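(* Let $X$ be a compact Kähler manifold. Then the map $\mathrm{Pic}(X)\to H^{1,1}(X,\mathbb{Z})$ sending a holomorphic line bundle to (the image in $H^2(X,\mathbb{C})$ of) its first Chern class is surjective; that is, every element of $H^{1,1}(X,\mathbb{Z})$ is the first Chern class of a holomorphic line bundle on $X$.
   Context: $\mathrm{Pic}(X)\cong H^1(X,\mathcal{O}_X^* )$ is the group of isomorphism classes of holomorphic line bundles on $X$. The first Chern class $c_1:\mathrm{Pic}(X)\to H^2(X,\mathbb{Z})$ is the connecting homomorphism of the exponential sequence $0\to\mathbb{Z}\to\mathcal{O}_X\to\mathcal{O}_X^*\to 0$, $f\mapsto\exp(2\pi\sqrt{-1}f)$. $H^{1,1}(X)\subset H^2(X,\mathbb{C})$ is the subspace of classes representable by closed forms of type $(1,1)$, and $H^{1,1}(X,\mathbb{Z})=\mathrm{im}\big(H^2(X,\mathbb{Z})\to H^2(X,\mathbb{C})\big)\cap H^{1,1}(X)$. *)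

(* Defs.v *)
From HB Require Import structures.
From mathcomp Require Import all_boot all_order all_algebra.
From mathcomp Require Import complex.
From mathcomp Require Import all_classical all_reals all_analysis.

Set Implicit Arguments.
Unset Strict Implicit.
Unset Printing Implicit Defensive.

Import Order.TTheory GRing.Theory Num.Theory numFieldNormedType.Exports.
Local Open Scope classical_set_scope.
Local Open Scope ring_scope.

(* The coercion to numClosedFieldType selects, for R[i] and for row vectors over
   R[i], the topology and the complex normed space structure defined by the
   modulus. *)
Definition Cplx (R : realType) : numClosedFieldType := R[i]%C.

Definition realC (R : realType) (x : R) : Cplx R := x%:C%C.

Definition cexp (R : realType) (z : Cplx R) : Cplx R :=
  realC (expR (complex.Re z)) *
    (realC (cos (complex.Im z)) + 'i * realC (sin (complex.Im z))).

(** * Real differential calculus on C^n *)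

Section RealCalculus.
Context {R : realType} {n : nat}.
Local Notation C := (Cplx R).
Local Notation V := 'rV[Cplx R]_n.
Implicit Types (f : V -> C) (v z : V) (W : set V).

Definition rquot f v z (t : R) : C :=
  (realC t)^-1 * (f (z + realC t *: v) - f z).

(* derivative along the real direction v: the increment t is real *)
Definition rderivable f v z : Prop := cvg (rquot f v z t @[t --> 0^']).
Definition rderive f v z : C := lim (rquot f v z t @[t --> 0^']).

(* On an open set W, C^k in the sense of the real structure of C^n = R^2n. *)
Fixpoint Ck (k : nat) W f : Prop :=
  (forall z, W z -> {for z, continuous f}) /\
  if k is k'.+1 then
    forall v, (forall z, W z -> rderivable f v z) /\ Ck k' W (rderive f v)
  else True.

Definition smooth W f : Prop := forall k, Ck k W f.

End RealCalculus.

(** * Complex manifolds *)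

(* cm_inv a is the inverse of the chart cm_chart a : cm_dom a -> C^n; both are
   total functions, whose values outside cm_dom a and its image are irrelevant.
   Complex differentiability on an open subset of C^n is holomorphy. *)
Record complexManifold (R : realType) (n : nat) := ComplexManifold {
  cm_space :> topologicalType;
  cm_idx : Type;
  cm_dom : cm_idx -> set cm_space;
  cm_chart : cm_idx -> cm_space -> 'rV[Cplx R]_n;
  cm_inv : cm_idx -> 'rV[Cplx R]_n -> cm_space;
  cm_hausdorff : hausdorff_space cm_space;
  cm_second_countable : @second_countable cm_space;
  cm_dom_open : forall a, open (cm_dom a);
  cm_cover : forall p, exists a, cm_dom a p;
  cm_img_open : forall a, open (cm_chart a @` cm_dom a);
  cm_chartK : forall a p, cm_dom a p -> cm_inv a (cm_chart a p) = p;
  cm_chart_cont : forall a p, cm_dom a p -> {for p, continuous (cm_chart a)};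
  cm_inv_cont : forall a z, (cm_chart a @` cm_dom a) z ->
    {for z, continuous (cm_inv a)};
  cm_trans_holo : forall a b z,
    (cm_chart a @` (cm_dom a `&` cm_dom b)) z ->
    differentiable (cm_chart b \o cm_inv a) z
}.

Arguments cm_idx {R n} c.
Arguments cm_dom {R n c} _ _.
Arguments cm_chart {R n c} _ _.
Arguments cm_inv {R n c} _ _.

Section Forms.
Context {R : realType} {n : nat}.
Variable X : complexManifold R n.
Local Notation C := (Cplx R).
Local Notation V := 'rV[Cplx R]_n.

Definition trans (a b : cm_idx X) : V -> V := cm_chart b \o cm_inv a.

(* the image in C^n, under the chart a, of the part of W it covers *)
Definition img (a : cm_idx X) (W : set X) : set V :=
  cm_chart a @` (cm_dom a `&` W).

Definition holomorphic (W : set X) (f : X -> C) : Prop :=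
  forall a z, img a W z -> differentiable (f \o cm_inv a : V -> C) z.

(** ** Complex-valued differential forms *)

(* A k-form is given by its expression in each chart: at z, a function of k
   tangent vectors, which are the rows of a k x n matrix. *)
Definition pform (k : nat) : Type := cm_idx X -> V -> 'M[C]_(k, n) -> C.

Definition rmultilinear k (w : 'M[C]_(k, n) -> C) : Prop :=
  forall i (b c : R) (A B D : 'M[C]_(k, n)),
    row i A = realC b *: row i B + realC c *: row i D ->
    row' i B = row' i A -> row' i D = row' i A ->
    w A = realC b * w B + realC c * w D.

Definition alternating k (w : 'M[C]_(k, n) -> C) : Prop :=
  forall (i j : 'I_k) A, i != j -> row i A = row j A -> w A = 0.

Definition pullback k (t : V -> V) (w : V -> 'M[C]_(k, n) -> C) :
    V -> 'M[C]_(k, n) -> C :=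
  fun z A => w (t z) (\matrix_i ('d t z (row i A) : V)).

(* smooth k-form on the open set W *)
Definition is_form k (W : set X) (w : pform k) : Prop :=
  [/\ forall a z, img a W z -> rmultilinear (w a z),
      forall a z, img a W z -> alternating (w a z),
      forall a A, smooth (img a W) (fun z => w a z A) &
      forall a b z A, img a (cm_dom b `&` W) z ->
        w a z A = pullback (trans a b) (w b) z A].

Definition form_eq k (W : set X) (w e : pform k) : Prop :=
  forall a z A, img a W z -> w a z A = e a z A.

Definition form0 (f : X -> C) : pform 0 := fun a z _ => f (cm_inv a z).

(* Exterior derivative: the invariant formula on constant vector fields. It goes
   with the convention (dx /\ dy)(u, v) = dx u * dy v - dx v * dy u. *)
Definition extd k (w : pform k) : pform k.+1 := fun a z A =>
  \sum_(i < k.+1) (-1) ^+ i * rderive (fun y => w a y (row' i A)) (row i A) z.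

Definition closed_form k (w : pform k) : Prop :=
  is_form setT w /\ form_eq setT (extd w) (fun _ _ _ => 0).

(* \sum_(j, k) h j k dz_j /\ dzbar_k, on the two rows of A *)
Definition dz_dzbar (h : 'M[C]_n) (A : 'M[C]_(2, n)) : C :=
  \sum_j \sum_k h j k *
    (A ord0 j * (A ord_max k)^* - A ord_max j * (A ord0 k)^*).

Definition type11 (w : pform 2) : Prop :=
  forall a z, img a setT z ->
    exists h : 'M[C]_n, forall A, w a z A = dz_dzbar h A.

Definition hermitian_pos (h : 'M[C]_n) : Prop :=
  (forall j k, h j k = (h k j)^*) /\
  forall u : V, u != 0 -> 0 < \sum_j \sum_k h j k * (u ord0 j * (u ord0 k)^*).

(* There is a hermitian metric \sum h_jk dz_j dzbar_k whose fundamental form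
   i/2 \sum h_jk dz_j /\ dzbar_k is closed. Since the form determines h, giving
   the metric amounts to giving the form. *)
Definition kahler : Prop :=
  exists2 w : pform 2, closed_form w &
    forall a z, img a setT z ->
      exists2 h : 'M[C]_n, hermitian_pos h &
        forall A, w a z A = dz_dzbar (('i / 2) *: h) A.

End Forms.

(** * Cech cohomology *)

(* Cech cohomology is the colimit over the open covers (U_x) indexed by the
   points of X, with x \in U_x (these are cofinal among all open covers). The
   refinement maps of the colimit are then mere restrictions. *)
Section Cech.
Variable X : topologicalType.

Record pcover := PCover {
  pc_set :> X -> set X;
  pc_open : forall x, open (pc_set x);
  pc_mem : forall x, pc_set x x
}.

Definition refines (U' U : pcover) : Prop := forall x, U' x `<=` U x.

Definition inter (U : pcover) q (s : 'I_q -> X) : set X :=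
  [set p | forall i, U (s i) p].

Definition cobd (M : zmodType) q (c : ('I_q.+1 -> X) -> M) :
    ('I_q.+2 -> X) -> M :=
  fun s => \sum_(i < q.+2) c (s \o lift i) *~ ((-1) ^+ i).

Definition loc_const (A : Type) (W : set X) (f : X -> A) : Prop :=
  forall p, W p -> \forall p' \near p, f p' = f p.

Lemma fct_mulrzE (A : zmodType) (g : X -> A) (m : int) p :
  (g *~ m) p = g p *~ m.
Proof.
have natE k : (g *+ k) p = g p *+ k.
  by elim: k => [|k IHk]; rewrite ?mulr0n // !mulrS -IHk.
by case: m => k; rewrite ?NegzE ?mulrNz -!pmulrn -natE.
Qed.

Lemma cobd_fun (A : zmodType) q (c : ('I_q.+1 -> X) -> X -> A) s p :
  cobd c s p = cobd (fun s => c s p) s.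
Proof.
by rewrite /cobd fct_sumE; apply: eq_bigr => i _; rewrite fct_mulrzE.
Qed.

Lemma cobdD (M : zmodType) q (c c' : ('I_q.+1 -> X) -> M) s :
  cobd (c \+ c') s = cobd c s + cobd c' s.
Proof. by rewrite -big_split; apply: eq_bigr => i _; rewrite mulrzDl. Qed.

Lemma cobd_raddf (M N : zmodType) (f : {additive M -> N}) q
  (c : ('I_q.+1 -> X) -> M) s : cobd (f \o c) s = f (cobd c s).
Proof. by rewrite raddf_sum; apply: eq_bigr => i _; rewrite raddfMz. Qed.

Lemma cobd0 (M : zmodType) q s : cobd (fun _ : 'I_q.+1 -> X => 0 : M) s = 0.
Proof. by rewrite /cobd big1 // => i _; rewrite mul0rz. Qed.

Section Degree2.
Variable A : zmodType.

(* Cech 2-cocycles of the constant sheaf A: the section over U_s is a locally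
   constant function, whose values outside U_s are irrelevant. *)
Record cocycle2 := Cocycle2 {
  c2_cover : pcover;
  c2_val :> ('I_3 -> X) -> X -> A;
  c2_loc : forall s, loc_const (inter c2_cover s) (c2_val s);
  c2_closed : forall s p, inter c2_cover s p -> cobd c2_val s p = 0
}.

HB.instance Definition _ := gen_eqMixin cocycle2.
HB.instance Definition _ := gen_choiceMixin cocycle2.

Definition cohomologous (c c' : cocycle2) : Prop :=
  exists (U : pcover) (b : ('I_2 -> X) -> X -> A),
    [/\ refines U (c2_cover c) /\ refines U (c2_cover c'),
        forall s, loc_const (inter U s) (b s) &
        forall s p, inter U s p -> c s p - c' s p = cobd b s p].

Definition cohomologousb (c c' : cocycle2) : bool := `[< cohomologous c c' >].

Lemma pcoverI_open (U U' : pcover) x : open (U x `&` U' x).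
Proof. by apply: openI; exact: pc_open. Qed.

Lemma pcoverI_mem (U U' : pcover) x : (U x `&` U' x) x.
Proof. by split; exact: pc_mem. Qed.

Definition pcoverI (U U' : pcover) : pcover :=
  PCover (pcoverI_open U U') (pcoverI_mem U U').

Lemma cohomologous_refl c : cohomologous c c.
Proof.
exists (c2_cover c), (fun _ _ => 0); split=> [|s|s p _].
- by split=> x p.
- by move=> p _; near=> q.
- by rewrite subrr cobd_fun cobd0.
Unshelve. all: by end_near. Qed.

Lemma cohomologous_sym c c' : cohomologous c c' -> cohomologous c' c.
Proof.
move=> [U [b [[Uc Uc'] bl bE]]].
exists U, (fun s p => - b s p); split=> //.
- by move=> s p /bl; apply: filterS => q ->.
- move=> s p /bE; rewrite !cobd_fun => /(congr1 -%R); rewrite opprB => ->.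
  by rewrite -(cobd_raddf -%R).
Qed.

Lemma cohomologous_trans c1 c2 c3 :
  cohomologous c1 c2 -> cohomologous c2 c3 -> cohomologous c1 c3.
Proof.
move=> [U [b [[U1 U2] bl bE]]] [U' [b' [[U1' U2'] bl' bE']]].
exists (pcoverI U U'), (fun s p => b s p + b' s p); split.
- by split=> x p [] => [/U1//|_ /U2'].
- move=> s p Us.
  have /bl h : inter U s p by move=> i; case: (Us i).
  have /bl' h' : inter U' s p by move=> i; case: (Us i).
  by apply: filterS2 h h' => q -> ->.
- move=> s p Us.
  have /bE h : inter U s p by move=> i; case: (Us i).
  have /bE' h' : inter U' s p by move=> i; case: (Us i).
  rewrite cobd_fun (cobdD (fun s => b s p) (fun s => b' s p)) -!cobd_fun.
  by rewrite -h -h' addrA subrK.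
Qed.

Lemma cohomologousb_equiv : equiv_class_of cohomologousb.
Proof.
split=> [c|c c'|c2 c1 c3].
- exact/asboolP/cohomologous_refl.
- by apply/asboolP/asboolP => /cohomologous_sym.
- by move=> /asboolP h12 /asboolP h23; apply/asboolP/(cohomologous_trans h12).
Qed.

Canonical cohomologousb_canonical := EquivRelPack cohomologousb_equiv.

Definition H2 : Type := {eq_quot cohomologousb}%qT.
HB.instance Definition _ := Choice.on H2.
HB.instance Definition _ := EqQuotient.on H2.

Definition H2_class (c : cocycle2) : H2 := (\pi_H2 c)%qT.

Lemma H2_classP c c' : H2_class c = H2_class c' <-> cohomologous c c'.
Proof. by split=> [/eqmodP/asboolP|h]; last exact/eqmodP/asboolP. Qed.

Lemma trivial_cover_mem (x : X) : [set: X] x. Proof. by []. Qed.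

Definition cocycle2_0 : cocycle2.
Proof.
apply: (@Cocycle2 (PCover (fun=> openT) trivial_cover_mem) (fun _ _ => 0)).
- by move=> s p _; near=> q.
- by move=> s p _; rewrite cobd_fun cobd0.
Unshelve. all: by end_near. Defined.

End Degree2.

(* change of coefficients along f : A -> B *)
Section Functoriality.
Variables (A B : zmodType) (f : {additive A -> B}).

Lemma cocycle2_map_loc (c : cocycle2 A) s :
  loc_const (inter (c2_cover c) s) (f \o c s).
Proof. by move=> p /c2_loc; apply: filterS => q /= ->. Qed.

Lemma cocycle2_map_closed (c : cocycle2 A) s p :
  inter (c2_cover c) s p -> cobd (fun s => f \o c s) s p = 0.
Proof.
move=> /c2_closed h; rewrite cobd_fun.
by rewrite (cobd_raddf f (fun s => c s p)) -cobd_fun h raddf0.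
Qed.

Definition cocycle2_map (c : cocycle2 A) : cocycle2 B :=
  Cocycle2 (@cocycle2_map_loc c) (@cocycle2_map_closed c).

Definition H2_map (x : H2 A) : H2 B := H2_class (cocycle2_map (repr x)).

Lemma H2_map_class c : H2_map (H2_class c) = H2_class (cocycle2_map c).
Proof.
apply/H2_classP.
have /H2_classP[U [b [Uc bl bE]]] : H2_class (repr (H2_class c)) = H2_class c.
  exact: reprK.
exists U, (fun s => f \o b s); split=> //.
- by move=> s p /bl; apply: filterS => q /= ->.
- move=> s p /bE /= h; rewrite -raddfB h !cobd_fun.
  by rewrite (cobd_raddf f (fun s => b s p)).
Qed.

End Functoriality.
End Cech.

Arguments H2 X A : clear implicits.
Arguments cocycle2 X A : clear implicits.

Section Lefschetz.
Context {R : realType} {n : nat}.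
Variable X : complexManifold R n.
Local Notation C := (Cplx R).

(** * The Hodge subspace H^{1,1} *)

(* The isomorphism between the de Rham and Cech cohomologies with complex
   coefficients, by descent in the Cech-de Rham double complex: w = d theta_x on
   U_x, theta_y - theta_x = d f_xy on U_xy, and c_xyz = f_yz - f_xz + f_xy.
   Another sign convention would replace c by - c, which changes neither
   H11 nor H11Z. *)
Definition deRham_cech (w : pform X 2) (c : cocycle2 X C) : Prop :=
  let W q (s : 'I_q -> X) := inter (c2_cover c) s in
  exists (theta : ('I_1 -> X) -> pform X 1) (f : ('I_2 -> X) -> X -> C),
    [/\ forall s, is_form (W _ s) (theta s) /\
                  form_eq (W _ s) (extd (theta s)) w,
        forall s, is_form (W _ s) (form0 (f s)) /\
                  form_eq (W _ s) (extd (form0 (f s))) (cobd theta s) &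
        forall s p, W _ s p -> c s p = cobd f s p].

Definition H11 : set (H2 X C) :=
  [set x | exists (w : pform X 2) (c : cocycle2 X C),
     [/\ closed_form w, type11 w, deRham_cech w c & H2_class c = x]].

Definition H2_ZC : H2 X int -> H2 X C := H2_map (intr : {additive int -> C}).

Definition H11Z : set (H2 X C) := range H2_ZC `&` H11.

(** * Holomorphic line bundles *)

(* The fibres are complex vector spaces, and over each open set lb_dom i of a
   cover there is a linear trivialization; the transition functions between two
   trivializations are holomorphic. The topology and the complex structure of
   the total space are those given by the trivializations. *)
Record line_bundle := LineBundle {
  lb_fib : X -> lmodType C;
  lb_idx : Type;
  lb_dom : lb_idx -> set X;
  lb_triv : forall (i : lb_idx) (p : X), {linear lb_fib p -> C^o};
  lb_dom_open : forall i, open (lb_dom i);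
  lb_cover : forall p, exists i, lb_dom i p;
  lb_triv_bij : forall i p, lb_dom i p -> bijective (lb_triv i p);
  lb_trans : forall i j, exists2 g : X -> C,
    holomorphic (lb_dom i `&` lb_dom j) g &
    forall p (v : lb_fib p), lb_dom i p -> lb_dom j p ->
      lb_triv i p v = g p * lb_triv j p v
}.

Arguments lb_triv : clear implicits.

Definition lb_iso (L L' : line_bundle) : Prop :=
  exists F : forall p, {linear lb_fib L p -> lb_fib L' p},
    (forall p, bijective (F p)) /\
    forall (i : lb_idx L) (j : lb_idx L'), exists2 h : X -> C,
      holomorphic (lb_dom i `&` lb_dom j) h &
      forall p (v : lb_fib L p), lb_dom i p -> lb_dom j p ->
        lb_triv L' j p (F p v) = h p * lb_triv L i p v.

(* Isomorphism classes of line bundles. The fibres range over a universe, so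
   that line_bundle is too large a type for the generic quotients. *)
Definition Pic : Type := {P : line_bundle -> Prop | exists L, P = lb_iso L}.

Definition Pic_class (L : line_bundle) : Pic :=
  exist _ (lb_iso L) (ex_intro _ L erefl).

(* The connecting homomorphism of 0 -> Z -> O -> O* -> 0, where the inclusion of
   Z is followed by f |-> exp(2 pi i f), applied to the transition cocycle g_xy
   of L on a cover finer than that of the trivializations:
   g_xy = exp(2 pi i f_xy), with f_xy holomorphic on U_xy, and
   c_xyz = f_yz - f_xz + f_xy. *)
Definition chern_cocycle (L : line_bundle) (c : cocycle2 X int) : Prop :=
  let W q (s : 'I_q -> X) := inter (c2_cover c) s in
  exists (i : X -> lb_idx L) (f : ('I_2 -> X) -> X -> C),
    [/\ forall x, c2_cover c x `<=` lb_dom (i x),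
        forall s, holomorphic (W _ s) (f s),
        forall s p (v : lb_fib L p), W _ s p ->
          lb_triv L (i (s ord0)) p v =
          cexp (2 * realC pi * 'i * f s p) * lb_triv L (i (s ord_max)) p v &
        forall s p, W _ s p -> (c s p)%:~R = cobd f s p].

(* On a compact Hausdorff X every line bundle has a Chern cocycle, and the
   cocycles of isomorphic line bundles are cohomologous: the default value of
   xget is not used. *)
Definition c1 (P : Pic) : H2 X int :=
  xget (H2_class (cocycle2_0 X int))
    [set x | exists (L : line_bundle) (c : cocycle2 X int),
       [/\ sval P L, chern_cocycle L c & H2_class c = x]].

End Lefschetz.

(* Main.v *)
Require Import Defs.
From HB Require Import structures.
From mathcomp Require Import all_boot all_order all_algebra.
From mathcomp Require Import complex.
From mathcomp Require Import all_classical all_reals all_analysis.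
From mathcomp Require Import ring lra.

Set Implicit Arguments.
Unset Strict Implicit.
Unset Printing Implicit Defensive.

Import Order.TTheory GRing.Theory Num.Theory numFieldNormedType.Exports.
Local Open Scope classical_set_scope.
Local Open Scope ring_scope.

(* Let an integral cocycle [b] and a closed (1,1)-form [w] represent the same class:
   [w = d theta_x], [theta_y - theta_x = d f_xy] and [b = delta (f - e)] with [e]
   locally constant. Since [w] is of type (1,1), the (0,1)-part of [theta_x] is
   dbar-closed, hence near x it is [dbar u_x] by the local Dolbeault lemma. Then
   [f'_xy := f_xy - e_xy - (u_y - u_x)] is holomorphic, as its differential is complex linear,
   and its coboundary is still [b]; so the functions [exp (2 pi i f'_xy)]
   are the transition functions of a line bundle with Chern cocycle [b].
   The primitives [u_x] come from iterated Cauchy transforms of cut-off coefficients,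
   which only need finite regularity. *)

(** The analytic obstacle is the construction of [u_x]. The Cauchy transform is taken as two nested
    one-variable integrals in polar coordinates, where the Jacobian [r] cancels the singularity of
    the kernel. The integral [J] is an antiderivative normalised at 0, so that all estimates reduce
    to the mean value inequality, and the regularity of the transform comes from its commuting with
    translations. The dbar-equation is solved one coordinate at a time. Each step subtracts the dbar
    of a partial solution and so costs one derivative: data of class [C^(n+1)] and cutoffs of finite
    regularity are enough. Type (1,1) enters only through the behaviour of [w] under multiplication
    of its arguments by ['i]. Covers are indexed by points, so passing to the neighbourhoods where
    the [u_x] live is a mere restriction, and the bundle needs no gluing quotient: the fibre at [p]
    is normalised by the trivialization with index [p]. As [c1] selects an arbitrary Chern cocycle
    of an arbitrary isomorphic bundle, the independence of these choices has to be proved as well;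
    this is where logarithms are needed. *)

(* Abstracting over the field of complex numbers keeps unification from unfolding
   the structures of [R[i]]. *)
Class cplx (R : realType) (C : numClosedFieldType) := {
  ofR : R -> C;
  re : C -> R;
  im : C -> R;
  ofRD : forall a b, ofR (a + b) = ofR a + ofR b;
  ofRM : forall a b, ofR (a * b) = ofR a * ofR b;
  ofR1 : ofR 1 = 1;
  ofR_le : forall a b, (ofR a <= ofR b) = (a <= b);
  normE : forall z : C, `|z| = ofR (re `|z|);
  cplxE : forall z, z = ofR (re z) + 'i * ofR (im z);
  reD : forall z w, re (z + w) = re z + re w;
  imD : forall z w, im (z + w) = im z + im w;
  reM : forall z w, re (z * w) = re z * re w - im z * im w;
  imM : forall z w, im (z * w) = re z * im w + im z * re w;
  re_ofR : forall a, re (ofR a) = a;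
  im_ofR : forall a, im (ofR a) = 0;
  re_i : re 'i = 0;
  im_i : im 'i = 1;
  re_norm : forall z, `|re z| <= re `|z|
}.

(** The instance is transparent because [Ck_cC], [cexpE] and [cexp_e2] identify the abstract notions
    with those of the statement by conversion. *)
#[global] Instance cplx_Cplx (R : realType) : cplx R (Cplx R).
Proof.
apply: (@Build_cplx R (Cplx R) (@realC R) (@complex.Re R) (@complex.Im R)).
- by move=> a b; rewrite /realC rmorphD.
- by move=> a b; rewrite /realC rmorphM.
- by [].
- exact: lecR.
- by move=> z; rewrite normc_def.
- by move=> z; rewrite -complexiE; exact: complexE.
- by move=> z w; rewrite raddfD.
- by move=> z w; rewrite raddfD.
- by case=> a b [c d].
- by case=> a b [c d].
- by [].
- by [].
- by rewrite -complexiE.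
- by rewrite -complexiE.
- move=> z; rewrite -lecR; apply: le_trans (normc_ge_Re z) _.
  by rewrite normc_def.
Defined.

(** * Curves in the complex plane *)

Section ComplexPlane.
Context {R : realType} {C : numClosedFieldType} {S : cplx R C}.
Implicit Types (z w : C) (a b : R).

Lemma ofR0 : ofR 0 = 0 :> C.
Proof. by apply: (addrI (ofR 0)); rewrite -ofRD !addr0. Qed.

Lemma ofRN a : ofR (- a) = - ofR a :> C.
Proof. by apply: (addrI (ofR a)); rewrite -ofRD !subrr ofR0. Qed.

Lemma ofRB a b : ofR (a - b) = ofR a - ofR b :> C.
Proof. by rewrite ofRD ofRN. Qed.

Lemma ofR_inj : injective (@ofR R C S).
Proof. by move=> a b /(congr1 re); rewrite !re_ofR. Qed.

Lemma ofR_eq0 a : (ofR a == 0 :> C) = (a == 0).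
Proof. by rewrite -ofR0 (inj_eq ofR_inj). Qed.

Lemma ofR_lt a b : (ofR a < ofR b :> C) = (a < b).
Proof. by rewrite !lt_def ofR_le (inj_eq ofR_inj). Qed.

Lemma ofRV a : ofR a^-1 = (ofR a)^-1 :> C.
Proof.
have [->|a0] := eqVneq a 0; first by rewrite invr0 ofR0 invr0.
apply: (@mulfI _ (ofR a)); first by rewrite ofR_eq0.
by rewrite -ofRM !divff ?ofR_eq0// ofR1.
Qed.

Lemma reN z : re (- z) = - re z.
Proof.
apply: (addrI (re z)); rewrite -reD !subrr.
by rewrite -ofR0 re_ofR.
Qed.

Lemma imN z : im (- z) = - im z.
Proof.
apply: (addrI (im z)); rewrite -imD !subrr.
by rewrite -ofR0 im_ofR.
Qed.

Lemma reim_inj z w : re z = re w -> im z = im w -> z = w.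
Proof. by move=> h1 h2; rewrite (cplxE z) (cplxE w) h1 h2. Qed.

Lemma re_iM z : re ('i * z) = - im z.
Proof. by rewrite reM re_i im_i mul0r sub0r mul1r. Qed.

Lemma im_iM z : im ('i * z) = re z.
Proof. by rewrite imM re_i im_i mul0r add0r mul1r. Qed.

(** The norm of [C] takes values in [C]; estimates are carried out in [R], where real analysis and
    [lra] apply. *)
Definition cm z : R := re `|z|.

Lemma cmE z : `|z| = ofR (cm z).
Proof. exact: normE. Qed.

Lemma cm_ge0 z : 0 <= cm z.
Proof. by rewrite -(@ofR_le R C) -cmE ofR0 normr_ge0. Qed.

Lemma cm0 : cm 0 = 0. Proof. by rewrite /cm normr0 -ofR0 re_ofR. Qed.

Lemma cmD z w : cm (z + w) <= cm z + cm w.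
Proof. by rewrite -(@ofR_le R C) ofRD -!cmE ler_normD. Qed.

Lemma cmN z : cm (- z) = cm z. Proof. by rewrite /cm normrN. Qed.

Lemma cmBC z w : cm (z - w) = cm (w - z).
Proof. by rewrite -opprB cmN. Qed.

Lemma cmB z w : cm (z - w) <= cm z + cm w.
Proof. by rewrite -[cm w]cmN cmD. Qed.

Lemma cmM z w : cm (z * w) = cm z * cm w.
Proof. by apply: ofR_inj; rewrite -cmE normrM !cmE -ofRM. Qed.

Lemma cmV z : cm z^-1 = (cm z)^-1.
Proof. by apply: ofR_inj; rewrite -cmE normfV !cmE -ofRV. Qed.

Lemma cm_ofR a : cm (ofR a) = `|a|.
Proof.
apply: ofR_inj; rewrite -cmE; have [a0|a0] := leP 0 a.
  by rewrite !ger0_norm// -ofR0 ofR_le.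
by rewrite !ltr0_norm ?ofRN// -ofR0 ofR_lt.
Qed.

Lemma cmi : cm 'i = 1.
Proof. by apply: ofR_inj; rewrite -cmE normCi ofR1. Qed.

Lemma cm_eq0 z : (cm z == 0) = (z == 0).
Proof. by rewrite -ofR_eq0 -cmE normr_eq0. Qed.

Lemma cm_re z : `|re z| <= cm z. Proof. exact: re_norm. Qed.

Lemma cm_im z : `|im z| <= cm z.
Proof. by rewrite -normrN -re_iM (le_trans (cm_re _))// cmM cmi mul1r. Qed.

Lemma cm_le z : cm z <= `|re z| + `|im z|.
Proof.
rewrite {1}(cplxE z); apply: (le_trans (cmD _ _)).
by rewrite cmM cmi mul1r !cm_ofR.
Qed.

Lemma cm_sum (I : Type) (r : seq I) (P : pred I) (F : I -> C) :
  cm (\sum_(i <- r | P i) F i) <= \sum_(i <- r | P i) cm (F i).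
Proof.
elim/big_ind2: _ => [|x y z w xy zw|//]; first by rewrite cm0.
by apply: (le_trans (cmD _ _)); exact: lerD.
Qed.

Lemma cvgCP (T : Type) (F : set_system T) (FF : Filter F) (f : T -> C) (l : C) :
  f x @[x --> F] --> l <->
  forall e : R, 0 < e -> \forall x \near F, cm (f x - l) <= e.
Proof.
split=> [/cvgrPdist_le h e e0|h].
  have e0' : (0 : C) < ofR e by rewrite -ofR0 ofR_lt.
  have := h _ e0'; apply: filterS => x.
  by rewrite cmE ofR_le cmBC.
apply/cvgrPdist_le => e e0.
have eE : e = ofR (cm e) by rewrite -cmE gtr0_norm.
have ce0 : 0 < cm e by rewrite -ofR_lt -eE ofR0.
by have := h (cm e) ce0; apply: filterS => x; rewrite eE cmE ofR_le cmBC -eE.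
Qed.

Lemma nbhs0R (P : R -> Prop) : (\forall s \near (0 : R), P s) <->
  exists2 d : R, 0 < d & forall s, `|s| < d -> P s.
Proof.
split.
  move=> /nbhs_ballP[d /= d0 h]; exists d => // s sd; apply: h.
  by rewrite /ball /= sub0r normrN.
move=> [d d0 h]; apply/nbhs_ballP; exists d => // s.
by rewrite /ball /= sub0r normrN; exact: h.
Qed.

Lemma dnbhs0R (P : R -> Prop) : (\forall s \near (0 : R)^', P s) <->
  exists2 d : R, 0 < d & forall s, `|s| < d -> s != 0 -> P s.
Proof.
rewrite /dnbhs; split; first by move=> /nbhs0R[d d0 h]; exists d => // s /h.
by move=> [d d0 h]; apply/nbhs0R; exists d => // s /h.
Qed.

(** Stated without a quotient, so that the estimate includes [s = 0] and can be made uniform in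
    parameters and integrated; [cderP] relates it to difference quotients. *)
Definition cder (F : R -> C) (t : R) (l : C) : Prop :=
  forall e : R, 0 < e -> exists2 d : R, 0 < d &
    forall s, `|s| < d -> cm (F (t + s) - F t - ofR s * l) <= e * `|s|.

Definition ccont (F : R -> C) : Prop :=
  forall t (e : R), 0 < e -> exists2 d : R, 0 < d &
    forall s, `|s| < d -> cm (F (t + s) - F t) <= e.

Lemma cderP F t l :
  cder F t l <-> (ofR s)^-1 * (F (t + s) - F t) @[s --> 0^'] --> l.
Proof.
have E (s : R) : s != 0 -> cm ((ofR s)^-1 * (F (t + s) - F t) - l) =
    `|s|^-1 * cm (F (t + s) - F t - ofR s * l).
  move=> s0; rewrite -(cm_ofR s) -cmV -cmM [in RHS]mulrBr mulKf//; last by rewrite ofR_eq0.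
split=> [h|/cvgCP h e e0].
  apply/cvgCP => e /h[d d0 hd]; apply/dnbhs0R; exists d => // s sd s0.
  by rewrite E// mulrC ler_pdivrMr ?normr_gt0// hd.
have /dnbhs0R[d d0 hd] := h e e0; exists d => // s sd.
have [->|s0] := eqVneq s 0; first by rewrite addr0 subrr ofR0 mul0r subr0 cm0 normr0 mulr0.
by have := hd s sd s0; rewrite E// mulrC ler_pdivrMr ?normr_gt0.
Qed.

Lemma cder_Re F (t : R) l : cder F t l ->
  is_derive t (1 : R) (re \o F) (re l).
Proof.
move=> h.
have H : h^-1 *: (((re \o F) \o shift t) (h *: 1) -
   (re \o F) t) @[h --> 0^'] --> re l.
  apply/cvgrPdist_le => e /h[d d0 hd]; apply/dnbhs0R; exists d => // s sd s0.
  rewrite /= [s *: _]mulr1 addrC (addrC s) [_ *: _]mulrC.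
  have := hd s sd; rewrite -ler_pdivrMr ?normr_gt0//.
  apply: le_trans; rewrite ler_pdivlMr ?normr_gt0// -normrM.
  apply: le_trans (cm_re _); rewrite !reD !reN reM re_ofR im_ofR mul0r subr0.
    rewrite (_ : _ * s = - (re (F (t + s)) - re (F t) - s * re l)) ?normrN//.
  by field.
by apply: DeriveDef; [apply/cvg_ex; eexists; exact: H|exact/cvg_lim].
Qed.

Lemma cderZ F t l (a : C) : cder F t l -> cder (fun t => a * F t) t (a * l).
Proof.
move=> h e e0.
have k0 : 0 < cm a + 1 by rewrite ltr_wpDl ?cm_ge0.
have [d d0 hd] := h (e / (cm a + 1)) (divr_gt0 e0 k0).
exists d => // s /hd {}hd; rewrite -mulrBr mulrCA -mulrBr cmM.
apply: (@le_trans _ _ ((cm a + 1) * (e / (cm a + 1) * `|s|))).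
  by apply: ler_pM => //; rewrite ?cm_ge0// lerDl.
by rewrite mulrA [_ * (e / _)]mulrC divfK// gt_eqF.
Qed.

Lemma cderD F G t l m : cder F t l -> cder G t m ->
  cder (fun t => F t + G t) t (l + m).
Proof.
move=> hF hG e e0; have e2 : 0 < e / 2 by rewrite divr_gt0.
have [d d0 hd] := hF _ e2; have [d' d0' hd'] := hG _ e2.
exists (Num.min d d'); rewrite ?lt_min ?d0// => s.
rewrite lt_min => /andP[/hd h /hd' h'].
rewrite (_ : _ - _ = (F (t + s) - F t - ofR s * l) +
  (G (t + s) - G t - ofR s * m)); last by ring.
apply: (le_trans (cmD _ _)); apply: (le_trans (lerD h h')).
by rewrite -mulrDl -splitr.
Qed.

Lemma cder_ext F G t l : (forall s, F s = G s) -> cder F t l -> cder G t l.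
Proof. by move=> /funext ->. Qed.

Lemma cderN F t l : cder F t l -> cder (fun t => - F t) t (- l).
Proof.
move=> /(cderZ (-1)); rewrite mulN1r; apply: cder_ext => s.
by rewrite mulN1r.
Qed.

Lemma cderB F G t l m : cder F t l -> cder G t m ->
  cder (fun t => F t - G t) t (l - m).
Proof. by move=> hF /cderN; exact: cderD. Qed.

Lemma cder_cst (a : C) t : cder (fun=> a) t 0.
Proof.
by move=> e e0; exists 1 => // s _; rewrite subrr mulr0 subr0 cm0 mulr_ge0// ltW.
Qed.

Lemma cder_lin (a : C) t : cder (fun t => ofR t * a) t a.
Proof.
move=> e e0; exists 1 => // s _.
rewrite ofRD (_ : _ - _ = 0); last by ring.
by rewrite cm0 mulr_ge0// ltW.
Qed.

Lemma cder_Im F (t : R) l : cder F t l ->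
  is_derive t (1 : R) (im \o F) (im l).
Proof.
move=> /(cderZ (- 'i)) /cder_Re.
rewrite (_ : re (_ * _) = im l); last first.
  by rewrite reM reN imN re_i im_i oppr0 mul0r sub0r mulN1r opprK.
rewrite (_ : (_ \o _) = im \o F)//; apply/funext => s /=.
by rewrite reM reN imN re_i im_i oppr0 mul0r sub0r mulN1r opprK.
Qed.

Lemma is_derive_cder (F : R -> C) (t : R) l :
  is_derive t (1 : R) (re \o F) (re l) ->
  is_derive t (1 : R) (im \o F) (im l) -> cder F t l.
Proof.
have real (f : R -> R) (m : R) : is_derive t (1 : R) f m ->
    cder (fun s => ofR (f s)) t (ofR m).
  move=> [df dfE]; apply/cderP/cvgCP => e e0.
  have : h^-1 *: ((f \o shift t) (h *: 1) - f t) @[h --> 0^'] --> m.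
    by move/cvg_ex: df => [x hx]; rewrite -dfE /derive (cvg_lim _ hx).
  move=> /cvgrPdist_le/(_ e e0); apply: filterS => s /=.
  rewrite -ofRB -ofRV -ofRM -ofRB cm_ofR distrC.
  by  rewrite [s%:A]mulr1 (addrC t).
move=> /real hR /real/(cderZ 'i) hI.
rewrite (cplxE l); apply: cder_ext (cderD hR hI) => s /=.
by rewrite -cplxE.
Qed.

Lemma cder_ccont (F G : R -> C) : (forall t, cder F t (G t)) -> ccont F.
Proof.
move=> h t e e0.
have [d d0 hd] := h t 1 ltr01.
have k0 : 0 < 1 + cm (G t) by rewrite ltr_pwDl ?cm_ge0.
exists (Num.min d (e / (1 + cm (G t)))); rewrite ?lt_min ?d0 ?divr_gt0// => s.
rewrite lt_min => /andP[/hd sd /ltW se].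
rewrite -[X in cm X](subrK (ofR s * G t)); apply: (le_trans (cmD _ _)).
rewrite cmM cm_ofR mul1r in sd *.
apply: (@le_trans _ _ (`|s| * (1 + cm (G t)))).
  by rewrite mulrDr mulr1 lerD2r.
by rewrite -ler_pdivlMr.
Qed.

Lemma mean_value_real (f df : R -> R) (x K : R) :
  (forall t : R, `|t| <= `|x| -> is_derive t (1 : R) f (df t)) ->
  (forall t, `|t| <= `|x| -> `|df t| <= K) -> `|f x - f 0| <= K * `|x|.
Proof.
move=> hd hK.
have D a b (t : R) : t \in `[a, b] -> `|a| <= `|x| -> `|b| <= `|x| -> `|t| <= `|x|.
  rewrite in_itv/= => /andP[ta tb]; rewrite !ler_norml => /andP[ax ax'] /andP[bx bx'].
  by rewrite (le_trans ax)//= (le_trans tb).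
have M a b : a <= b -> `|a| <= `|x| -> `|b| <= `|x| ->
    `|f b - f a| <= K * (b - a).
  move=> ab ax bx.
  have hd' t : t \in `]a, b[ -> is_derive t (1 : R) f (df t).
    by move=> /subset_itv_oo_cc/D h; apply/hd/h.
  have cf : {within `[a, b], continuous f}.
    apply: continuous_in_subspaceT => t /[1!inE] /D h.
    have [+ _] := hd t (h ax bx).
    by move=> /derivable1_diffP/differentiable_continuous.
  have [c cab ->] := MVT_segment ab hd' cf.
  rewrite normrM [`|b - a|]ger0_norm ?subr_ge0// ler_wpM2r ?subr_ge0//.
  by apply/hK/(D _ _ _ cab).
have [x0|x0] := leP 0 x.
  by have := M 0 x x0; rewrite normr0 normr_ge0 subr0 [`|x|]ger0_norm//; exact.
have := M x 0 (ltW x0); rewrite normr0 normr_ge0 sub0r distrC.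
by rewrite [in _ * `|x|]ltr0_norm//; exact.
Qed.

(** The real inequality is applied to [re] and [im] separately, whence the factor 2. It is the
    source of most powers of 2 in the constants below. *)
Lemma mean_value (F G : R -> C) (x K : R) :
  (forall t, `|t| <= `|x| -> cder F t (G t)) ->
  (forall t, `|t| <= `|x| -> cm (G t) <= K) ->
  cm (F x - F 0) <= 2 * K * `|x|.
Proof.
move=> hd hK; apply: (le_trans (cm_le _)).
have -> : 2 * K * `|x| = K * `|x| + K * `|x| by ring.
rewrite !reD !imD !reN !imN; apply: lerD.
  apply: (@mean_value_real (re \o F) (re \o G)) => t tx.
    exact/cder_Re/hd.
  by apply: (le_trans (cm_re _)); exact: hK.
apply: (@mean_value_real (im \o F) (im \o G)) => t tx.
  exact/cder_Im/hd.
by apply: (le_trans (cm_im _)); exact: hK.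
Qed.

Lemma cder0_eq (F : R -> C) (x : R) :
  (forall t, `|t| <= `|x| -> cder F t 0) -> F x = F 0.
Proof.
move=> h; apply/eqP; rewrite -subr_eq0 -cm_eq0 eq_le cm_ge0 andbT.
have := @mean_value F (fun=> 0) x 0 h; rewrite mulr0 mul0r; apply.
by move=> t _; rewrite cm0.
Qed.

(** * Antiderivatives and integrals of continuous curves *)

Lemma is_derive_shift0 (f : R -> R) (t l : R) :
  derivable f t 1 -> f^`()%classic t = l -> is_derive t (1 : R) f l.
Proof. by move=> df <-; apply: DeriveDef => //; rewrite derive1E. Qed.

Lemma antiderivative_real_bounded (g : R -> R) (B : R) : 0 < B ->
  (forall t, {for t, continuous g}) ->
  exists F : R -> R, F 0 = 0 /\
    forall t : R, `|t| < B -> is_derive t (1 : R) F (g t).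
Proof.
move=> B0 cg.
have ig : lebesgue_measure.-integrable `[-B, B]%classic (EFin \o g).
  apply: continuous_compact_integrable; first exact: segment_compact.
  by apply: continuous_subspaceT => t; exact: cg.
pose F0 x := \int[lebesgue_measure]_(t in `[-B, x]) g t.
exists (fun x => F0 x - F0 0); split; first by rewrite subrr.
move=> t tB.
have [tB1 tB2] : - B < t /\ t < B by move: tB; rewrite ltr_norml => /andP[].
have [d1 d2] := @continuous_FTC1 R g (BLeft (- B)) t B tB2 ig tB1 (cg t).
have D := is_derive_shift0 d1 d2.
have := is_deriveB D (is_derive_cst (F0 0) t (1 : R)).
by rewrite subr0.
Qed.

(** The antiderivatives on the intervals []-B, B[] all vanish at 0, hence agree where they overlap.
    The value at [x] is read from the interval with [B = |x| + 1]. *)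
Lemma antiderivative_real (g : R -> R) : (forall t, {for t, continuous g}) ->
  exists F : R -> R, F 0 = 0 /\ forall t : R, is_derive t (1 : R) F (g t).
Proof.
move=> cg.
have E (B : R) : exists F : R -> R, 0 < B -> F 0 = 0 /\
    forall t : R, `|t| < B -> is_derive t (1 : R) F (g t).
  have [B0|B0] := ltP 0 B; last first.
        by exists (fun=> 0).
  by have [F hF] := antiderivative_real_bounded B0 cg; exists F.
have [F hF] := choice E.
have U B B' (x : R) : `|x| < B -> `|x| < B' -> F B x = F B' x.
  move=> xB xB'.
  have [F0 dF] := hF B (le_lt_trans (normr_ge0 _) xB).
  have [F0' dF'] := hF B' (le_lt_trans (normr_ge0 _) xB').
  apply/eqP; rewrite -subr_eq0 -normr_le0.
  have := @mean_value_real (F B \- F B') (fun=> 0) x 0.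
  rewrite /= F0 F0' subrr subr0 mul0r; apply => t tx; last by rewrite normr0.
  rewrite -(subrr (g t)); apply: is_deriveB.
    exact/dF/(le_lt_trans tx).
  exact/dF'/(le_lt_trans tx).
have lt1 (x : R) : `|x| < `|x| + 1 by rewrite ltrDl.
exists (fun x => F (`|x| + 1) x); split.
  by have [-> //] := hF (`|0| + 1) (le_lt_trans (normr_ge0 _) (lt1 0)).
move=> t.
have B0 : 0 < `|t| + 1 := le_lt_trans (normr_ge0 _) (lt1 t).
have [_ /(_ t (lt1 t)) D] := hF _ B0.

apply: (near_eq_is_derive _ D).
apply/nbhs_ballP; exists 1 => //= s; rewrite /ball /= => st.
apply: U => //; rewrite distrC in st.
by rewrite -[s](subrK t) addrC (le_lt_trans (ler_normD _ _))// ltrD2l.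
Qed.

Lemma ccont_Re (f : R -> C) : ccont f -> forall t, {for t, continuous (re \o f)}.
Proof.
move=> cf t; apply/cvgrPdist_le => e /(cf t)[d d0 hd].
apply/nbhs_ballP; exists d => //= s; rewrite /ball /= distrC => /hd h.
have tE : t + (s - t) = s by rewrite addrC subrK.
rewrite tE in h.
by rewrite distrC -reN -reD (le_trans (cm_re _)).
Qed.

Lemma ccontZ (f : R -> C) (a : C) : ccont f -> ccont (fun t => a * f t).
Proof.
move=> cf t e e0; have k0 : 0 < cm a + 1 by rewrite ltr_wpDl ?cm_ge0.
have [d d0 hd] := cf t (e / (cm a + 1)) (divr_gt0 e0 k0).
exists d => // s /hd h; rewrite -mulrBr cmM.
apply: (@le_trans _ _ ((cm a + 1) * (e / (cm a + 1)))).
  by apply: ler_pM => //; rewrite ?cm_ge0// lerDl.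
by rewrite mulrC divfK// gt_eqF.
Qed.

Lemma ccontD (f g : R -> C) : ccont f -> ccont g -> ccont (fun t => f t + g t).
Proof.
move=> cf cg t e e0; have e2 : 0 < e / 2 by rewrite divr_gt0.
have [d d0 hd] := cf t _ e2; have [d' d0' hd'] := cg t _ e2.
exists (Num.min d d'); rewrite ?lt_min ?d0// => s.
rewrite lt_min => /andP[/hd h /hd' h'].
rewrite opprD addrACA (le_trans (cmD _ _))// (le_trans (lerD h h'))//.
by rewrite -splitr.
Qed.

Lemma ccontB (f g : R -> C) : ccont f -> ccont g -> ccont (fun t => f t - g t).
Proof.
move=> cf /(ccontZ (-1)) cg; have := ccontD cf cg.
by under eq_fun do rewrite mulN1r.
Qed.

Lemma ccont_cst (a : C) : ccont (fun=> a).
Proof. by move=> t e e0; exists 1 => // s _; rewrite subrr cm0 ltW. Qed.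

Lemma ccontM (f g : R -> C) : ccont f -> ccont g -> ccont (fun t => f t * g t).
Proof.
move=> cf cg t e e0.
have f0 := cm_ge0 (f t); have g0 := cm_ge0 (g t).
(* With both increments at most 1 and at most [q], the three terms of the product increment are
   bounded by [q], [q |f t|] and [q |g t|], which add up to [e]. *)
have e3 : 0 < Num.min 1 (e / (1 + cm (f t) + cm (g t))).
  by rewrite lt_min ltr01 divr_gt0// -addrA ltr_pwDl// addr_ge0.
have [d d0 hd] := cf t _ e3; have [d' d0' hd'] := cg t _ e3.
exists (Num.min d d'); rewrite ?lt_min ?d0// => s.
rewrite lt_min => /andP[/hd + /hd'].
rewrite !le_min => /andP[h1 h2] /andP[_ h4].
rewrite (_ : _ - _ = (f (t + s) - f t) * (g (t + s) - g t) +
  f t * (g (t + s) - g t) + (f (t + s) - f t) * g t); last by ring.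
apply: (le_trans (cmD _ _)); rewrite cmM.
apply: (le_trans (lerD (cmD _ _) (lexx _))); rewrite !cmM.
set q := e / _ in h2 h4 *.
have qE : q * (1 + cm (f t) + cm (g t)) = e.
  by rewrite divfK// gt_eqF// -addrA ltr_pwDl// addr_ge0.
rewrite -qE 2!mulrDr mulr1; apply: lerD; [apply: lerD|].
- by rewrite -[q]mul1r ler_pM ?cm_ge0.
- by rewrite mulrC ler_pM ?cm_ge0.
- by rewrite ler_pM ?cm_ge0.
Qed.

Lemma antiderivative (f : R -> C) : ccont f ->
  exists F : R -> C, F 0 = 0 /\ forall t, cder F t (f t).
Proof.
move=> cf.
have [F [F0 dF]] := antiderivative_real (ccont_Re cf).
(* The imaginary part of [f] is the real part of [- 'i * f]. *)
have [G [G0 dG]] := antiderivative_real (ccont_Re (ccontZ (- 'i) cf)).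
exists (fun t => ofR (F t) + 'i * ofR (G t)); split.
  by rewrite F0 G0 ofR0 mulr0 addr0.
move=> t; apply: is_derive_cder.
  rewrite (_ : re \o _ = F); first exact: dF.
  apply/funext => s /=.
      by rewrite reD re_iM !re_ofR im_ofR oppr0 addr0.
rewrite (_ : im \o _ = G); last first.
  apply/funext => s /=.
      by rewrite imD im_iM im_ofR re_ofR add0r.
have := dG t; rewrite /= reM reN imN re_i im_i oppr0 mul0r sub0r.
by rewrite mulN1r opprK.
Qed.

(* the integral of [f] from 0 to x, for continuous [f]; otherwise possibly junk *)
Definition J (f : R -> C) : R -> C :=
  xget (fun=> 0) [set F | F 0 = 0 /\ forall t, cder F t (f t)].

Lemma J_spec f : ccont f -> J f 0 = 0 /\ forall t, cder (J f) t (f t).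
Proof.
move=> /antiderivative[F hF].
by have := @xgetPex _ (fun=> 0) [set F | F 0 = 0 /\ forall t, cder F t (f t)];
  apply; exists F.
Qed.

Lemma J_eq (f F : R -> C) (x : R) : ccont f ->
  (forall t, `|t| <= `|x| -> cder F t (f t)) -> J f x = F x - F 0.
Proof.
move=> /J_spec[J0 dJ] dF.
have := @cder0_eq (fun t => J f t - F t) x.
rewrite J0 sub0r => h.
have {}h : J f x - F x = - F 0.
  apply: h => t tx.
  by rewrite -(subrr (f t)); apply: cderB => //; exact: dF.
by rewrite [RHS]addrC -h subrK.
Qed.

Lemma JD (f g : R -> C) x : ccont f -> ccont g ->
  J (fun t => f t + g t) x = J f x + J g x.
Proof.
move=> cf cg; have [f0 df] := J_spec cf; have [g0 dg] := J_spec cg.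
rewrite (@J_eq _ (fun t => J f t + J g t))//; first by rewrite f0 g0 addr0 subr0.
- exact: ccontD.
- by move=> t _; exact: cderD.
Qed.

Lemma JZ (a : C) (f : R -> C) x : ccont f -> J (fun t => a * f t) x = a * J f x.
Proof.
move=> cf; have [f0 df] := J_spec cf.
rewrite (@J_eq _ (fun t => a * J f t))//; first by rewrite f0 mulr0 subr0.
- exact: ccontZ.
- by move=> t _; exact: cderZ.
Qed.

Lemma JB (f g : R -> C) x : ccont f -> ccont g ->
  J (fun t => f t - g t) x = J f x - J g x.
Proof.
move=> cf cg; have cg' := ccontZ (-1) cg.
have := JD x cf cg'; rewrite JZ// mulN1r => <-.
by congr (J _ x); apply/funext => t; rewrite mulN1r.
Qed.

Lemma J_bound (f : R -> C) x K : ccont f ->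
  (forall t, `|t| <= `|x| -> cm (f t) <= K) -> cm (J f x) <= 2 * K * `|x|.
Proof.
move=> cf hK; have [f0 df] := J_spec cf.
by rewrite -[J f x]subr0 -f0; apply: (@mean_value _ f) => // t _.
Qed.

End ComplexPlane.

(** * Real differentials on C^n *)

Section RealDifferentials.
Context {R : realType} {C : numClosedFieldType} {S : cplx R C} {n : nat}.
Local Notation V := 'rV[C]_n.
Local Notation ofR := (@ofR R C S).
Local Notation re := (@re R C S).
Local Notation im := (@im R C S).
Local Notation cm := (@cm R C S).
Local Notation cder := (@cder R C S).
Implicit Types (f g : V -> C) (v z h : V) (W : set V).

Definition vn (h : V) : R := re `|h|.

Lemma vnE h : `|h| = ofR (vn h).
Proof.
by have := @normE R C S `|h|; rewrite normr_id.
Qed.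

Lemma vn_ge0 h : 0 <= vn h.
Proof. by rewrite -(@ofR_le R C S) -vnE ofR0 normr_ge0. Qed.

Lemma vn0 : vn 0 = 0. Proof. by rewrite /vn normr0 -(@ofR0 R C S) re_ofR. Qed.

Lemma vnD h k : vn (h + k) <= vn h + vn k.
Proof. by rewrite -(@ofR_le R C S) ofRD -!vnE ler_normD. Qed.

Lemma vnN h : vn (- h) = vn h. Proof. by rewrite /vn normrN. Qed.

Lemma vnZ (a : C) h : vn (a *: h) = cm a * vn h.
Proof. by apply: (@ofR_inj R C S); rewrite -vnE normrZ cmE vnE -ofRM. Qed.

Lemma vn_coord h j : cm (h ord0 j) <= vn h.
Proof.
rewrite leNgt; apply/negP => lt.
have : ball (0 : V) (ofR (cm (h ord0 j))) h.
  by rewrite mx_norm_ball /ball_ /= sub0r normrN vnE ofR_lt.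
move=> [_ /(_ ord0 j)]; rewrite mxE -ball_normE /ball_ /= sub0r normrN cmE.
by rewrite ltxx.
Qed.

Lemma vn_sum (I : Type) (r : seq I) (F : I -> V) :
  vn (\sum_(i <- r) F i) <= \sum_(i <- r) vn (F i).
Proof.
elim/big_ind2: _ => [|x y z w xy zw|//]; first by rewrite vn0.
by apply: (le_trans (vnD _ _)); exact: lerD.
Qed.

Lemma nbhsVP z (P : V -> Prop) : (\forall y \near z, P y) <->
  exists2 d : R, 0 < d & forall h, vn h < d -> P (z + h).
Proof.
split.
  move=> /nbhs_ballP[d /= d0 hd].
    have dE : d = ofR (cm d) by rewrite -cmE gtr0_norm.
  exists (cm d); first by rewrite -(@ofR_lt R C S) -dE ofR0.
  move=> h hlt; apply: hd; rewrite mx_norm_ball /ball_ /= opprD addrA subrr sub0r.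
  by rewrite normrN vnE dE ofR_lt.
move=> [d d0 hd]; apply/nbhs_ballP; exists (ofR d); first by rewrite /= -ofR0 ofR_lt.
move=> y; rewrite mx_norm_ball /ball_ /= distrC vnE ofR_lt => /hd.
by rewrite addrC subrK.
Qed.

Lemma contVP f z : {for z, continuous f} <-> forall e : R, 0 < e ->
  exists2 d : R, 0 < d & forall h, vn h < d -> cm (f (z + h) - f z) <= e.
Proof.
split=> [h e e0|h].
    apply/(nbhsVP z (fun y => cm (f y - f z) <= e)).
  exact: ((cvgCP (nbhs_filter z) f (f z)).1 h e e0).
apply/(cvgCP (nbhs_filter z) f (f z)) => e /h ?.
exact/(nbhsVP z (fun y => cm (f y - f z) <= e)).
Qed.

Lemma openVP W z : open W -> W z ->
  exists2 d : R, 0 < d & forall h, vn h < d -> W (z + h).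
Proof. by move=> oW Wz; apply/nbhsVP/open_nbhs_nbhs. Qed.

(** This and the next three definitions restate [rquot], [rderivable], [rderive] and [Ck] over the
    abstract field; [Ck_cC] makes the link. *)
Definition cquot f v z (t : R) : C := (ofR t)^-1 * (f (z + ofR t *: v) - f z).

Definition cderivable f v z : Prop := cvg (cquot f v z t @[t --> 0^']).

Definition cderive f v z : C := lim (cquot f v z t @[t --> 0^']).

Fixpoint cC (k : nat) W f : Prop :=
  (forall z, W z -> {for z, continuous f}) /\
  if k is k'.+1 then
    forall v, (forall z, W z -> cderivable f v z) /\ cC k' W (cderive f v)
  else True.

Definition rder f v z (l : C) : Prop :=
  cder (fun s => f (z + ofR s *: v)) 0 l.

Lemma rderP f v z l : rder f v z l <-> cquot f v z t @[t --> 0^'] --> l.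
Proof.
rewrite /rder cderP.
rewrite (_ : (fun s => _) = cquot f v z)//; apply/funext => s.
by rewrite add0r ofR0 scale0r addr0.
Qed.

Lemma rderivable_rder f v z : cderivable f v z -> rder f v z (cderive f v z).
Proof. by move=> /cvg_ex[l hl]; apply/rderP; rewrite /cderive (cvg_lim _ hl). Qed.

Lemma rder_rderivable f v z l : rder f v z l -> cderivable f v z.
Proof. by move=> /rderP h; apply/cvg_ex; exists l. Qed.

Lemma rder_rderive f v z l : rder f v z l -> cderive f v z = l.
Proof. by move=> /rderP h; exact: cvg_lim. Qed.

Lemma rder_line f v z l (t : R) : rder f v (z + ofR t *: v) l <->
  cder (fun s => f (z + ofR s *: v)) t l.
Proof.
rewrite /rder /cder; split=> h e /h[d d0 hd]; exists d; rewrite ?d0// => s /hd.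
  by rewrite add0r ofR0 scale0r addr0 -[z + _ + _]addrA -scalerDl -ofRD.
by rewrite add0r ofR0 scale0r addr0 -[z + _ + _]addrA -scalerDl -ofRD.
Qed.

Lemma rder_near f g v z l : (\forall y \near z, f y = g y) ->
  rder f v z l -> rder g v z l.
Proof.
move=> /nbhsVP[d d0 hd] h e /h[d' d0' hd'].
have k0 : 0 < vn v + 1 by rewrite ltr_wpDl ?vn_ge0.
exists (Num.min d' (d / (vn v + 1))); first by rewrite lt_min d0' divr_gt0.
move=> s; rewrite lt_min => /andP[/hd' {}hd' sd].
rewrite add0r ofR0 scale0r addr0 in hd' *.
rewrite -!hd//; first by rewrite -[z]addr0 hd// vn0 in hd' *.
rewrite vnZ cm_ofR; rewrite ltr_pdivlMr// in sd.
by apply: le_lt_trans sd; rewrite ler_wpM2l// lerDl.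
Qed.

Lemma rderD f g v z l m : rder f v z l -> rder g v z m ->
  rder (fun y => f y + g y) v z (l + m).
Proof. exact: cderD. Qed.

Lemma rderZ f v z l a : rder f v z l -> rder (fun y => a * f y) v z (a * l).
Proof. exact: cderZ. Qed.

Lemma rderB f g v z l m : rder f v z l -> rder g v z m ->
  rder (fun y => f y - g y) v z (l - m).
Proof. exact: cderB. Qed.

Lemma rder_cst a v z : rder (fun=> a) v z 0.
Proof. exact: cder_cst. Qed.

Lemma rderM f g v z l m : {for z, continuous f} -> 
  rder f v z l -> rder g v z m ->
  rder (fun y => f y * g y) v z (l * g z + f z * m).
Proof.
move=> cf /rderP hf /rderP hg; apply/rderP.
have cf' : f (z + ofR t *: v) @[t --> (0 : R)^'] --> f z.
  apply/cvgCP => e /((contVP f z).1 cf)[d d0 hd].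
  have k0 : 0 < vn v + 1 by rewrite ltr_wpDl ?vn_ge0.
  apply/dnbhs0R; exists (d / (vn v + 1)); first exact: divr_gt0.
  move=> s sd _; apply: hd; rewrite vnZ cm_ofR; rewrite ltr_pdivlMr// in sd.
  by apply: le_lt_trans sd; rewrite ler_wpM2l// lerDl.
have H : (cquot f v z t * g z + f (z + ofR t *: v) * cquot g v z t)
    @[t --> (0 : R)^'] --> l * g z + f z * m.
  by apply: cvgD; apply: cvgM => //; exact: cvg_cst.
suff -> : cquot (fun y => f y * g y) v z = fun t =>
    cquot f v z t * g z + f (z + ofR t *: v) * cquot g v z t by exact: H.
by apply/funext => t; rewrite /cquot; ring.
Qed.

Lemma cC_cont k W f z : cC k W f -> W z -> {for z, continuous f}.
Proof. by case: k => [|k] [h _] /h. Qed.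

Lemma cC_rder k W f v z : cC k.+1 W f -> W z -> rder f v z (cderive f v z).
Proof. by move=> [_ /(_ v) [h _]] /h; exact: rderivable_rder. Qed.

Lemma cC_rderive k W f v : cC k.+1 W f -> cC k W (cderive f v).
Proof. by move=> [_ /(_ v) []]. Qed.

Lemma continuous_near f g z : (\forall y \near z, f y = g y) ->
  {for z, continuous f} -> {for z, continuous g}.
Proof.
move=> h /contVP cf; apply/contVP => e /cf[d d0 hd].
have fz := nbhs_singleton h; move/nbhsVP: h => [d' d0' hd'].
exists (Num.min d d'); first by rewrite lt_min d0.
by move=> k; rewrite lt_min => /andP[/hd + /hd' <-]; rewrite -fz.
Qed.

Lemma cC_eq k W f g : open W -> (forall z, W z -> f z = g z) ->
  cC k W f -> cC k W g.
Proof.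
move=> oW; elim: k f g => [|k IH] f g fg [cf hf].
    split; last exact: I.
  move=> z Wz; apply: continuous_near (cf z Wz).
  by apply: filterS (open_nbhs_nbhs (conj oW Wz)) => y /fg.
have nfg z : W z -> \forall y \near z, f y = g y.
  by move=> Wz; apply: filterS (open_nbhs_nbhs (conj oW Wz)) => y /fg.
split=> [z Wz|v]; first exact: continuous_near (nfg z Wz) (cf z Wz).
have D z : W z -> rder g v z (cderive f v z).
  move=> Wz; apply: rder_near (nfg z Wz) _; apply: rderivable_rder.
  by have [] := hf v; move=> /(_ z Wz).
split=> [z /D|]; first exact: rder_rderivable.
apply: (IH (cderive f v)) => [z /D|]; first by move=> /rder_rderive ->.
by have [] := hf v.
Qed.

Lemma cCI k W f : open W -> (forall z, W z -> {for z, continuous f}) ->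
  (forall v, exists2 g, (forall z, W z -> rder f v z (g z)) & cC k W g) ->
  cC k.+1 W f.
Proof.
move=> oW cf hf; split; first exact: cf.
move=> v; have [g fg Cg] := hf v.
split=> [z /fg|]; first exact: rder_rderivable.
by apply: cC_eq Cg => // z /fg /rder_rderive.
Qed.

Lemma cC_sub k W W' f : W' `<=` W -> cC k W f -> cC k W' f.
Proof.
move=> W'W; elim: k f => [|k IH] f [cf hf].
  by split=> // z /W'W /cf.
split=> [z /W'W /cf//|v]; have [h1 h2] := hf v.
by split=> [z /W'W /h1//|]; exact: IH.
Qed.

Lemma cCS k W f : cC k.+1 W f -> cC k W f.
Proof.
elim: k f => [|k IH] f [cf hf]; split; [exact: cf|exact: I|exact: cf|].
by move=> v; have [h1 /IH h2] := hf v.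
Qed.

Lemma cC_le k m W f : (k <= m)%N -> cC m W f -> cC k W f.
Proof.
move=> /subnK <-; elim: (m - k)%N => [|d IH]; first by rewrite add0n.
by rewrite addSn => /cCS.
Qed.

Lemma cC_cup k W W' f : open W -> open W' -> cC k W f -> cC k W' f ->
  cC k (W `|` W') f.
Proof.
move=> oW oW'; elim: k f => [|k IH] f [c1 h1] [c2 h2].
  by split=> // z [/c1|/c2].
split=> [z [/c1|/c2]//|v]; have [d1 e1] := h1 v; have [d2 e2] := h2 v.
by split=> [z [/d1|/d2]//|]; exact: IH.
Qed.

Lemma cC_cst k W a : open W -> cC k W (fun=> a).
Proof.
move=> oW; elim: k a => [|k IH] a; first by split=> // z _; exact: cst_continuous.
apply: cCI => // [z _|v]; first exact: cst_continuous.
by exists (fun=> 0) => // z _; exact: rder_cst.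
Qed.

Lemma cCD k W f g : open W -> cC k W f -> cC k W g -> cC k W (fun z => f z + g z).
Proof.
move=> oW; elim: k f g => [|k IH] f g Cf Cg.
    by split=> // z Wz; apply: continuousD; [exact: cC_cont Cf Wz|exact: cC_cont Cg Wz].
apply: cCI => // [z Wz|v].
  by apply: continuousD; [exact: cC_cont Cf Wz|exact: cC_cont Cg Wz].
exists (fun z => cderive f v z + cderive g v z).
  by move=> z Wz; apply: rderD; [exact: (cC_rder _ Cf)|exact: (cC_rder _ Cg)].
by apply: IH; exact: cC_rderive.
Qed.

Lemma cCM k W f g : open W -> cC k W f -> cC k W g -> cC k W (fun z => f z * g z).
Proof.
move=> oW; elim: k f g => [|k IH] f g Cf Cg.
    by split=> // z Wz; apply: continuousM; [exact: cC_cont Cf Wz|exact: cC_cont Cg Wz].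
apply: cCI => // [z Wz|v].
  by apply: continuousM; [exact: cC_cont Cf Wz|exact: cC_cont Cg Wz].
exists (fun z => cderive f v z * g z + f z * cderive g v z).
  move=> z Wz; apply: rderM; first exact: cC_cont Cf Wz.
    exact: (cC_rder _ Cf).
  exact: (cC_rder _ Cg).
by apply: cCD => //; apply: IH; rewrite //; first [exact: cC_rderive|exact: cCS].
Qed.

Lemma cCZ k W a f : open W -> cC k W f -> cC k W (fun z => a * f z).
Proof. by move=> oW; apply: cCM => //; exact: cC_cst. Qed.

Lemma cCB k W f g : open W -> cC k W f -> cC k W g -> cC k W (fun z => f z - g z).
Proof.
move=> oW Cf Cg; apply: (cC_eq oW _ (cCD oW Cf (cCZ (-1) oW Cg))) => z _.
by rewrite mulN1r.
Qed.

(** [L] is a bare function: differentials can then be added, composed and rewritten freely, and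
    complex linearity is supplied separately by [Clinear]. *)
Definition rdiff f z (L : V -> C) : Prop :=
  forall e : R, 0 < e -> exists2 d : R, 0 < d &
    forall h, vn h < d -> cm (f (z + h) - f z - L h) <= e * vn h.

(** Continuous directional derivatives give a Fréchet expansion: the point moves along the
    directions of [r] one after the other, and the mean value inequality controls each segment. *)
Lemma C1_seq (I : Type) (u : I -> V) W f z (r : seq I) (e : R) :
  open W -> cC 1 W f -> W z -> 0 < e ->
  exists2 d : R, 0 < d & forall t : I -> R, (forall i, `|t i| <= d) ->
    cm (f (z + \sum_(i <- r) ofR (t i) *: u i) - f z -
        \sum_(i <- r) ofR (t i) * cderive f (u i) z) <=
      e * \sum_(i <- r) `|t i|.
Proof.
move=> oW Cf Wz; elim: r e => [|i r IH] e e0.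
  by exists 1 => // t _; rewrite !big_nil !(addr0, subrr) cm0 mulr0.
have [d d0 hd] := IH e e0.
have e2 : 0 < e / 2 by rewrite divr_gt0.
have [d1 d10 hW] := openVP oW Wz.
have [d2 d20 hc] := (contVP _ _).1 (cC_cont (cC_rderive (u i) Cf) Wz) _ e2.
(* If every [|t j|] is at most [d3 / (2 * Q)], the total displacement is at most [d3 / 2]: the whole
   last segment stays in [W], where the derivative along [u i] is within [e / 2] of its value at
   [z]. *)
pose Q := vn (u i) + \sum_(j <- r) vn (u j) + 1.
have Q0 : 0 < Q by rewrite ltr_wpDl// addr_ge0 ?vn_ge0// sumr_ge0// => j _; exact: vn_ge0.
pose d3 := Num.min d1 d2.
have d30 : 0 < d3 by rewrite lt_min d10.
exists (Num.min d (d3 / (2 * Q))); first by rewrite lt_min d0 !divr_gt0// mulr_gt0.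
move=> t ht.
have ht1 j : `|t j| <= d by have := ht j; rewrite le_min => /andP[].
have ht2 j : `|t j| <= d3 / (2 * Q) by have := ht j; rewrite le_min => /andP[].
have {hd}hr := hd t ht1; rewrite !big_cons.
set A := \sum_(j <- r) ofR (t j) *: u j in hr *.
set B := \sum_(j <- r) ofR (t j) * _ in hr *.
set D := cderive f (u i) z.
have small (s : R) : `|s| <= `|t i| -> vn (A + ofR s *: u i) < d3.
  move=> st.
  have : vn (A + ofR s *: u i) <= d3 / (2 * Q) * Q.
    apply: (le_trans (vnD _ _)).
    have dS0 : 0 <= d3 / (2 * Q) by rewrite divr_ge0 ?mulr_ge0// ltW.
    apply: (@le_trans _ _ (d3 / (2 * Q) * (vn (u i) + \sum_(j <- r) vn (u j)))).
      rewrite addrC mulrDr lerD//.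
        by rewrite vnZ cm_ofR ler_wpM2r ?vn_ge0// (le_trans st).
      rewrite mulr_sumr (le_trans (vn_sum _ _))//.
      by apply: ler_sum => j _; rewrite vnZ cm_ofR ler_wpM2r ?vn_ge0.
    by rewrite ler_wpM2l// lerDl.
  move=> /le_lt_trans; apply.
  by rewrite invfM mulrA divfK ?gt_eqF// ltr_pdivrMr// ltr_pMr// ltr1n.
have M1 s : `|s| <= `|t i| -> cder (fun s => f (z + A + ofR s *: u i) - ofR s * D)
    s (cderive f (u i) (z + A + ofR s *: u i) - D).
  move=> /small hs; apply: cderB; last exact: cder_lin.
  apply/rder_line; apply: (cC_rder _ Cf).
  by rewrite -addrA; apply: hW; rewrite (lt_le_trans hs)// ge_min lexx.
have M2 s : `|s| <= `|t i| -> cm (cderive f (u i) (z + A + ofR s *: u i) - D) <= e / 2.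
  move=> /small hs; rewrite -addrA; apply: hc.
  by rewrite (lt_le_trans hs)// ge_min lexx orbT.
have := mean_value M1 M2; rewrite ofR0 scale0r mul0r addr0 subr0 => h.
rewrite (_ : _ - _ = (f (z + A + ofR (t i) *: u i) - ofR (t i) * D - f (z + A)) +
   (f (z + A) - f z - B)); last first.
  by rewrite (addrC _ A) addrA; ring.
rewrite (le_trans (cmD _ _))// mulrDr lerD//.
by rewrite (le_trans h)// [2 * _]mulrC divfK// pnatr_eq0.
Qed.

Definition Ldiff f z h : C := \sum_(j < n)
  (ofR (re (h ord0 j)) * cderive f (delta_mx ord0 j) z +
   ofR (im (h ord0 j)) * cderive f ('i *: delta_mx ord0 j) z).

Lemma row_reim h : h = \sum_(j < n)
  (ofR (re (h ord0 j)) *: delta_mx ord0 j +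
   ofR (im (h ord0 j)) *: ('i *: delta_mx ord0 j)).
Proof.
rewrite {1}(row_sum_delta h); apply: eq_bigr => j _.
by rewrite scalerA -scalerDl {1}(cplxE (h ord0 j)) [_ * 'i]mulrC.
Qed.

Lemma C1_rdiff W f z : open W -> cC 1 W f -> W z -> rdiff f z (Ldiff f z).
Proof.
move=> oW Cf Wz e e0.
pose u (i : 'I_n * bool) : V :=
  if i.2 then 'i *: delta_mx ord0 i.1 else delta_mx ord0 i.1.
have sumE (M : zmodType) (F : 'I_n * bool -> M) :
    \sum_i F i = \sum_(j < n) (F (j, false) + F (j, true)).
    rewrite (eq_bigr (fun p => F (p.1, p.2))); last by case.
  rewrite -(pair_bigA _ (fun j b => F (j, b))) /=; apply: eq_bigr => j _.
  by rewrite big_bool addrC.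
(* There are [2 * n] real coordinates, each bounded by [vn h]; the added 1 keeps the denominator
   positive when [n] is 0. *)
have k0 : 0 < (2 * n%:R + 1 : R) by rewrite ltr_wpDl// mulr_ge0.
have ek0 : 0 < e / (2 * n%:R + 1) by rewrite divr_gt0.
have [d d0 hd] := C1_seq u (index_enum _) oW Cf Wz ek0.
exists d => // h hlt.
pose t (i : 'I_n * bool) := if i.2 then im (h ord0 i.1) else re (h ord0 i.1).
have tle i : `|t i| <= vn h.
  by case: i => j []; apply: le_trans (vn_coord h j); [exact: cm_im|exact: cm_re].
have := hd t (fun i => le_trans (tle i) (ltW hlt)).
rewrite !sumE /= -row_reim => /le_trans; apply.
apply: (@le_trans _ _ (e / (2 * n%:R + 1) * (\sum_(j < n) (vn h + vn h)))).
    apply: ler_wpM2l; first exact: ltW.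
  by apply: ler_sum => j _; exact: lerD (tle (j, false)) (tle (j, true)).
have -> : \sum_(j < n) (vn h + vn h) = vn h * (2 * n%:R).
    rewrite sumr_const card_ord -(mulr_natr _ n); ring.
rewrite -[leRHS](_ : e / (2 * n%:R + 1) * (vn h * (2 * n%:R + 1)) = _); last first.
  by field; rewrite gt_eqF.
apply: ler_wpM2l; first exact: ltW.
by rewrite ler_wpM2l ?vn_ge0// lerDl.
Qed.

Lemma LdiffD f z h k : Ldiff f z (h + k) = Ldiff f z h + Ldiff f z k.
Proof.
rewrite /Ldiff -big_split /=; apply: eq_bigr => j _.
by rewrite mxE reD imD !ofRD; ring.
Qed.

Lemma LdiffZ f z (a : R) h : Ldiff f z (ofR a *: h) = ofR a * Ldiff f z h.
Proof.
rewrite /Ldiff mulr_sumr; apply: eq_bigr => j _.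
by rewrite mxE reM imM re_ofR im_ofR !mul0r subr0 addr0 !ofRM; ring.
Qed.

Lemma Ldiff_bound f z : exists2 K : R, 0 < K & forall h, cm (Ldiff f z h) <= K * vn h.
Proof.
exists (\sum_(j < n) (cm (cderive f (delta_mx ord0 j) z) +
  cm (cderive f ('i *: delta_mx ord0 j) z)) + 1).
  by rewrite ltr_wpDl// sumr_ge0// => j _; rewrite addr_ge0 ?cm_ge0.
move=> h; rewrite mulrDl mul1r; apply: ler_wpDr; first exact: vn_ge0.
rewrite (le_trans (cm_sum _ _ _))// mulr_suml; apply: ler_sum => j _.
apply: (le_trans (cmD _ _)); rewrite mulrDl !cmM !cm_ofR; apply: lerD.
  rewrite mulrC; apply: ler_wpM2l; first exact: cm_ge0.
  exact: (le_trans (cm_re _) (vn_coord h j)).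
rewrite mulrC; apply: ler_wpM2l; first exact: cm_ge0.
exact: (le_trans (cm_im _) (vn_coord h j)).
Qed.

Lemma rdiff_curve f z (c : R -> C) (v : V) t l :
  rdiff f (z + c t *: v) (Ldiff f (z + c t *: v)) -> cder c t l ->
  cder (fun s => f (z + c s *: v)) t (Ldiff f (z + c t *: v) (l *: v)).
Proof.
set y := z + _ => hf hc e e0.
have [K K0 hK] := Ldiff_bound f y.
pose Q := (cm l + 1) * (vn v + 1).
have v0 : 0 < vn v + 1 by rewrite ltr_wpDl ?vn_ge0.
have Q0 : 0 < Q by rewrite mulr_gt0// ltr_wpDl ?cm_ge0.
have e2 : 0 < e / 2 by rewrite divr_gt0.
have [d1 d10 h1] := hf (e / 2 / Q) (divr_gt0 e2 Q0).
(* The bound 1 makes the increment of the curve at most [Q * |s|]; the other one makes the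
   contribution of the curve's remainder, seen through [Ldiff], at most [e / 2 * |s|]. *)
have q0 : 0 < Num.min 1 (e / 2 / (K * (vn v + 1))).
  by rewrite lt_min ltr01 divr_gt0// mulr_gt0.
have [d2 d20 h2] := hc _ q0.
exists (Num.min d2 (d1 / Q)); first by rewrite lt_min d20 divr_gt0.
move=> s; rewrite lt_min => /andP[/[dup] sd /h2 {}h2 sd'].
have {h2}[h2 h3] : cm (c (t + s) - c t - ofR s * l) <= 1 * `|s| /\
    cm (c (t + s) - c t - ofR s * l) <= e / 2 / (K * (vn v + 1)) * `|s|.
  by split; apply: (le_trans h2); rewrite ler_wpM2r// ge_min lexx ?orbT.
pose k := (c (t + s) - c t) *: v.
have -> : z + c (t + s) *: v = y + k.
    by rewrite /y /k -addrA -scalerDl [c t + _]addrC subrK.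
have kE : k = ofR s *: (l *: v) + (c (t + s) - c t - ofR s * l) *: v.
  by rewrite scalerA -scalerDl addrC subrK.
have kle : vn k <= Q * `|s|.
  rewrite vnZ /Q mulrAC; apply: ler_pM; rewrite ?cm_ge0 ?vn_ge0 ?lerDl//.
  rewrite -(subrK (ofR s * l) (_ - _)) (le_trans (cmD _ _))//.
  by rewrite cmM cm_ofR mulrDl addrC [`|s| * _]mulrC lerD2l.
have klt : vn k < d1 by rewrite (le_lt_trans kle)// mulrC -ltr_pdivlMr.
rewrite -LdiffZ (_ : _ - _ = (f (y + k) - f y - Ldiff f y k) +
  Ldiff f y ((c (t + s) - c t - ofR s * l) *: v)); last first.
    by rewrite [in Ldiff f y k]kE LdiffD opprD addrA subrK.
rewrite (le_trans (cmD _ _))// [e]splitr mulrDl lerD//.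
    rewrite (le_trans (h1 _ klt))// -[e / 2 in leRHS](divfK (lt0r_neq0 Q0)).
    rewrite -[leRHS]mulrA; apply: ler_wpM2l => //.
  by rewrite divr_ge0// ltW.
rewrite (le_trans (hK _))// vnZ.
apply: (@le_trans _ _ (K * (vn v + 1) * (e / 2 / (K * (vn v + 1)) * `|s|))).
    rewrite -[leRHS]mulrA; apply: ler_wpM2l; first exact: ltW.
  by rewrite mulrC; apply: ler_pM; rewrite ?cm_ge0 ?vn_ge0 ?lerDl.
by rewrite mulrA [_ * (e / 2 / _)]mulrC divfK// gt_eqF// mulr_gt0.
Qed.

Lemma C1_rderive W f z v : open W -> cC 1 W f -> W z ->
  cderive f v z = Ldiff f z v.
Proof.
move=> oW Cf Wz; apply: rder_rderive.
have := @rdiff_curve f z (fun s => ofR s * 1) v 0 1.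
rewrite ofR0 mul0r scale0r addr0 scale1r => /(_ (C1_rdiff oW Cf Wz) (cder_lin _ _)).
by apply: cder_ext => s; rewrite mulr1.
Qed.

End RealDifferentials.

(** * Uniform continuity of functions supported in a box, and symmetry of second derivatives *)

Section Box.
Context {R : realType} {C : numClosedFieldType} {S : cplx R C} {n : nat}.
Local Notation V := (matrix C 1 n).
Local Notation ofR := (@ofR R C S).
Local Notation re := (@re R C S).
Local Notation im := (@im R C S).
Local Notation cm := (@cm R C S).
Local Notation cder := (@cder R C S).
Local Notation ccont := (@ccont R C S).
Local Notation vn := (@vn R C S _).
Local Notation rder := (@rder R C S _).
Local Notation cderive := (@cderive R C S _).
Local Notation cC := (@cC R C S _).
Implicit Types (f g : V -> C) (v z h a : V) (W : set V).

Definition box a (d : R) : set V := [set z | forall j,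
  `|re (z ord0 j - a ord0 j)| <= d /\ `|im (z ord0 j - a ord0 j)| <= d].

Lemma square_compact (w : C) (d : R) :
  compact [set u : C | `|re (u - w)| <= d /\ `|im (u - w)| <= d].
Proof.
pose F (p : R * R) : C := w + (ofR p.1 + 'i * ofR p.2).
have -> : [set u : C | `|re (u - w)| <= d /\ `|im (u - w)| <= d] =
    F @` (`[- d, d] `*` `[- d, d])%classic.
  apply/seteqP; split=> [u [h1 h2]|_ [[x y] [/= hx hy] <-]] /=.
    exists (re (u - w), im (u - w)); last first.
      by rewrite /F /= -cplxE addrC subrK.
    by split; rewrite /= in_itv /= -ler_norml.
  rewrite /F /= addrC addKr reD imD re_iM im_iM !re_ofR !im_ofR oppr0 addr0 add0r.
  by rewrite !ler_norml; move: hx hy; rewrite !in_itv.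
apply: continuous_compact; last by apply: compact_setX; exact: segment_compact.
apply: continuous_subspaceT => p.
apply/(@cvgCP R C S _ _ (nbhs_filter p)) => e e0.
apply/nbhs_ballP; exists (e / 2); first by rewrite /= divr_gt0.
move=> q [/= h1 h2].
rewrite (_ : F q - F p = ofR (q.1 - p.1) + 'i * ofR (q.2 - p.2)); last first.
  by rewrite /F !ofRB; ring.
rewrite (le_trans (@cmD R C S _ _))// cmM cmi mul1r !cm_ofR.
rewrite [e]splitr lerD// distrC ltW//.
Qed.

Lemma box_compact a d : compact (box a d).
Proof.
apply: (@rV_compact C n (fun j => [set u : C |
  `|re (u - a ord0 j)| <= d /\ `|im (u - a ord0 j)| <= d])) => j.
exact: square_compact.
Qed.

Lemma box_out_near a d z : ~ box a d z -> \forall y \near z, ~ box a d y.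
Proof.
move=> /existsNP[j h].
have [x xj dx] : exists2 x, x \in [:: `|re (z ord0 j - a ord0 j)|; `|im (z ord0 j - a ord0 j)|]
    & d < x.
  have [h1|h1] := leP `|re (z ord0 j - a ord0 j)| d; last first.
    by exists `|re (z ord0 j - a ord0 j)| => //; rewrite !inE eqxx.
  have [h2|h2] := leP `|im (z ord0 j - a ord0 j)| d; first by case: h.
  by exists `|im (z ord0 j - a ord0 j)| => //; rewrite !inE eqxx orbT.
apply/(@nbhsVP R C S n z); exists (x - d); first by rewrite subr_gt0.
move=> k kx /(_ j); rewrite mxE.
rewrite (_ : _ - a ord0 j = z ord0 j - a ord0 j + k ord0 j); last by ring.
have kr := le_lt_trans (le_trans (cm_re _) (vn_coord k j)) kx.
have ki := le_lt_trans (le_trans (cm_im _) (vn_coord k j)) kx.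
have aux (p q : R) : `|q| < `|p| - d -> d < `|p + q|.
  move=> hq; rewrite -[p in ltRHS]opprK -(normrN (- - p + q)) opprD opprK.
  apply: lt_le_trans (lerB_dist _ _); rewrite normrN.
  by rewrite ltrBrDr addrC -ltrBrDr.
rewrite reD imD => -[].
move: xj dx kr ki; rewrite !inE => /orP[]/eqP-> _ kr ki h1 h2.
  by have := aux _ _ kr; rewrite ltNge h1.
by have := aux _ _ ki; rewrite ltNge h2.
Qed.

Definition UC f : Prop := forall e : R, 0 < e -> exists2 d : R, 0 < d &
  forall z h, vn h < d -> cm (f (z + h) - f z) <= e.

Lemma UC_supp f a d : (forall z, {for z, continuous f}) ->
  (forall z, ~ box a d z -> f z = 0) -> UC f.
Proof.
move=> cf f0 e e0.
(* The near-covering form of compactness turns thresholds valid near each point into a single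
   threshold for the whole box. *)
have := (compact_near_coveringP _).1 (@box_compact a d) R (nbhs 0^'+)
  (fun t z => forall h, vn h < t -> cm (f (z + h) - f z) <= e) _.
have [|] := pselect (forall x, box a d x -> \forall x' \near x & t \near 0^'+,
   forall h, vn h < t -> cm (f (x' + h) - f x') <= e); last first.
  move=> h; exfalso; apply: h => x _.
  have e2 : 0 < e / 2 by rewrite divr_gt0.
  have [r r0 hr] := (@contVP R C S n f x).1 (cf x) _ e2.
  have r2 : 0 < r / 2 by rewrite divr_gt0.
  exists ([set y | vn (y - x) < r / 2], [set t | t < r / 2]).
    split=> /=.
      apply/(@nbhsVP R C S n x); exists (r / 2) => // k.
            by rewrite /= [x + k]addrC addrK.
    exact: nbhs_right_lt.
  move=> [y t] /= [yx tr] k kt.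
  rewrite (_ : f (y + k) - f y = (f (x + (y - x + k)) - f x) - (f (x + (y - x)) - f x)).
    rewrite (le_trans (@cmB R C S _ _))// [e]splitr lerD//; apply: hr.
      by rewrite (le_lt_trans (vnD _ _))// [r]splitr ltrD// (lt_trans kt).
    by rewrite (lt_trans yx)// ltr_pdivrMr// ltr_pMr// ltr1n.
  by rewrite addrA [x + (y - x)]addrC subrK; ring.
move=> h /(_ _ h) H.
have [t [t0 ht]] : exists t, 0 < t /\ box a d `<=` fun z => 
    forall h, vn h < t -> cm (f (z + h) - f z) <= e.
  have /filter_ex[t [t0 ht]] : \forall t \near (0:R)^'+, 0 < t /\ box a d `<=` fun z => 
    forall h, vn h < t -> cm (f (z + h) - f z) <= e.
    by near=> t; split; [near: t; exact: nbhs_right_gt|near: t].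
  by exists t.
exists t => // z k kt.
(* When only [z + k] lies in the box, the estimate is used at [z + k] with increment [- k]; when
   neither point does, both values vanish. *)
have [bz|bz] := pselect (box a d z); first exact: ht.
have [bk|bk] := pselect (box a d (z + k)).
  have := ht _ bk (- k); rewrite addrK vnN => /(_ kt).
  by rewrite cmBC.
by rewrite !f0// subrr cm0 ltW.
Unshelve. all: by end_near. Qed.

Lemma UCD f g : UC f -> UC g -> UC (fun z => f z + g z).
Proof.
move=> cf cg e e0; have e2 : 0 < e / 2 by rewrite divr_gt0.
have [d d0 hd] := cf _ e2; have [d' d0' hd'] := cg _ e2.
exists (Num.min d d'); rewrite ?lt_min ?d0// => z s.
rewrite lt_min => /andP[/(hd z) h /(hd' z) h'].
rewrite opprD addrACA (le_trans (cmD _ _))// (le_trans (lerD h h'))//.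
by rewrite -splitr.
Qed.

Lemma UCZ (b : C) f : UC f -> UC (fun z => b * f z).
Proof.
move=> cf e e0; have k0 : 0 < cm b + 1 by rewrite ltr_wpDl ?cm_ge0.
have [d d0 hd] := cf (e / (cm b + 1)) (divr_gt0 e0 k0).
exists d => // z s /(hd z) h; rewrite -mulrBr cmM.
apply: (@le_trans _ _ ((cm b + 1) * (e / (cm b + 1)))).
  by apply: ler_pM => //; rewrite ?cm_ge0// lerDl.
by rewrite mulrC divfK// gt_eqF.
Qed.

Lemma UCB f g : UC f -> UC g -> UC (fun z => f z - g z).
Proof.
move=> cf /(UCZ (-1)) cg; have := UCD cf cg.
by under eq_fun do rewrite mulN1r.
Qed.

Lemma UC_shift f h : UC f -> UC (fun z => f (z + h)).
Proof.
move=> cf e /cf[d d0 hd]; exists d => // z k kd.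
by rewrite addrAC; exact: hd.
Qed.

Lemma UC_cont f z : UC f -> {for z, continuous f}.
Proof.
move=> cf; apply/(@contVP R C S n f z) => e /cf[d d0 hd].
by exists d => // h; exact: hd.
Qed.

Lemma UC_curve f (c : R -> C) z v : UC f -> ccont c -> ccont (fun t => f (z + c t *: v)).
Proof.
move=> cf cc t e /cf[d d0 hd].
have v0 : 0 < vn v + 1 by rewrite ltr_wpDl ?vn_ge0.
have [d' d0' hd'] := cc t (d / 2 / (vn v + 1)) ltac:(by rewrite !divr_gt0).
exists d' => // s /hd' {}hd'.
rewrite (_ : z + c (t + s) *: v = z + c t *: v + (c (t + s) - c t) *: v); last first.
  by rewrite -addrA -scalerDl [c t + _]addrC subrK.
apply: hd; rewrite vnZ.
apply: (@le_lt_trans _ _ (d / 2 / (vn v + 1) * (vn v + 1))).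
  by apply: ler_pM => //; rewrite ?cm_ge0 ?vn_ge0 ?lerDl.
by rewrite divfK ?gt_eqF// ltr_pdivrMr// ltr_pMr// ltr1n.
Qed.

(** The point is that [d] does not depend on [z]: this uniform remainder is what allows
    differentiation under the integral in [T_rder]. *)
Lemma UC_rder f g v : UC g -> (forall z, rder f v z (g z)) ->
  forall e : R, 0 < e -> exists2 d : R, 0 < d & forall z s, `|s| < d ->
    cm (f (z + ofR s *: v) - f z - ofR s * g z) <= e * `|s|.
Proof.
move=> cg fg e e0; have e2 : 0 < e / 2 by rewrite divr_gt0.
have [d d0 hd] := cg _ e2.
have v0 : 0 < vn v + 1 by rewrite ltr_wpDl ?vn_ge0.
exists (d / (vn v + 1)); first exact: divr_gt0.
move=> z s sd.
have M1 t : `|t| <= `|s| -> cder (fun t => f (z + ofR t *: v) - ofR t * g z) t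
    (g (z + ofR t *: v) - g z).
  by move=> _; apply: cderB; [exact/rder_line|exact: cder_lin].
have M2 t : `|t| <= `|s| -> cm (g (z + ofR t *: v) - g z) <= e / 2.
  move=> ts; apply: hd; rewrite vnZ cm_ofR.
  rewrite ltr_pdivlMr// in sd; apply: le_lt_trans sd.
  by apply: ler_pM; rewrite ?vn_ge0// lerDl.
have := mean_value M1 M2.
rewrite ofR0 scale0r mul0r subr0 addr0 [2 * _]mulrC divfK//
   (_ : _ - f z = f (z + ofR s *: v) - f z - ofR s * g z)//.
by ring.
Qed.

(** The second difference of [f] over the parallelogram spanned by [s v] and [s w] is symmetric in
    [v] and [w], and up to [o(s^2)] it equals [s^2] times either mixed derivative. *)
Lemma cderive_comm W f v w z : open W -> cC 2 W f -> W z ->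
  cderive (cderive f v) w z = cderive (cderive f w) v z.
Proof.
move=> oW Cf Wz.
suff H v' w' : forall e : R, 0 < e -> exists2 d : R, 0 < d & forall s, `|s| < d ->
    cm (f (z + ofR s *: v' + ofR s *: w') - f (z + ofR s *: v') - f (z + ofR s *: w') + f z
     - ofR s * ofR s * cderive (cderive f v') w' z) <= e * (`|s| * `|s|).
  apply/eqP; rewrite -subr_eq0 -(@cm_eq0 R C S) eq_le cm_ge0 andbT.
  apply/ler_addgt0Pr => e e0; rewrite add0r.
  have e2 : 0 < e / 2 by rewrite divr_gt0.
  have [d d0 hd] := H v w _ e2; have [d' d0' hd'] := H w v _ e2.
  pose s := Num.min d d' / 2.
  have m0 : 0 < Num.min d d' by rewrite lt_min d0.
  have s0 : 0 < s by rewrite divr_gt0.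
  have sd : `|s| < Num.min d d'.
    by rewrite gtr0_norm// ltr_pdivrMr// ltr_pMr// ltr1n.
  have := hd s; have := hd' s; move: sd; rewrite lt_min => /andP[-> ->] => /(_ isT) h' /(_ isT) h.
  have := le_trans (@cmB R C S _ _) (lerD h h').
  set P := cderive _ w z; set P' := cderive _ v z.
  rewrite [z + _ + _]addrAC (_ : _ - _ = (ofR s * ofR s) * (P' - P)); last by ring.
    have ss0 : 0 < `|s| * `|s| by rewrite mulr_gt0// normr_gt0 gt_eqF.
  clearbody P P'.
  rewrite cmM cmM cm_ofR -mulrDl -splitr mulrC ler_pM2r//.
  by rewrite cmBC.
move=> e e0; set c := cderive _ w' z.
(* Two nested mean value inequalities, along [w'] and then along [v'], each double the bound. *)
have e4 : 0 < e / 4 by rewrite divr_gt0.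
have C1 : cC 1 W (cderive f v') := cC_rderive v' Cf.
have [d1 d10 hW] := @openVP R C S n W z oW Wz.
have [d2 d20 hc] := (@contVP R C S n _ _).1 (cC_cont (cC_rderive w' C1) Wz) _ e4.
pose Q := vn v' + vn w' + 1.
have Q0 : 0 < Q by rewrite ltr_wpDl// addr_ge0 ?vn_ge0.
exists (Num.min d1 d2 / Q); first by rewrite divr_gt0// lt_min d10.
move=> s; rewrite ltr_pdivlMr// => sd.
have small (p q : R) : `|p| <= `|s| -> `|q| <= `|s| ->
    vn (ofR p *: v' + ofR q *: w') < Num.min d1 d2.
  move=> ps qs; apply: le_lt_trans sd; rewrite (le_trans (vnD _ _))// !vnZ !cm_ofR.
  by rewrite /Q !mulrDr mulr1 ler_wpDr// lerD// ler_wpM2r ?vn_ge0.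
have in1 p q : `|p| <= `|s| -> `|q| <= `|s| -> W (z + ofR p *: v' + ofR q *: w').
  move=> ps qs; rewrite -addrA; apply: hW.
  by have := small p q ps qs; rewrite lt_min => /andP[].
have in2 p q : `|p| <= `|s| -> `|q| <= `|s| ->
   cm (cderive (cderive f v') w' (z + ofR p *: v' + ofR q *: w') - c) <= e / 4.
  move=> ps qs; rewrite -addrA; apply: hc.
  by have := small p q ps qs; rewrite lt_min => /andP[].
pose G p := f (z + ofR p *: v' + ofR s *: w') - f (z + ofR p *: v') - ofR p * (ofR s * c).
have z0 p : z + ofR p *: v' = z + ofR p *: v' + ofR 0 *: w' by rewrite ofR0 scale0r addr0.
have n0 : `|(0 : R)| <= `|s| by rewrite normr0.
have D p : `|p| <= `|s| -> cder G p (cderive f v' (z + ofR p *: v' + ofR s *: w') -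
     cderive f v' (z + ofR p *: v') - ofR s * c).
  move=> ps; apply: cderB; last exact: cder_lin.
  apply: cderB.
    apply: (@cder_ext R C S (fun q => f (z + ofR s *: w' + ofR q *: v'))).
      by move=> q; rewrite addrAC.
    by rewrite addrAC; apply/rder_line; apply: (cC_rder _ Cf); rewrite addrAC; exact: in1.
  by apply/rder_line; apply: (cC_rder _ Cf); rewrite z0; exact: in1.
have B p : `|p| <= `|s| -> cm (cderive f v' (z + ofR p *: v' + ofR s *: w') -
     cderive f v' (z + ofR p *: v') - ofR s * c) <= e / 2 * `|s|.
  move=> ps.
  have M1 q : `|q| <= `|s| -> cder (fun q => cderive f v' (z + ofR p *: v' + ofR q *: w') - ofR q * c) q
     (cderive (cderive f v') w' (z + ofR p *: v' + ofR q *: w') - c).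
    move=> qs; apply: cderB; last exact: cder_lin.
    by apply/rder_line; apply: (cC_rder _ C1); exact: in1.
  have := mean_value M1 (in2 p ^~ ps).
  rewrite ofR0 scale0r mul0r subr0 addr0 (_ : 2 * (e / 4) = e / 2); last by field.
  by rewrite addrAC.
have := mean_value D B.
rewrite /G ofR0 scale0r mul0r subr0 addr0.
rewrite (_ : 2 * _ * _ = e * (`|s| * `|s|)); last by field.
congr (_ <= _); congr (cm _); ring.
Qed.

End Box.

(** * The Cauchy transform *)

Section Cauchy.
Context {R : realType} {C : numClosedFieldType} {S : cplx R C} {n : nat}.
Local Notation V := (matrix C 1 n).
Local Notation ofR := (@ofR R C S).
Local Notation re := (@re R C S).
Local Notation im := (@im R C S).
Local Notation cm := (@cm R C S).
Local Notation cder := (@cder R C S).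
Local Notation ccont := (@ccont R C S).
Local Notation J := (@J R C S).
Local Notation vn := (@vn R C S _).
Local Notation rder := (@rder R C S _).
Local Notation cderive := (@cderive R C S _).
Local Notation cC := (@cC R C S _).
Local Notation UC := (@UC R C S _).
Local Notation box := (@box R C S _).
Implicit Types (f g : V -> C) (v z h a : V).

Lemma cder_ofR (g : R -> R) (t l : R) : is_derive t (1 : R) g l ->
  cder (fun s => ofR (g s)) t (ofR l).
Proof.
move=> dg; apply: is_derive_cder.
  rewrite (_ : re \o _ = g) ?re_ofR//.
  by apply/funext => s /=; rewrite re_ofR.
rewrite (_ : im \o _ = cst 0) ?im_ofR//; first exact: is_derive_cst.
by apply/funext => s /=; rewrite im_ofR.
Qed.

Definition cis (t : R) : C := ofR (cos t) + 'i * ofR (sin t).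

(** With [w = r e^(it)] and area element [r dr dt], the kernel [1 / w] contributes exactly this
    factor [e^(-it)]: no singularity remains at [r = 0]. *)
Definition cisN (t : R) : C := ofR (cos t) - 'i * ofR (sin t).

Lemma iM_i (a : C) : 'i * ('i * a) = - a.
Proof. by rewrite mulrA -expr2 sqrCi mulN1r. Qed.

Lemma cder_cis t : cder cis t ('i * cis t).
Proof.
have -> : 'i * cis t = ofR (- sin t) + 'i * ofR (cos t).
  by rewrite /cis mulrDr iM_i ofRN addrC.
by apply: cderD; [|apply: cderZ]; exact: cder_ofR.
Qed.

Lemma cm_cis t : cm (cis t) <= 2.
Proof.
rewrite (le_trans (cmD _ _))// cmM cmi mul1r !cm_ofR -[2]/(1 + 1).
by rewrite lerD ?cos_max ?sin_max.
Qed.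

Lemma cm_cisN t : cm (cisN t) <= 2.
Proof.
rewrite (le_trans (cmB _ _))// cmM cmi mul1r !cm_ofR -[2]/(1 + 1).
by rewrite lerD ?cos_max ?sin_max.
Qed.

Lemma cis2pi : cis (pi *+ 2) = cis 0.
Proof. by rewrite /cis cos2pi sin2pi cos0 sin0. Qed.

Lemma ccont_cos : ccont (fun t => ofR (cos t)).
Proof. by apply: cder_ccont => t; exact: cder_ofR. Qed.

Lemma ccont_sin : ccont (fun t => ofR (sin t)).
Proof. by apply: cder_ccont => t; exact: cder_ofR. Qed.

Lemma ccont_cis : ccont cis.
Proof. by apply: cder_ccont => t; exact: cder_cis. Qed.

Lemma ccont_cisN : ccont cisN.
Proof. by apply: ccontB ccont_cos (ccontZ _ ccont_sin). Qed.

(** The sign is that of a convolution, where the function is evaluated at [z - w]. *)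
Definition ray (r t : R) : C := - (ofR r * cis t).

Lemma ray_cont r : ccont (ray r).
Proof.
by have := ccontZ (- ofR r) ccont_cis; under eq_fun do rewrite mulNr.
Qed.

Variables (v : V) (rho : R).

Lemma norm2pi : `|(pi *+ 2 : R)| = 2 * pi.
Proof. by rewrite ger0_norm ?mulr_natl// mulrn_wge0// pi_ge0. Qed.

(* In polar coordinates around [z] in the complex line of direction [v],
   [T f z] is the convolution of [f] with the Cauchy kernel [1 / (pi w)], cut off
   at radius [rho]. *)
Definition T_angle f z (r : R) : C :=
  J (fun t => cisN t * f (z + ray r t *: v)) (pi *+ 2).

Definition T f z : C := ofR pi^-1 * J (T_angle f z) rho.

Lemma T_angle_fiber f z r : UC f -> ccont (fun t => cisN t * f (z + ray r t *: v)).
Proof. by move=> cf; apply: ccontM ccont_cisN (UC_curve _ _ cf (ray_cont r)). Qed.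

Lemma T_angleD f g z r : UC f -> UC g ->
  T_angle (fun y => f y + g y) z r = T_angle f z r + T_angle g z r.
Proof.
move=> cf cg; rewrite /T_angle -JD; [|exact: T_angle_fiber..].
by congr (J _ _); apply/funext => t; rewrite mulrDr.
Qed.

Lemma T_angleZ (a : C) f z r : UC f ->
  T_angle (fun y => a * f y) z r = a * T_angle f z r.
Proof.
move=> cf; rewrite /T_angle -JZ; [|exact: T_angle_fiber..].
by congr (J _ _); apply/funext => t; rewrite mulrCA.
Qed.

Lemma T_angle_bound f z r K : UC f -> (forall y, cm (f y) <= K) ->
  cm (T_angle f z r) <= 8 * pi * K.
Proof.
move=> cf hK.
have K0 : 0 <= K := le_trans (cm_ge0 _) (hK 0).
(* A factor 2 from [J_bound], a factor 2 from [cm_cisN], and the length [2 * pi]. The radial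
   integral doubles once more and the division by [pi] leaves the 16 of [T_bound]. *)
have -> : 8 * pi * K = 2 * (2 * K) * `|(pi *+ 2 : R)|.
  by rewrite norm2pi; ring.
apply: J_bound => [|t _]; first exact: T_angle_fiber.
by rewrite cmM ler_pM ?cm_ge0 ?cm_cisN.
Qed.

Lemma ray_move r s t : vn ((ray (r + s) t - ray r t) *: v) <= `|s| * (2 * vn v).
Proof.
rewrite (_ : _ - _ = ofR s * - cis t); last by rewrite /ray ofRD; ring.
rewrite vnZ cmM cm_ofR cmN -mulrA ler_wpM2l// ler_wpM2r ?vn_ge0//.
exact: cm_cis.
Qed.

Lemma UC_ray f : UC f -> forall e : R, 0 < e -> exists2 d : R, 0 < d &
  forall z r s t, `|s| < d ->
    cm (f (z + ray (r + s) t *: v) - f (z + ray r t *: v)) <= e.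
Proof.
move=> cf e /cf[d d0 hd].
have k0 : 0 < 2 * vn v + 1 by rewrite ltr_wpDl// mulr_ge0// vn_ge0.
exists (d / (2 * vn v + 1)); first exact: divr_gt0.
move=> z r s t sd.
rewrite (_ : z + ray (r + s) t *: v = z + ray r t *: v + (ray (r + s) t - ray r t) *: v); last first.
  by rewrite -addrA -scalerDl [ray r t + _]addrC subrK.
apply: hd; rewrite ltr_pdivlMr// in sd; apply: le_lt_trans sd.
by rewrite (le_trans (ray_move _ _ _))// ler_wpM2l// lerDl.
Qed.

Lemma T_angle_cont f z : UC f -> ccont (T_angle f z).
Proof.
move=> cf r e e0.
have e' : 0 < e / (8 * pi) by rewrite divr_gt0// mulr_gt0// pi_gt0.
have [d d0 hd] := UC_ray cf e'.
exists d => // s sd.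
rewrite /T_angle -JB; [|exact: T_angle_fiber..].
have -> : e = 2 * (2 * (e / (8 * pi))) * `|(pi *+ 2 : R)|.
      rewrite norm2pi; have := lt0r_neq0 (pi_gt0 R).
  by move: (pi : R) => p p0; field.
apply: J_bound => [|t _]; first by apply: ccontB; exact: T_angle_fiber.
by rewrite -mulrBr cmM ler_pM ?cm_ge0 ?cm_cisN// hd.
Qed.

Lemma TD f g z : UC f -> UC g -> T (fun y => f y + g y) z = T f z + T g z.
Proof.
move=> cf cg; rewrite /T -mulrDr -JD; [|exact: T_angle_cont..].
by congr (_ * J _ _); apply/funext => t; rewrite T_angleD.
Qed.

Lemma TZ (a : C) f z : UC f -> T (fun y => a * f y) z = a * T f z.
Proof.
move=> cf; rewrite /T mulrCA -[a * J _ _]JZ; last exact: T_angle_cont.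
by congr (_ * J _ _); apply/funext => t; rewrite T_angleZ.
Qed.

Lemma TB f g z : UC f -> UC g -> T (fun y => f y - g y) z = T f z - T g z.
Proof.
move=> cf cg; have cg' := UCZ (-1) cg.
have -> : (fun y => f y - g y) = (fun y => f y + -1 * g y).
  by apply/funext => y; rewrite mulN1r.
by rewrite TD// TZ// mulN1r.
Qed.

Lemma T_bound f z K : UC f -> (forall y, cm (f y) <= K) ->
  cm (T f z) <= 16 * `|rho| * K.
Proof.
move=> cf hK; rewrite /T cmM cm_ofR normfV (gtr0_norm (pi_gt0 R)).
rewrite mulrC ler_pdivrMr ?pi_gt0//.
rewrite (_ : _ * pi = 2 * (8 * pi * K) * `|rho|); last by ring.
apply: J_bound => [|t _]; first exact: T_angle_cont.
exact: T_angle_bound.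
Qed.

(** Through this identity and linearity, increments of [T f] are values of [T] on increments of [f],
    so [T_bound] alone yields continuity and differentiability. *)
Lemma T_shift f z h : T (fun y => f (y + h)) z = T f (z + h).
Proof.
rewrite /T; congr (_ * J _ _); apply/funext => r; rewrite /T_angle.
by congr (J _ _); apply/funext => t; rewrite addrAC.
Qed.

Let B : R := 16 * `|rho| + 1.

Let B_gt0 : 0 < B. Proof. by rewrite ltr_wpDl// mulr_ge0. Qed.

Let T_bound' f z K : 0 <= K -> UC f -> (forall y, cm (f y) <= K) -> cm (T f z) <= B * K.
Proof.
move=> K0 cf hK; rewrite (le_trans (T_bound z cf hK))//.
by rewrite ler_wpM2r// lerDl.
Qed.

Lemma T_UC f : UC f -> UC (T f).
Proof.
move=> cf e e0.
have [d d0 hd] := cf _ (divr_gt0 e0 B_gt0).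
exists d => // z h hlt.
rewrite -T_shift -TB//; last exact: UC_shift.
rewrite -[e](divfK (lt0r_neq0 B_gt0)) mulrC; apply: T_bound'.
- by rewrite divr_ge0// ltW// B_gt0.
- by apply: UCB => //; exact: UC_shift.
- by move=> y; exact: hd.
Qed.

(** The remainder of [T f] is [T] applied to the remainder of [f], which [UC_rder] bounds at all
    points simultaneously. *)
Lemma T_rder f g w : UC f -> UC g -> (forall z, rder f w z (g z)) ->
  forall z, rder (T f) w z (T g z).
Proof.
move=> cf cg fg z e e0.
have [d d0 hd] := UC_rder cg fg (divr_gt0 e0 B_gt0).
exists d => // s sd; rewrite add0r ofR0 scale0r addr0.
have cs := UC_shift (ofR s *: w) cf.
rewrite -T_shift -TB// -TZ// -TB//; [|exact: UCB|exact: UCZ].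
rewrite (_ : e * `|s| = B * (e / B * `|s|)); last by field; rewrite gt_eqF// B_gt0.
apply: T_bound'.
- by rewrite mulr_ge0// divr_ge0// ltW// B_gt0.
- by apply: UCB; [exact: UCB|exact: UCZ].
- by move=> y; exact: hd.
Qed.

Lemma cC_UC k f a d : cC k setT f -> (forall z, ~ box a d z -> f z = 0) -> UC f.
Proof. by move=> Cf; apply: UC_supp => z; exact: cC_cont Cf _. Qed.

Lemma cderive_supp f w a d : (forall z, ~ box a d z -> f z = 0) ->
  forall z, ~ box a d z -> cderive f w z = 0.
Proof.
move=> f0 z bz; apply: rder_rderive.
apply: (@rder_near R C S n (fun=> 0)); last exact: rder_cst.
by apply: filterS (@box_out_near R C S n a d z bz) => y /f0.
Qed.

Lemma T_cC k f a d : cC k setT f -> (forall z, ~ box a d z -> f z = 0) ->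
  cC k setT (T f).
Proof.
elim: k f => [|k IH] f Cf f0; have cf := cC_UC Cf f0.
  by split=> // z _; apply: UC_cont; exact: T_UC.
apply: cCI; first exact: openT.
  by move=> z _; apply: UC_cont; exact: T_UC.
move=> w; have f0' := cderive_supp w f0.
have Cf' := cC_rderive w Cf.
exists (T (cderive f w)); last exact: IH.
move=> z _; apply: T_rder => //; first exact: cC_UC Cf' f0'.
by move=> y; exact: cC_rder Cf _.
Qed.

Lemma T_cderive k f a d w z : cC k.+1 setT f -> (forall z, ~ box a d z -> f z = 0) ->
  cderive (T f) w z = T (cderive f w) z.
Proof.
move=> Cf f0; apply: rder_rderive; apply: T_rder.
- exact: cC_UC Cf f0.
- exact: cC_UC (cC_rderive w Cf) (cderive_supp w f0).
- by move=> y; exact: cC_rder Cf _.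
Qed.

End Cauchy.

(** * The Cauchy-Pompeiu formula in one complex direction *)

Section CauchyFormula.
Context {R : realType} {C : numClosedFieldType} {S : cplx R C} {n : nat}.
Local Notation V := (matrix C 1 n).
Local Notation ofR := (@ofR R C S).
Local Notation re := (@re R C S).
Local Notation im := (@im R C S).
Local Notation cm := (@cm R C S).
Local Notation cder := (@cder R C S).
Local Notation ccont := (@ccont R C S).
Local Notation J := (@J R C S).
Local Notation cderive := (@cderive R C S _).
Local Notation cC := (@cC R C S _).
Local Notation UC := (@UC R C S _).
Local Notation box := (@box R C S _).
Local Notation Ldiff := (@Ldiff R C S _).
Local Notation cis := (@cis R C S).
Local Notation cisN := (@cisN R C S).
Local Notation ray := (@ray R C S).
Implicit Types (f g : V -> C) (v z h a : V).

Definition dbar (j : 'I_n) f z : C :=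
  2^-1 * (cderive f (delta_mx ord0 j) z + 'i * cderive f ('i *: delta_mx ord0 j) z).

Lemma Ldiff_delta f z (l : C) (k : 'I_n) : Ldiff f z (l *: delta_mx ord0 k) =
  ofR (re l) * cderive f (delta_mx ord0 k) z +
  ofR (im l) * cderive f ('i *: delta_mx ord0 k) z.
Proof.
rewrite /Ldiff (bigD1 k)//= big1 => [|j jk]; rewrite !mxE ?eqxx.
  by rewrite mulr1 addr0.
rewrite (negbTE jk) andbF mulr0 -(@ofR0 R C S) re_ofR im_ofR.
by rewrite ofR0 !mul0r addr0.
Qed.

Variables (k : 'I_n) (rho d : R) (a : V) (f : V -> C).
Let v : V := delta_mx ord0 k.
Hypotheses (Cf : cC 1 setT f) (f0 : forall z, ~ box a d z -> f z = 0).
Let D1 := cderive f v.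
Let D2 := cderive f ('i *: v).

Let UCf : UC f. Proof. exact: cC_UC Cf f0. Qed.

Let UC1 : UC D1.
Proof. exact: cC_UC (cC_rderive v Cf) (cderive_supp v f0). Qed.

Let UC2 : UC D2.
Proof. exact: cC_UC (cC_rderive ('i *: v) Cf) (cderive_supp ('i *: v) f0). Qed.

Let y z (r t : R) : V := z + ray r t *: v.

Let cder_f z (c : R -> C) t l : cder c t l ->
  cder (fun s => f (z + c s *: v)) t
    (ofR (re l) * D1 (z + c t *: v) + ofR (im l) * D2 (z + c t *: v)).
Proof.
move=> dc; rewrite -Ldiff_delta; apply: rdiff_curve dc.
by apply: (@C1_rdiff R C S n setT) => //; exact: openT.
Qed.

(** [radial] and [angular] are the derivatives of [f] along [e^(it) v] and [i e^(it) v]. In these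
    terms [2 e^(-it)] times the dbar-derivative of [f] is [radial + i angular]. *)
Let radial z r t : C := ofR (cos t) * D1 (y z r t) + ofR (sin t) * D2 (y z r t).

Let angular z r t : C := ofR (cos t) * D2 (y z r t) - ofR (sin t) * D1 (y z r t).

Let cder_radial z r t : cder (fun s => f (y z s t)) r (- radial z r t).
Proof.
have dr : cder (ray ^~ t) r (- cis t).
    by apply: cder_ext (cder_lin (- cis t) r) => s; rewrite mulrN.
have := cder_f z dr; rewrite reN imN reD imD re_iM im_iM !re_ofR !im_ofR.
by rewrite oppr0 addr0 add0r !ofRN !mulNr -opprD.
Qed.

Let cder_angular z r t : cder (fun s => f (y z r s)) t (- ofR r * angular z r t).
Proof.
have dr : cder (ray r) t (- ofR r * ('i * cis t)).
    by apply: cder_ext (cderZ (- ofR r) (cder_cis t)) => s; rewrite mulNr.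
have := cder_f z dr.
have -> : - ofR r * ('i * cis t) = ofR (r * sin t) + 'i * ofR (- (r * cos t)).
  by rewrite /cis mulrDr iM_i ofRN !ofRM; ring.
rewrite reD imD re_iM im_iM !re_ofR !im_ofR oppr0 addr0 add0r.
rewrite (_ : _ + _ = - ofR r * angular z r t)//.
by rewrite /angular /y ofRN !ofRM; ring.
Qed.

Let ccont_y g z r : UC g -> ccont (fun t => g (y z r t)).
Proof. by move=> cg; apply: UC_curve cg (ray_cont r). Qed.

Let radial_cont z r : ccont (radial z r).
Proof.
by apply: ccontD; apply: ccontM; [exact: ccont_cos|exact: ccont_y|exact: ccont_sin|exact: ccont_y].
Qed.

Let angular_cont z r : ccont (angular z r).
Proof.
by apply: ccontB; apply: ccontM; [exact: ccont_cos|exact: ccont_y|exact: ccont_sin|exact: ccont_y].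
Qed.

Let J_angular z r : J (angular z r) (pi *+ 2) = 0.
Proof.
(* For [r != 0] the integrand is [-1 / r] times the derivative of the periodic function
   [f (y z r t)] of [t]. At [r = 0] this division is impossible, but the base point no longer moves
   and a periodic primitive is explicit. *)
have [r0|r0] := eqVneq r 0.
  have y0 t : y z r t = z by rewrite /y /ray r0 ofR0 mul0r oppr0 scale0r addr0.
  rewrite (@J_eq R C S _ (fun t => ofR (sin t) * D2 z + ofR (cos t) * D1 z)); last first.
  - move=> t _; rewrite /angular y0.
    apply: (@cder_ext R C S (fun t => D2 z * ofR (sin t) + D1 z * ofR (cos t))).
      by move=> s; rewrite mulrC [D1 z * _]mulrC.
    rewrite (_ : _ - _ = D2 z * ofR (cos t) + D1 z * ofR (- sin t)); last first.
      by rewrite ofRN; ring.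
    by apply: cderD; apply: cderZ; exact: cder_ofR.
  - exact: angular_cont.
  by rewrite cos2pi sin2pi cos0 sin0 subrr.
rewrite (@J_eq R C S _ (fun t => (- ofR r)^-1 * f (y z r t))); last first.
- move=> t _; have := cderZ (- ofR r)^-1 (cder_angular z r t).
  by rewrite mulKf// oppr_eq0 ofR_eq0.
- exact: angular_cont.
by rewrite /y /ray cis2pi subrr.
Qed.

Let T_angle_dbar z r :
  T_angle v (dbar k f) z r = 2^-1 * J (radial z r) (pi *+ 2).
Proof.
rewrite /T_angle (_ : (fun t => _) =
    fun t => 2^-1 * radial z r t + (2^-1 * 'i) * angular z r t); last first.
  apply/funext => t; rewrite /dbar /radial /angular -/D1 -/D2 -/(y z r t) /cisN.
  set A := D1 _; set B := D2 _.
  have : 'i ^+ 2 = -1 :> C := sqrCi _.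
  by move: 'i A B (ofR (cos t)) (ofR (sin t)) => I A B c s I2; ring: I2.
rewrite JD; [|by apply: ccontZ; exact: radial_cont|by apply: ccontZ; exact: angular_cont].
rewrite JZ; last exact: radial_cont.
rewrite JZ; last exact: angular_cont.
by rewrite J_angular mulr0 addr0.
Qed.

(** Differentiation under the integral sign: the remainder is bounded uniformly in the angle because
    [D1] and [D2] are uniformly continuous. *)
Let cder_mean z r :
  cder (fun s => J (fun t => f (y z s t)) (pi *+ 2)) r (- J (radial z r) (pi *+ 2)).
Proof.
move=> e e0.
(* The two terms of [radial] give a factor 2, [mean_value] another 2, and [J_bound] over the full
   circle [2 * (2 * pi)]. *)
have e' : 0 < e / (16 * pi) by rewrite divr_gt0// mulr_gt0// pi_gt0.
have [d1 d10 hd1] := UC_ray v UC1 e'.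
have [d2 d20 hd2] := UC_ray v UC2 e'.
exists (Num.min d1 d2); first by rewrite lt_min d10.
move=> s; rewrite lt_min => /andP[s1 s2].
have cr q : ccont (fun t => f (y z q t)) by exact: ccont_y.
have crad := ccontZ (ofR s) (radial_cont z r).
rewrite mulrN opprK -JB// -JZ; last exact: radial_cont.
rewrite -JD//; last exact: ccontB.
rewrite (_ : e * `|s| = 2 * (4 * (e / (16 * pi)) * `|s|) * `|(pi *+ 2 : R)|); last first.
    rewrite norm2pi; have := lt0r_neq0 (pi_gt0 R).
  by move: (pi : R) => p p0; field.
apply: J_bound => [|t _]; first by apply: ccontD => //; exact: ccontB.
have M1 q : `|q| <= `|s| ->
    cder (fun q => f (y z (r + q) t) + ofR q * radial z r t) q
      (- radial z (r + q) t + radial z r t).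
  move=> _; apply: cderD; last exact: cder_lin.
  move=> e1 e10; have [d3 d30 hd3] := cder_radial z (r + q) t e10.
  by exists d3 => // p /hd3; rewrite addrA.
have M2 q : `|q| <= `|s| ->
    cm (- radial z (r + q) t + radial z r t) <= 2 * (e / (16 * pi)).
  move=> qs.
  rewrite (_ : _ + _ = - (ofR (cos t) * (D1 (y z (r + q) t) - D1 (y z r t)) +
    ofR (sin t) * (D2 (y z (r + q) t) - D2 (y z r t)))); last by rewrite /radial; ring.
  rewrite cmN (le_trans (cmD _ _))// !cmM !cm_ofR mulr_natl mulr2n lerD//.
    rewrite -[leRHS]mul1r ler_pM ?cm_ge0 ?cos_max// hd1//.
    exact: le_lt_trans qs s1.
  rewrite -[leRHS]mul1r ler_pM ?cm_ge0 ?sin_max// hd2//.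
  exact: le_lt_trans qs s2.
have := mean_value M1 M2.
rewrite addr0 ofR0 mul0r addr0 mulrA (_ : 2 * 2 = 4 :> R); last by ring.
by rewrite addrAC.
Qed.

(** The radial integrand is [-1/2] times the derivative of the circle integral [M], since the
    angular part integrates to 0. Hence the integral is [(M 0 - M rho) / 2], where [M 0] is
    [2 pi f z] and [M rho] vanishes by hypothesis. *)
Lemma T_dbar z : (forall t, f (z + ray rho t *: v) = 0) ->
  T v rho (dbar k f) z = f z.
Proof.
move=> frho.
pose M r := J (fun t => f (y z r t)) (pi *+ 2).
have UCd : UC (dbar k f).
  by apply: UCZ; apply: UCD; [exact: UC1|apply: UCZ; exact: UC2].
rewrite /T (@J_eq R C S _ (fun r => - 2^-1 * M r)); last first.
- move=> r _; rewrite T_angle_dbar -mulrNN; apply: cderZ.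
  exact: cder_mean.
- exact: T_angle_cont.
have -> : M rho = 0.
  rewrite /M (_ : (fun t => _) = fun=> 0); last by apply/funext => t; rewrite /y frho.
  rewrite (@J_eq R C S _ (fun=> 0)) ?subrr//; first exact: ccont_cst.
  by move=> t _; exact: cder_cst.
have -> : M 0 = ofR (pi *+ 2) * f z.
  rewrite /M (_ : (fun t => _) = fun=> f z); last first.
    by apply/funext => t; rewrite /y /ray ofR0 mul0r oppr0 scale0r addr0.
  rewrite (@J_eq R C S _ (fun t => ofR t * f z)) ?ofR0 ?mul0r ?subr0//.
    exact: ccont_cst.
  by move=> t _; exact: cder_lin.
rewrite mulr0 sub0r mulNr opprK mulr2n ofRD ofRV.
have : ofR pi != 0 :> C by rewrite ofR_eq0 gt_eqF ?pi_gt0.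
by move: (ofR pi) => p p0; field.
Qed.

End CauchyFormula.

(** * Cutoff functions of finite regularity *)

Section Cutoff.
Context {R : realType} {C : numClosedFieldType} {S : cplx R C} {n : nat}.
Local Notation V := (matrix C 1 n).
Local Notation ofR := (@ofR R C S).
Local Notation re := (@re R C S).
Local Notation im := (@im R C S).
Local Notation cm := (@cm R C S).
Local Notation cder := (@cder R C S).
Local Notation ccont := (@ccont R C S).
Local Notation J := (@J R C S).
Local Notation vn := (@vn R C S _).
Local Notation cC := (@cC R C S _).
Implicit Types (f : V -> C) (g : R -> C) (v z h a : V) (W : set V).

Fixpoint lineC (k : nat) (g : R -> C) : Prop :=
  ccont g /\
  if k is k'.+1 then exists2 g', forall t, cder g t (g' t) & lineC k' g' else True.

Lemma lineC_cont k g : lineC k g -> ccont g.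
Proof. by case: k => [|k] []. Qed.

Lemma lineC_le k m g : (k <= m)%N -> lineC m g -> lineC k g.
Proof.
elim: k m g => [|k IH] m g km Cg; first by split=> //; exact: lineC_cont Cg.
case: m km Cg => // m km [cg [g' dg Cg']]; split=> //.
by exists g' => //; exact: IH Cg'.
Qed.

Lemma lineC_shift k g (w : R) : lineC k g -> lineC k (fun t => g (t + w)).
Proof.
have S1 (f : R -> C) : ccont f -> ccont (fun t => f (t + w)).
  move=> cf t e e0; have [d d0 hd] := cf (t + w) e e0.
  by exists d => // s /hd; rewrite [t + s + _]addrAC.
elim: k g => [|k IH] g [cg hg]; split => //; try exact: S1.
have [g' dg Cg] := hg; exists (fun t => g' (t + w)); last exact: IH.
move=> t e e0; have [d d0 hd] := dg (t + w) e e0.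
by exists d => // s /hd; rewrite [t + s + _]addrAC.
Qed.

Lemma lineCZ k (b : C) g : lineC k g -> lineC k (fun t => b * g t).
Proof.
elim: k g => [|k IH] g [cg hg]; split => //; try exact: ccontZ.
have [g' dg Cg] := hg; exists (fun t => b * g' t); last exact: IH.
by move=> t; exact: cderZ.
Qed.

Lemma lineCB k g g' : lineC k g -> lineC k g' -> lineC k (fun t => g t - g' t).
Proof.
elim: k g g' => [|k IH] g g' [cg hg] [cg' hg']; split => //; try exact: ccontB.
have [f df Cf] := hg; have [f' df' Cf'] := hg'.
exists (fun t => f t - f' t); last exact: IH.
by move=> t; exact: cderB.
Qed.

(* Averaging over windows of radius [w] gains one derivative. *)
Lemma lineC_mean k g (w : R) : 0 < w -> lineC k g ->
  lineC k.+1 (fun x => ofR (2 * w)^-1 * (J g (x + w) - J g (x - w))).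
Proof.
move=> w0 Cg.
have cg := lineC_cont Cg.
have D t : cder (fun x => ofR (2 * w)^-1 * (J g (x + w) - J g (x - w))) t
    (ofR (2 * w)^-1 * (g (t + w) - g (t - w))).
  have Jd u : cder (fun x => J g (x + u)) t (g (t + u)).
    move=> e e0; have [d d0 hd] := (J_spec cg).2 (t + u) e e0.
    by exists d => // s /hd; rewrite [t + s + _]addrAC.
  by apply: cderZ; apply: cderB.
split; first exact: cder_ccont D.
exists (fun t => ofR (2 * w)^-1 * (g (t + w) - g (t - w))) => //.
by apply: lineCZ; apply: lineCB; exact: lineC_shift.
Qed.

(** Where [g] is constant its primitive is affine; so averaging preserves the plateaus of a cutoff,
    up to the width of the window. *)
Lemma J_window g (x w : R) (c : C) : ccont g -> 0 < w ->
  (forall t, `|t| <= w -> g (x + t) = c) ->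
  ofR (2 * w)^-1 * (J g (x + w) - J g (x - w)) = c.
Proof.
move=> cg w0 gc.
have D t : `|t| <= w -> cder (fun t => J g (x + t) - ofR t * c) t 0.
  move=> tw; rewrite -(subrr c); apply: cderB; last exact: cder_lin.
  rewrite -(gc t tw) => e e0; have [d d0 hd] := (J_spec cg).2 (x + t) e e0.
  by exists d => // s /hd; rewrite addrA.
have E u : `|u| = w -> J g (x + u) - ofR u * c = J g x.
  move=> uw; rewrite (@cder0_eq R C S (fun t => J g (x + t) - ofR t * c) u).
    by rewrite addr0 ofR0 mul0r subr0.
  by move=> t; rewrite uw; exact: D.
have E1 := E w (gtr0_norm w0).
have E2 := E (- w); rewrite normrN in E2; have {}E2 := E2 (gtr0_norm w0).
rewrite (_ : J g (x + w) - J g (x - w) = ofR (2 * w) * c).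
  by rewrite mulrA -ofRM mulVf ?ofR1 ?mul1r// mulf_neq0 ?gt_eqF.
have -> : J g (x + w) = J g x + ofR w * c by rewrite -E1 subrK.
have -> : J g (x - w) = J g x + ofR (- w) * c by rewrite -E2 subrK.
by rewrite ofRN (_ : 2 * w = w + w) ?ofRD; ring.
Qed.

(** A piecewise linear plateau function is averaged [k] times; each averaging gains a derivative and
    eats a margin [w] at both ends of the transition. *)
Lemma cutoff_line k (A B : R) : 0 < A -> A < B -> exists g : R -> C,
  [/\ lineC k g, forall x, `|x| <= A -> g x = 1 & forall x, B <= `|x| -> g x = 0].
Proof.
elim: k A B => [|k IH] A B A0 AB.
  have c0 : 0 < B - A by rewrite subr_gt0.
  pose u (x : R) : R := (B - `|x|) / (B - A).
  (* This expression truncates [u x] to the interval from 0 to 1; absolute values make its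
     continuity a matter of the reverse triangle inequality. *)
  exists (fun x => ofR ((`|u x| - `|u x - 1| + 1) / 2)); split.
  - split=> // t e e0; exists (e * (B - A)); first exact: mulr_gt0.
    move=> s sd; rewrite -ofRB cm_ofR.
    have us : `|u (t + s) - u t| <= e.
      rewrite (_ : _ - _ = (`|t| - `|t + s|) / (B - A)); last by rewrite /u; ring.
      rewrite normrM normfV (gtr0_norm c0).
      rewrite ler_pdivrMr// (le_trans (ler_dist_dist _ _))//.
      by rewrite opprD addrA subrr sub0r normrN ltW.
    have h1 := ler_dist_dist (u (t + s)) (u t).
    have h2 := ler_dist_dist (u (t + s) - 1) (u t - 1).
    rewrite opprB addrA subrK in h2.
    move: us h1 h2; set p := `|_ - _|; set q := `|u (t + s)|; set q' := `|u t|.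
    set r := `|u (t + s) - 1|; set r' := `|u t - 1|.
    clearbody p q q' r r'.
    move=> us; rewrite !ler_norml => /andP[h1 h2] /andP[h3 h4].
    by apply/andP; split; lra.
  - move=> x xA; have u1 : 1 <= u x by rewrite /u ler_pdivlMr// mul1r lerD2l lerN2.
    rewrite ger0_norm ?(le_trans ler01)// ger0_norm ?subr_ge0//.
    by rewrite opprB addrCA subrr addr0 -[1 + 1]/(2%:R) divff// ofR1.
  - move=> x xB; have u1 : u x <= 0.
      by rewrite /u -oppr_ge0 -mulNr opprB divr_ge0 ?subr_ge0// ltW.
    rewrite ler0_norm// ler0_norm ?subr_le0 ?(le_trans u1)//.
    by rewrite (_ : (_ / 2) = 0) ?ofR0//; field.
(* A quarter leaves a transition of positive length between [A + w] and [B - w] for the induction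
   hypothesis. *)
pose w := (B - A) / 4.
have w0 : 0 < w by rewrite divr_gt0// subr_gt0.
have [||g [Cg g1 g0]] := IH (A + w) (B - w); first exact: addr_gt0.
  by rewrite /w; lra.
exists (fun x => ofR (2 * w)^-1 * (J g (x + w) - J g (x - w))); split.
- exact: lineC_mean.
- move=> x xA; apply: J_window => //; first exact: lineC_cont Cg.
  by move=> t tw; apply: g1; rewrite (le_trans (ler_normD _ _))// lerD.
- move=> x xB; apply: J_window => //; first exact: lineC_cont Cg.
  move=> t tw; apply: g0; rewrite -[x](opprK x) -normrN opprD opprK.
  rewrite (le_trans _ (lerB_dist _ _))// normrN.
  by rewrite lerB.
Qed.

Lemma lineC_comp k g (l : V -> R) : lineC k g ->
  (forall z h, `|l (z + h) - l z| <= vn h) ->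
  (forall v, exists m, forall z s, l (z + ofR s *: v) = l z + s * m) ->
  cC k setT (fun z => g (l z)).
Proof.
move=> + l1 l2; elim: k g => [|k IH] g Cg.
  split=> // z _; apply/(@contVP R C S n _ z) => e e0.
  have [d d0 hd] := lineC_cont Cg (l z) e0; exists d => // h hlt.
  rewrite (_ : l (z + h) = l z + (l (z + h) - l z)); last by rewrite [RHS]addrC subrK.
  by apply: hd; exact: le_lt_trans (l1 _ _) hlt.
apply: cCI; first exact: openT.
  move=> z _; apply/(@contVP R C S n _ z) => e e0.
  have [d d0 hd] := lineC_cont Cg (l z) e0; exists d => // h hlt.
  rewrite (_ : l (z + h) = l z + (l (z + h) - l z)); last by rewrite [RHS]addrC subrK.
  by apply: hd; exact: le_lt_trans (l1 _ _) hlt.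
move=> v; have [m lm] := l2 v; have [_ [g' dg Cg']] := Cg.
exists (fun z => ofR m * g' (l z)); last first.
  by apply: cCZ; [exact: openT|exact: IH].
move=> z _ e e0; have m0 : 0 < `|m| + 1 by rewrite ltr_wpDl.
have [d d0 hd] := dg (l z) _ (divr_gt0 e0 m0).
exists (d / (`|m| + 1)); first exact: divr_gt0.
move=> s sd; rewrite add0r ofR0 scale0r addr0 lm.
have sm : `|s * m| < d.
  rewrite normrM; rewrite ltr_pdivlMr// in sd; apply: le_lt_trans sd.
  by rewrite ler_wpM2l// lerDl.
have := hd _ sm; rewrite ofRM -mulrA => /le_trans; apply.
rewrite normrM (_ : e * `|s| = e / (`|m| + 1) * (`|s| * (`|m| + 1))); last first.
  by field; rewrite gt_eqF.
apply: ler_wpM2l; first by rewrite divr_ge0// ltW.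
by rewrite ler_wpM2l// lerDl.
Qed.

(** The cutoff is a product with one factor per complex coordinate, so that along a line of
    direction [e_k] only the factor of index [k] varies; [dbar_solve1] depends on this. *)
Definition slab (g : R -> C) (a z : V) (j : 'I_n) : C :=
  g (re (z ord0 j - a ord0 j)) * g (im (z ord0 j - a ord0 j)).

Lemma slab_cC k g a j : lineC k g -> cC k setT (fun z => slab g a z j).
Proof.
move=> Cg; apply: cCM; first exact: openT.
  apply: (lineC_comp (l := fun z => re (z ord0 j - a ord0 j))) => //.
    move=> z h; rewrite mxE -reN -reD (_ : _ - _ = h ord0 j); last by ring.
    by rewrite (le_trans (cm_re _))// vn_coord.
  move=> v; exists (re (v ord0 j)) => z s; rewrite !mxE addrAC.
    rewrite [LHS]reD; congr (_ + _).
  by rewrite reM re_ofR im_ofR mul0r subr0.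
apply: (lineC_comp (l := fun z => im (z ord0 j - a ord0 j))) => //.
  move=> z h; rewrite mxE -imN -imD (_ : _ - _ = h ord0 j); last by ring.
  by rewrite (le_trans (cm_im _))// vn_coord.
move=> v; exists (im (v ord0 j)) => z s; rewrite !mxE addrAC.
rewrite [LHS]imD; congr (_ + _).
by rewrite imM re_ofR im_ofR mul0r addr0.
Qed.

Lemma cC_prod k W (I : Type) (r : seq I) (F : I -> V -> C) : open W ->
  (forall i, cC k W (F i)) -> cC k W (fun z => \prod_(i <- r) F i z).
Proof.
move=> oW CF; elim: r => [|i r IH].
  by apply: (cC_eq oW _ (cC_cst k 1 oW)) => z _; rewrite big_nil.
by apply: (cC_eq oW _ (cCM oW (CF i) IH)) => z _; rewrite big_cons.
Qed.

Lemma vn_lt h (e : R) : 0 < e -> (forall j, cm (h ord0 j) < e) -> vn h < e.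
Proof.
move=> e0 he; rewrite -(@ofR_lt R C S) -vnE.
suff : ball (0 : V) (ofR e) h by rewrite mx_norm_ball /ball_ /= sub0r normrN.
split; first by rewrite -(@ofR0 R C S) ofR_lt.
move=> i j; rewrite mxE -ball_normE /ball_ /= sub0r normrN cmE ofR_lt ord1.
exact: he.
Qed.

End Cutoff.

(** * The local Dolbeault lemma *)

Section Dolbeault.
Context {R : realType} {C : numClosedFieldType} {S : cplx R C} {n : nat}.
Local Notation V := (matrix C 1 n).
Local Notation re := (@re R C S).
Local Notation im := (@im R C S).
Local Notation J := (@J R C S).
Local Notation vn := (@vn R C S _).
Local Notation rder := (@rder R C S _).
Local Notation cderive := (@cderive R C S _).
Local Notation cC := (@cC R C S _).
Local Notation UC := (@UC R C S _).
Local Notation box := (@box R C S _).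
Local Notation lineC := (@lineC R C S).
Local Notation slab := (@slab R C S _).
Local Notation dbar := (@dbar R C S _).
Local Notation ray := (@ray R C S).
Local Notation T := (@T R C S _).
Implicit Types (f g : V -> C) (v z h a : V) (W : set V).

Lemma dbar_cC k W f j : open W -> cC k.+1 W f -> cC k W (dbar j f).
Proof.
move=> oW Cf; apply: cCZ => //; apply: cCD => //; last apply: cCZ => //.
  exact: cC_rderive.
exact: cC_rderive.
Qed.

Lemma cderive_comm_pair W f v v' w w' z : open W -> cC 2 W f -> W z ->
  2^-1 * (cderive (fun y => 2^-1 * (cderive f v y + 'i * cderive f v' y)) w z +
    'i * cderive (fun y => 2^-1 * (cderive f v y + 'i * cderive f v' y)) w' z) =
  2^-1 * (cderive (fun y => 2^-1 * (cderive f w y + 'i * cderive f w' y)) v z +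
    'i * cderive (fun y => 2^-1 * (cderive f w y + 'i * cderive f w' y)) v' z).
Proof.
move=> oW Cf Wz.
have D p q r : cderive (fun y => 2^-1 * (cderive f p y + 'i * cderive f q y)) r z =
    2^-1 * (cderive (cderive f p) r z + 'i * cderive (cderive f q) r z).
  apply: rder_rderive; apply: rderZ; apply: rderD; last apply: rderZ.
    exact: cC_rder (cC_rderive p Cf) Wz.
  exact: cC_rder (cC_rderive q Cf) Wz.
have K p q := cderive_comm p q oW Cf Wz.
have A (p q r t : C) : 2^-1 * (2^-1 * (p + 'i * q) + 'i * (2^-1 * (r + 'i * t))) =
    2^-1 * (2^-1 * (p + 'i * r) + 'i * (2^-1 * (q + 'i * t))) by ring.
rewrite (D v v' w) (D v v' w') (D w w' v) (D w w' v').
rewrite (K w v) (K w v') (K w' v) (K w' v'); exact: A.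
Qed.

Lemma dbar_comm W f i j z : open W -> cC 2 W f -> W z ->
  dbar i (dbar j f) z = dbar j (dbar i f) z.
Proof. exact: cderive_comm_pair. Qed.

Lemma dbarD W f g j z : cC 1 W f -> cC 1 W g -> W z ->
  dbar j (fun y => f y + g y) z = dbar j f z + dbar j g z.
Proof.
move=> Cf Cg Wz; rewrite /dbar.
do 2! rewrite (rder_rderive (rderD (cC_rder _ Cf Wz) (cC_rder _ Cg Wz))).
by ring.
Qed.

Lemma dbarB W f g j z : cC 1 W f -> cC 1 W g -> W z ->
  dbar j (fun y => f y - g y) z = dbar j f z - dbar j g z.
Proof.
move=> Cf Cg Wz; rewrite /dbar.
do 2! rewrite (rder_rderive (rderB (cC_rder _ Cf Wz) (cC_rder _ Cg Wz))).
by ring.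
Qed.

Lemma dbar0 j z : dbar j (fun=> 0) z = 0.
Proof.
by rewrite /dbar !(rder_rderive (rder_cst _ _ _)) mulr0 addr0 mulr0.
Qed.

Lemma dbar_near W f g j z : cC 1 W f -> W z -> (\forall y \near z, f y = g y) ->
  dbar j f z = dbar j g z.
Proof.
move=> Cf Wz fg; rewrite /dbar.
by do 2! rewrite (rder_rderive (rder_near fg (cC_rder _ Cf Wz))).
Qed.

Lemma T_line0 v rho f z : (forall r t, f (z + ray r t *: v) = 0) -> T v rho f z = 0.
Proof.
move=> f0.
have J0 x : J (fun=> 0) x = 0.
  rewrite (@J_eq R C S _ (fun=> 0)) ?subrr//; first exact: ccont_cst.
  by move=> t _; exact: cder_cst.
rewrite /T (_ : T_angle v f z = fun=> 0) ?J0 ?mulr0//.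
apply/funext => r; rewrite /T_angle (_ : (fun t => _) = fun=> 0) ?J0//.
by apply/funext => t; rewrite f0 mulr0.
Qed.

Lemma dbar_T v rho f a d j z : cC 1 setT f -> (forall z, ~ box a d z -> f z = 0) ->
  dbar j (T v rho f) z = T v rho (dbar j f) z.
Proof.
move=> Cf f0; rewrite /dbar !(T_cderive _ _ _ _ Cf f0).
have U w : UC (cderive f w) := cC_UC (cC_rderive w Cf) (cderive_supp w f0).
rewrite TZ; last by apply: UCD => //; exact: UCZ.
by rewrite TD ?TZ//; exact: UCZ.
Qed.

Lemma cutoff k a (d : R) : 0 < d -> exists g : R -> C,
  [/\ lineC k g, cC k setT (fun z => \prod_j slab g a z j),
    forall x, `|x| <= d / 2 -> g x = 1 &
    forall z, ~ box a d z -> \prod_j slab g a z j = 0].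
Proof.
move=> d0; have [||g [Cg g1 g0]] := @cutoff_line R C S k (d / 2) d.
- by rewrite divr_gt0.
- by rewrite ltr_pdivrMr// ltr_pMr// ltr1n.
exists g; split => //.
  by apply: cC_prod; [exact: openT|move=> j; exact: slab_cC].
move=> z /existsNP[j hj]; rewrite (bigD1 j)//= (_ : slab g a z j = 0) ?mul0r//.
rewrite /slab.
have [h1|h1] := leP `|re (z ord0 j - a ord0 j)| d; last by rewrite g0 ?mul0r// ltW.
have [h2|h2] := leP `|im (z ord0 j - a ord0 j)| d; last by rewrite (g0 (im _)) ?mulr0// ltW.
by case: hj.
Qed.

(** Two points of the box differ by at most [2 * d] in the real and imaginary parts of coordinate
    [k], so the square of their distance there is at most [8 * d^2], below [25 * d^2]. *)
Lemma ray_out (k : 'I_n) a (d : R) z t : 0 < d -> box a d z ->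
  ~ box a d (z + ray (5 * d) t *: delta_mx ord0 k).
Proof.
move=> d0 /(_ k)[h1 h2] /(_ k); rewrite !mxE !eqxx mulr1 addrAC reD imD.
rewrite /ray reN imN reM imM re_ofR im_ofR /cis reD imD re_iM im_iM.
rewrite !re_ofR !im_ofR oppr0 addr0 add0r !mul0r subr0 addr0 => -[h3 h4].
move: h1 h2 h3 h4; set x := re _; set y := im _.
rewrite !ler_norml => /andP[x1 x2] /andP[y1 y2] /andP[x3 x4] /andP[y3 y4].
have := cos2Dsin2 t; move: (cos t) (sin t) x3 x4 y3 y4 => c s x3 x4 y3 y4 cs.
have c1 : `|5 * d * c| <= 2 * d by rewrite ler_norml; apply/andP; split; lra.
have s1 : `|5 * d * s| <= 2 * d by rewrite ler_norml; apply/andP; split; lra.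
have dge0 : 0 <= 2 * d by rewrite mulr_ge0// ltW.
have c2 : (5 * d * c) ^+ 2 <= (2 * d) ^+ 2.
  by rewrite -[leLHS]real_normK ?num_real// ler_pXn2r ?nnegrE.
have s2 : (5 * d * s) ^+ 2 <= (2 * d) ^+ 2.
  by rewrite -[leLHS]real_normK ?num_real// ler_pXn2r ?nnegrE.
have E : (5 * d * c) ^+ 2 + (5 * d * s) ^+ 2 = 25 * d ^+ 2.
  by rewrite (_ : 25 * d ^+ 2 = 25 * d ^+ 2 * (c ^+ 2 + s ^+ 2)); [ring|rewrite cs mulr1].
have dd : 0 < d ^+ 2 by rewrite exprn_gt0.
have : (2 * d) ^+ 2 = 4 * d ^+ 2 by ring.
by move: (d ^+ 2) ((2 * d) ^+ 2) ((5 * d * c) ^+ 2) ((5 * d * s) ^+ 2) dd c2 s2 E => *; lra.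
Qed.

(* One variable at a time: [u] absorbs the component [g k], the last one that is
   nonzero, and stays holomorphic in the variables of index larger than [k]. *)
Lemma dbar_solve1 m W a (k : 'I_n) (g : 'I_n -> V -> C) : open W -> W a ->
  (forall j, cC m.+1 W (g j)) ->
  (forall i j z, W z -> dbar i (g j) z = dbar j (g i) z) ->
  (forall (j : 'I_n) z, (k < j)%N -> W z -> g j z = 0) ->
  exists W' u, [/\ open W', W' a, W' `<=` W, cC m.+1 setT u &
    (forall z, W' z -> dbar k u z = g k z) /\
    (forall (j : 'I_n) z, (k < j)%N -> W' z -> dbar j u z = 0)].
Proof.
move=> oW Wa Cg gE g0.
have [d0 d00 hW] := @openVP R C S n W a oW Wa.
(* Each coordinate of a point of the box is within [2 * d] of that of [a], hence within [d0]. *)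
pose d := d0 / 4.
have d_gt0 : 0 < d by rewrite divr_gt0.
have boxW : box a d `<=` W.
  move=> z bz; rewrite -(subrK a z) addrC; apply: hW; apply: vn_lt => // j.
  rewrite !mxE (le_lt_trans (cm_le _))//; have [h1 h2] := bz j.
  by rewrite (le_lt_trans (lerD h1 h2))// /d; lra.
have [c [Cc CX c1 X0]] := cutoff m.+1 a d_gt0.
pose X z := \prod_j slab c a z j.
pose phi z := X z * g k z.
have phi0 z : ~ box a d z -> phi z = 0 by move=> /X0 X0z; rewrite /phi /X X0z mul0r.
have Cphi : cC m.+1 setT phi.
  have onW : open (~` box a d).
    rewrite openE => z nbz; exact: (@box_out_near R C S n a d z nbz).
  (* [g k] is regular on [W] only; but [phi] is regular there and vanishes on the open complement of
     the box, and these two open sets cover everything. *)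
  have -> : [set: V] = W `|` ~` box a d.
    apply/seteqP; split=> // z _; have [bz|bz] := pselect (box a d z).
      by left; exact: boxW.
    by right.
  apply: cC_cup => //.
    by apply: cCM => //; exact: cC_sub CX.
  apply: (@cC_eq R C S n m.+1 _ (fun=> 0)) => //; last exact: cC_cst.
  by move=> z /phi0.
pose W' := [set z | vn (z - a) < d / 2].
have d2 : 0 < d / 2 by rewrite divr_gt0.
have W'box z : W' z -> box a (d / 2) z.
  move=> zW j; have := le_trans (vn_coord (z - a) j) (ltW zW); rewrite !mxE => h.
  by split; [exact: le_trans (cm_re _) h|exact: le_trans (cm_im _) h].
have W'box' z : W' z -> box a d z.
  move=> /W'box + j => /(_ j)[h1 h2].
  by split; apply: (le_trans); [exact: h1| |exact: h2|]; rewrite ler_pdivrMr// ler_pMr// ler1n.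
have slab1 z j : W' z -> slab c a z j = 1.
  by move=> /W'box /(_ j)[h1 h2]; rewrite /slab !c1// mulr1.
exists W', (T (delta_mx ord0 k) (5 * d) phi); split.
- rewrite openE => z zW; apply/(@nbhsVP R C S n z).
  exists (d / 2 - vn (z - a)); first by rewrite subr_gt0.
  move=> h hlt; rewrite /W' /= addrAC (le_lt_trans (vnD _ _))//.
  by rewrite -ltrBrDl.
- by rewrite /W' /= subrr vn0.
- by move=> z /W'box' /boxW.
- exact: T_cC Cphi phi0.
have C1 := cC_le (isT : (1 <= m.+1)%N) Cphi.
split=> [z zW|j z kj zW].
  rewrite (dbar_T _ _ _ _ C1 phi0) (T_dbar C1 phi0).
    by rewrite /phi /X big1 ?mul1r// => j _; exact: slab1.
  by move=> t; apply: phi0; apply: ray_out => //; exact: W'box'.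
(* On the line through [z] of direction [e_k], the coordinates other than [k] are those of [z], near
   which their cutoff factors are 1. So [phi] is locally [slab c a x k * g k x]; its first factor is
   constant in direction [j], and [dbar j (g k) = dbar k (g j)] vanishes as [k < j]. *)
rewrite (dbar_T _ _ _ _ C1 phi0); apply: T_line0 => r t.
set y := z + _.
have [by_|by_] := pselect (box a d y); last first.
  rewrite (dbar_near (g := fun=> 0) _ C1)// ?dbar0//.
  by apply: filterS (@box_out_near R C S n a d y by_) => x /phi0.
have Wy := boxW _ by_.
have ky i : i != k -> y ord0 i = z ord0 i.
  by move=> ik; rewrite /y !mxE (negbTE ik) andbF mulr0 addr0.
have near1 : \forall x \near y, phi x = slab c a x k * g k x.
  have W'n : \forall x \near z, W' x.
    apply/(@nbhsVP R C S n z); exists (d / 2 - vn (z - a)); first by rewrite subr_gt0.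
    move=> h hlt; rewrite /W' /= addrAC (le_lt_trans (vnD _ _))//.
    by rewrite -ltrBrDl.
  move/(@nbhsVP R C S n z) : W'n => [e e0 he].
  apply/(@nbhsVP R C S n y); exists e => // h hlt.
  rewrite /phi /X (bigD1 k)//= big1 ?mulr1// => i ik.
  rewrite /slab [(y + h) ord0 i]mxE ky//; have := slab1 _ i (he h hlt).
  by rewrite /slab [(z + h) ord0 i]mxE.
have kj' : j != k by rewrite neq_ltn kj orbT.
have C1g := cC_le (isT : (1 <= m.+1)%N) (Cg k).
have Cs : cC 1 setT (fun x => slab c a x k).
  by apply: slab_cC; exact: lineC_le (isT : (1 <= m.+1)%N) Cc.
have D (l : C) : cderive phi (l *: delta_mx ord0 j) y =
    slab c a y k * cderive (g k) (l *: delta_mx ord0 j) y.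
  apply: rder_rderive; apply: (@rder_near R C S n (fun x => slab c a x k * g k x)).
    by apply: filterS near1 => x ->.
  rewrite -[X in rder _ _ _ X]add0r -[X in X + _](mul0r (g k y)).
  apply: rderM; first exact: cC_cont Cs _.
    apply: (@cder_ext R C S (fun=> slab c a y k)); last exact: cder_cst.
    move=> s; rewrite /slab !mxE [k == j]eq_sym (negbTE kj') andbF !mulr0 addr0//.
  exact: cC_rder C1g Wy.
have -> : dbar j phi y = slab c a y k * dbar j (g k) y.
  by rewrite /dbar D -[delta_mx ord0 j]scale1r D; ring.
rewrite gE// (dbar_near (g := fun=> 0) _ (cC_le (isT : (1 <= m.+1)%N) (Cg j)) Wy).
  by rewrite dbar0 mulr0.
by apply: filterS (open_nbhs_nbhs (conj oW Wy)) => x; exact: g0.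
Qed.

(** Induction on the number [m] of components that may be nonzero. Subtracting the dbar of the
    solution for the last one kills it, keeps the later ones zero and preserves the compatibility
    conditions, at the price of one derivative; hence the class [C^(m+1)]. *)
Lemma dbar_solve m W a (g : 'I_n -> V -> C) : (m <= n)%N -> open W -> W a ->
  (forall j, cC m.+1 W (g j)) ->
  (forall i j z, W z -> dbar i (g j) z = dbar j (g i) z) ->
  (forall (j : 'I_n) z, (m <= j)%N -> W z -> g j z = 0) ->
  exists W' u, [/\ open W', W' a, W' `<=` W, cC 1 W' u &
    forall j z, W' z -> dbar j u z = g j z].
Proof.
elim: m W g => [|m IH] W g mn oW Wa Cg gE g0.
  exists W, (fun=> 0); split=> //; first exact: cC_cst.
  by move=> j z Wz; rewrite dbar0 g0.
pose k := Ordinal mn.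
have [W1 [u1 [oW1 W1a W1W Cu1 [uk uj]]]] := dbar_solve1 (k := k) oW Wa Cg gE g0.
have Cu W2 p : (p <= m.+2)%N -> cC p W2 u1.
  by move=> pm; apply: cC_le pm _; exact: cC_sub Cu1.
have Cg1 p j : (p <= m.+2)%N -> cC p W1 (g j).
  by move=> pm; apply: cC_le pm _; exact: cC_sub (Cg j).
have Cg' j : cC m.+1 W1 (fun z => g j z - dbar j u1 z).
  by apply: cCB => //; [exact: Cg1|apply: dbar_cC => //; exact: Cu].
have [||W' [u [oW' W'a W'W1 Cu' u'E]]] :=
  IH W1 (fun j z => g j z - dbar j u1 z) (ltnW mn) oW1 W1a Cg'.
- move=> i j z W1z.
  have Cd l : cC 1 W1 (dbar l u1) by apply: dbar_cC => //; exact: Cu.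
  rewrite !(dbarB _ (Cg1 1 _ isT) (Cd _) W1z) gE; last exact: W1W.
  by rewrite (dbar_comm _ _ oW1 (Cu W1 2 isT) W1z).
- move=> j z mj W1z; have [jk|jk] := eqVneq j k.
    by rewrite jk uk// subrr.
  have kj : (k < j)%N by rewrite ltn_neqAle mj andbT eq_sym.
  by rewrite uj// g0 ?subrr//; exact: W1W.
exists W', (fun z => u1 z + u z); split=> //.
- by move=> z /W'W1 /W1W.
- by apply: cCD => //; exact: Cu.
move=> j z W'z; rewrite (dbarD _ (Cu W' 1 isT) Cu' W'z) u'E//.
by rewrite addrC subrK.
Qed.

End Dolbeault.

(** * Complex-linear differentials and the (0,1)-part of a 1-form *)

Section ComplexDifferentials.
Context {R : realType} {C : numClosedFieldType} {S : cplx R C} {n : nat}.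
Local Notation V := (matrix C 1 n).
Local Notation ofR := (@ofR R C S).
Local Notation re := (@re R C S).
Local Notation im := (@im R C S).
Local Notation cm := (@cm R C S).
Local Notation vn := (@vn R C S _).
Local Notation cderive := (@cderive R C S _).
Local Notation cC := (@cC R C S _).
Local Notation Ldiff := (@Ldiff R C S _).
Local Notation rdiff := (@rdiff R C S _).
Implicit Types (f g : V -> C) (v z h : V) (W : set V) (L : V -> C).

Definition Clinear L : Prop := exists c : 'I_n -> C, forall h, L h = \sum_j h ord0 j * c j.

Lemma ClinearD L L' : Clinear L -> Clinear L' -> Clinear (fun h => L h + L' h).
Proof.
move=> [c cE] [c' cE']; exists (fun j => c j + c' j) => h.
by rewrite cE cE' -big_split; apply: eq_bigr => j _; rewrite mulrDr.
Qed.

Lemma ClinearN L : Clinear L -> Clinear (fun h => - L h).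
Proof.
move=> [c cE]; exists (fun j => - c j) => h.
by rewrite cE -sumrN; apply: eq_bigr => j _; rewrite mulrN.
Qed.

Lemma Clinear_comp L (t : {linear V -> V}) : Clinear L -> Clinear (fun h => L (t h)).
Proof.
move=> [c cE]; exists (fun j => L (t (delta_mx ord0 j))) => h.
rewrite {1}(row_sum_delta h) linear_sum cE.
under eq_bigr do rewrite summxE mulr_suml.
rewrite exchange_big; apply: eq_bigr => j _ /=.
rewrite cE mulr_sumr; apply: eq_bigr => i _.
by rewrite linearZ mxE mulrA.
Qed.

Lemma rdiffD f g z L M : rdiff f z L -> rdiff g z M ->
  rdiff (fun y => f y + g y) z (fun h => L h + M h).
Proof.
move=> hf hg e e0; have e2 : 0 < e / 2 by rewrite divr_gt0.
have [d d0 hd] := hf _ e2; have [d' d0' hd'] := hg _ e2.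
exists (Num.min d d'); rewrite ?lt_min ?d0// => s.
rewrite lt_min => /andP[/hd k /hd' k'].
rewrite (_ : _ - _ = (f (z + s) - f z - L s) + (g (z + s) - g z - M s)); last by ring.
rewrite (le_trans (cmD _ _))// (le_trans (lerD k k'))//.
by rewrite -mulrDl -splitr.
Qed.

Lemma rdiffN f z L : rdiff f z L -> rdiff (fun y => - f y) z (fun h => - L h).
Proof.
move=> hf e /hf[d d0 hd]; exists d => // s /hd.
by rewrite -cmN !opprD.
Qed.

Lemma rdiff_cst (c : C) z : rdiff (fun=> c) z (fun=> 0).
Proof.
move=> e e0; exists 1 => // h _.
by rewrite subrr subr0 cm0 mulr_ge0 ?vn_ge0// ltW.
Qed.

Lemma rdiff_near f g z L : (\forall y \near z, f y = g y) -> rdiff f z L -> rdiff g z L.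
Proof.
move=> fg hf e /hf[d d0 hd]; have fgz := nbhs_singleton fg.
move/(@nbhsVP R C S n z) : fg => [d' d0' hd'].
exists (Num.min d d'); first by rewrite lt_min d0.
by move=> h; rewrite lt_min => /andP[/hd + /hd' <-]; rewrite fgz.
Qed.

Lemma rdiff_eq f z L M : (forall h, L h = M h) -> rdiff f z L -> rdiff f z M.
Proof. by move=> /funext ->. Qed.

(** This is the Cauchy-Riemann criterion. [L] is packaged as a continuous linear map so that
    [diff_unique] can identify it with the complex differential. *)
Lemma rdiff_differentiable f z L : rdiff f z L -> Clinear L -> differentiable f z.
Proof.
move=> hf [c cE].
have lin : linear (fun h : V => \sum_j h ord0 j * c j : C).
  move=> b u v; rewrite scaler_sumr -big_split; apply: eq_bigr => j _ /=.
  by rewrite !mxE mulrDl scalerAl.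
pose lm := GRing.isLinear.Build _ _ _ _ _ lin.
pose df : {linear V -> C} := HB.pack (fun h : V => \sum_j h ord0 j * c j : C) lm.
have cdf : continuous df.
  move=> h; apply/(@contVP R C S n _ h) => e e0.
  pose K := \sum_j cm (c j) + 1.
  have K0 : 0 < K by rewrite ltr_wpDl// sumr_ge0// => j _; exact: cm_ge0.
  exists (e / K); first exact: divr_gt0.
  move=> k kd; rewrite -linearB /= [h + k]addrC addrK.
  rewrite ltr_pdivlMr// in kd; apply: le_trans (ltW kd).
  rewrite (le_trans (cm_sum _ _ _))// /K mulrDr mulr1 ler_wpDr ?vn_ge0//.
  rewrite mulr_sumr; apply: ler_sum => j _.
  by rewrite cmM ler_wpM2r ?cm_ge0 ?vn_coord.
have H : f \o shift z = cst (f z) + (df : V -> C) +o_ (0 : V) id.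
  apply/eqaddoP => e e0.
  have eE : e = ofR (cm e) by rewrite -cmE gtr0_norm.
  have ce0 : 0 < cm e by rewrite -(@ofR_lt R C S) -eE ofR0.
  have [d d0 hd] := hf _ ce0.
  apply/(@nbhsVP R C S n 0); exists d => // h /hd.
  rewrite add0r cmE vnE [e in _ -> _ <= e * _]eE -ofRM ofR_le cE => H.
  rewrite (_ : (_ - _) h = f (z + h) - f z - \sum_j h ord0 j * c j)//.
  by rewrite !fctE /= [h + z]addrC opprD addrA.
have dE := diff_unique cdf H.
by apply/diff_locallyP; rewrite dE.
Qed.

Lemma differentiable_V m (t : V -> 'rV[C]_m) z : differentiable t z ->
  forall e : R, 0 < e -> exists2 d : R, 0 < d &
    forall h, vn h < d -> vn (t (z + h) - t z - 'd t z h) <= e * vn h.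
Proof.
move=> /diff_locally/eqaddoP dt e e0.
have e0' : 0 < ofR e by rewrite -(@ofR0 R C S) ofR_lt.
have /(@nbhsVP R C S n 0)[d d0 hd] := dt _ e0'.
exists d => // h /hd; rewrite add0r !vnE -ofRM ofR_le.
by rewrite !fctE /= [h + z]addrC opprD addrA.
Qed.

Lemma rdiff_comp f (t : V -> V) z : differentiable t z ->
  rdiff f (t z) (Ldiff f (t z)) ->
  rdiff (f \o t) z (fun h => Ldiff f (t z) ('d t z h)).
Proof.
move=> dt hf e e0.
have [k k0 hk] : exists2 k : R, 0 < k & forall h, vn ('d t z h) <= k * vn h.
  have [k k0 hk] := linear_lipschitz (diff_continuous dt).
  have kE : k = ofR (cm k) by rewrite -cmE gtr0_norm.
  exists (cm k); first by rewrite -(@ofR_lt R C S) -kE ofR0.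
  by move=> h; have := hk h; rewrite !vnE [k in _ <= k * _]kE -ofRM ofR_le.
have [K K0 hK] := @Ldiff_bound R C S n f (t z).
have e2 : 0 < e / 2 by rewrite divr_gt0.
have k1 : 0 < k + 1 by rewrite ltr_wpDl// ltW.
have [d1 d10 h1] := hf (e / 2 / (k + 1)) (divr_gt0 e2 k1).
have q0 : 0 < Num.min 1 (e / 2 / K) by rewrite lt_min ltr01 divr_gt0.
have [d2 d20 h2] := differentiable_V dt q0.
exists (Num.min d2 (d1 / (k + 1))); first by rewrite lt_min d20 divr_gt0.
move=> h; rewrite lt_min => /andP[/h2 {}h2 hd].
pose s := t (z + h) - t z.
have sE : t (z + h) = t z + s by rewrite /s [RHS]addrC subrK.
have {h2}[h2 h3] : vn (s - 'd t z h) <= 1 * vn h /\ vn (s - 'd t z h) <= e / 2 / K * vn h.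
  by split; apply: (le_trans h2); rewrite ler_wpM2r ?vn_ge0// ge_min lexx ?orbT.
have sle : vn s <= (k + 1) * vn h.
  rewrite -(subrK ('d t z h) s) (le_trans (vnD _ _))//.
  by rewrite mulrDl addrC lerD.
have sd : vn s < d1 by rewrite (le_lt_trans sle)// mulrC -ltr_pdivlMr.
rewrite /comp sE (_ : _ - _ = (f (t z + s) - f (t z) - Ldiff f (t z) s) +
    Ldiff f (t z) (s - 'd t z h)); last first.
  have := @LdiffD R C S n f (t z) (s - 'd t z h) ('d t z h); rewrite subrK => ->.
  by ring.
rewrite (le_trans (cmD _ _))// [e]splitr mulrDl lerD//.
  rewrite (le_trans (h1 _ sd))// -[e / 2 in leRHS](divfK (lt0r_neq0 k1)) -[leRHS]mulrA.
  by apply: ler_wpM2l => //; rewrite divr_ge0// ltW.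
rewrite (le_trans (hK _))// -[e / 2](divfK (lt0r_neq0 K0)) [_ / _ * K]mulrC -mulrA.
by apply: ler_wpM2l => //; exact: ltW.
Qed.

(* The conjugate-linear part of a real-linear form [B] is read off from its values on
   the vectors [e_j] and [i e_j]. *)
Lemma dbar_Clinear f z (B : V -> C) :
  (forall h, B h = \sum_j (ofR (re (h ord0 j)) * B (delta_mx ord0 j) +
     ofR (im (h ord0 j)) * B ('i *: delta_mx ord0 j))) ->
  (forall j, @dbar R C S n j f z = 2^-1 * (B (delta_mx ord0 j) + 'i * B ('i *: delta_mx ord0 j))) ->
  Clinear (fun h => Ldiff f z h - B h).
Proof.
move=> BE dB; exists (fun j => cderive f (delta_mx ord0 j) z - B (delta_mx ord0 j)) => h.
rewrite BE /Ldiff -sumrB; apply: eq_bigr => j _.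
rewrite [h ord0 j in RHS]cplxE.
(* Equality of the [dzbar_j] coefficients says that the difference of the two real-linear forms
   takes ['i e_j] to ['i] times its value at [e_j]. *)
have : 'i * (cderive f ('i *: delta_mx ord0 j) z - B ('i *: delta_mx ord0 j)) =
    - (cderive f (delta_mx ord0 j) z - B (delta_mx ord0 j)).
  have := dB j; rewrite /dbar => /(mulfI _) E.
  have {}E := E ltac:(by rewrite invr_eq0 pnatr_eq0).
  apply/eqP; rewrite -addr_eq0 mulrBr addrC addrACA -opprD -E subrr//.
move: (cderive _ _ _) (B _) (cderive _ _ _) (B _) => p q r t E.
have E2 : r - t = 'i * (p - q).
  by rewrite -[r - t]opprK -(iM_i (r - t)) E mulrN opprK.
have -> : r = t + 'i * (p - q) by rewrite -E2 addrC subrK.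
by ring.
Qed.

(* the coefficient of [dzbar_j] in a 1-form *)
Definition coef01 (B : V -> C) (j : 'I_n) : C :=
  2^-1 * (B (delta_mx ord0 j) + 'i * B ('i *: delta_mx ord0 j)).

(** Here [q] is the exterior derivative of [th], and [e'], [u'] stand for ['i e], ['i u]. The two
    sides differ by a quarter of [q e u - q e' u' + i (q e u' + q e' u)], the (0,2)-component of
    [q], which the last two hypotheses cancel. *)
Lemma cderive_closed_pair (W : set V) (th : V -> V -> C) (q : V -> V -> C) e e' u u' z :
  W z -> (forall v, cC 1 W (fun y => th y v)) ->
  (forall v w, cderive (fun y => th y w) v z - cderive (fun y => th y v) w z = q v w) ->
  q e' u' = q e u -> q e' u = - q e u' ->
  2^-1 * (cderive (fun y => 2^-1 * (th y u + 'i * th y u')) e z +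
    'i * cderive (fun y => 2^-1 * (th y u + 'i * th y u')) e' z) =
  2^-1 * (cderive (fun y => 2^-1 * (th y e + 'i * th y e')) u z +
    'i * cderive (fun y => 2^-1 * (th y e + 'i * th y e')) u' z).
Proof.
move=> Wz Cth qE q1 q2.
have D p p' v : cderive (fun y => 2^-1 * (th y p + 'i * th y p')) v z =
    2^-1 * (cderive (fun y => th y p) v z + 'i * cderive (fun y => th y p') v z).
  apply: rder_rderive; apply: rderZ; apply: rderD; last apply: rderZ.
    exact: cC_rder (Cth _) Wz.
  exact: cC_rder (Cth _) Wz.
rewrite (D u u' e) (D u u' e') (D e e' u) (D e e' u').
have A (a b c d a' b' c' d' : C) : a - a' = q e u -> b - b' = q e u' ->
    c - c' = - q e u' -> d - d' = q e u ->
    2^-1 * (2^-1 * (a + 'i * b) + 'i * (2^-1 * (c + 'i * d))) =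
    2^-1 * (2^-1 * (a' + 'i * c') + 'i * (2^-1 * (b' + 'i * d'))).
  move=> /eqP; rewrite subr_eq => /eqP -> /eqP; rewrite subr_eq => /eqP ->.
  move=> /eqP; rewrite subr_eq => /eqP -> /eqP; rewrite subr_eq => /eqP ->.
  have : 'i ^+ 2 = -1 :> C := sqrCi _.
  by move: 'i (q e u) (q e u') => I r s I2; ring: I2.
apply: A; first exact: qE.
- exact: qE.
- by rewrite qE.
- by rewrite qE.
Qed.

Lemma coef01_closed (W : set V) (th : V -> V -> C) (q : V -> V -> C) i j z :
  W z -> (forall v, cC 1 W (fun y => th y v)) ->
  (forall v w, cderive (fun y => th y w) v z - cderive (fun y => th y v) w z = q v w) ->
  (forall v w, q ('i *: v) ('i *: w) = q v w) ->
  (forall v w, q ('i *: v) w = - q v ('i *: w)) ->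
  @dbar R C S n i (fun y => coef01 (th y) j) z = @dbar R C S n j (fun y => coef01 (th y) i) z.
Proof.
by move=> Wz Cth qE qii qi; apply: (cderive_closed_pair Wz Cth qE).
Qed.

Lemma coef01_cC k (W : set V) (th : V -> V -> C) j : open W ->
  (forall v, cC k W (fun y => th y v)) -> cC k W (fun y => coef01 (th y) j).
Proof.
move=> oW Cth; apply: cCZ => //; apply: cCD => //.
by apply: cCZ.
Qed.

End ComplexDifferentials.

(** * Exponential and logarithm *)

Section Exponential.
Context {R : realType} {C : numClosedFieldType} {S : cplx R C}.
Local Notation ofR := (@ofR R C S).
Local Notation re := (@re R C S).
Local Notation im := (@im R C S).
Local Notation cm := (@cm R C S).
Local Notation ccont := (@ccont R C S).
Local Notation cis := (@cis R C S).
Implicit Types z w : C.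

Definition ce z : C := ofR (expR (re z)) * (ofR (cos (im z)) + 'i * ofR (sin (im z))).

Lemma ceE z : ce z = ofR (expR (re z)) * cis (im z).
Proof. by []. Qed.

Lemma cisD (s t : R) : cis (s + t) = cis s * cis t.
Proof.
rewrite /cis cosD sinD ofRB !ofRD !ofRM.
have : 'i ^+ 2 = -1 :> C := sqrCi _.
by move: 'i => I I2; ring: I2.
Qed.

Lemma ceD z w : ce (z + w) = ce z * ce w.
Proof. by rewrite !ceE reD imD expRD cisD ofRM; ring. Qed.

Lemma cis0 : cis 0 = 1.
Proof. by rewrite /cis cos0 sin0 ofR1 ofR0 mulr0 addr0. Qed.

Lemma ce0 : ce 0 = 1.
Proof. by rewrite ceE -(@ofR0 R C S) re_ofR im_ofR expR0 cis0 ofR1 mulr1. Qed.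

Lemma ceN z : ce z * ce (- z) = 1.
Proof. by rewrite -ceD subrr ce0. Qed.

Lemma ce_neq0 z : ce z != 0.
Proof.
apply/eqP => z0; have := ceN z; rewrite z0 mul0r => /eqP.
by rewrite eq_sym oner_eq0.
Qed.

Lemma ce_sub1 (e : R) : 0 < e -> exists2 d : R, 0 < d &
  forall h, cm h < d -> cm (ce h - 1 - h) <= e * cm h.
Proof.
(* The three error terms below are at most [2 q], [q] and [q] times [cm h], and [4 q <= e]; the
   bound 1 is what gives [cm E <= 2]. *)
move=> e0; pose q := Num.min 1 (e / 6).
have q0 : 0 < q by rewrite lt_min ltr01 divr_gt0.
have [d1 d10 h1] := @cder_cis R C S 0 q q0.
have [d2 d20 h2] := @cder_ofR R C S (@expR R) 0 (expR 0) (is_derive_expR 0) q q0.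
have ec : ccont (fun t => ofR (expR t)).
  by apply: cder_ccont => t; apply: cder_ofR; exact: is_derive_expR.
have [d3 d30 h3] := ec 0 q q0.
exists (Num.min d1 (Num.min d2 d3)); first by rewrite !lt_min d10 d20.
move=> h; rewrite !lt_min => /and3P[hd1 hd2 hd3].
pose x := re h; pose y := im h.
have xh : `|x| <= cm h := cm_re h.
have yh : `|y| <= cm h := cm_im h.
have := h1 y (le_lt_trans yh hd1); have := h2 x (le_lt_trans xh hd2).
have := h3 x (le_lt_trans xh hd3).
rewrite !add0r cis0 expR0 mulr1 ofR1 [ofR y * _]mulrC => {h1 h2 h3}.
set E := ofR (expR x); set A := E - 1 - _; set B := cis y - 1 - _ => hE hA hB.
rewrite (_ : ce h - 1 - h = E * B + A * 1 + 'i * ofR y * (E - 1)); last first.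
  rewrite ceE -/x -/y -/E /A /B [h in LHS]cplxE -/x -/y mulr1; ring.
have q1 : q <= 1 by rewrite ge_min lexx.
have qe : q <= e / 6 by rewrite ge_min lexx orbT.
have E2 : cm E <= 2.
  rewrite -(subrK 1 E) (le_trans (cmD _ _))// -ofR1 cm_ofR normr1 -[2]/(1 + 1).
  by rewrite lerD2r ofR1 (le_trans hE).
have c0 : 0 <= cm h := @cm_ge0 R C S h.
have b1 : cm (E * B) <= 2 * (q * cm h).
  rewrite cmM ler_pM ?cm_ge0// (le_trans hB)// ler_wpM2l// ltW//.
have b2 : cm (A * 1) <= q * cm h.
  by rewrite mulr1 (le_trans hA)// ler_wpM2l// ltW.
have b3 : cm ('i * ofR y * (E - 1)) <= cm h * q.
  by rewrite !cmM cmi mul1r cm_ofR ler_pM ?cm_ge0.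
apply: (le_trans (cmD _ _)); apply: (le_trans (lerD (cmD _ _) (lexx _))).
apply: (le_trans (lerD (lerD b1 b2) b3)).
rewrite (_ : _ + _ = q * 4 * cm h); last by ring.
apply: ler_wpM2r => //; clear -e0 qe; clearbody q; lra.
Qed.

Lemma nbhs0CP (P : C -> Prop) : (exists2 d : R, 0 < d & forall h, cm h < d -> P h) ->
  \forall h \near (0 : C), P h.
Proof.
move=> [d d0 hd]; apply/nbhs_ballP; exists (ofR d).
  by rewrite /= -(@ofR0 R C S) ofR_lt.
by move=> h; rewrite -ball_normE /ball_ /= sub0r normrN cmE ofR_lt => /hd.
Qed.

Lemma nbhsCP w (P : C -> Prop) : (\forall z \near w, P z) <->
  exists2 d : R, 0 < d & forall z, cm (z - w) < d -> P z.
Proof.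
split.
  move=> /nbhs_ballP[d /= d0 hd].
  have dE : d = ofR (cm d) by rewrite -cmE gtr0_norm.
  exists (cm d); first by rewrite -(@ofR_lt R C S) -dE ofR0.
  by move=> z zw; apply: hd; rewrite -ball_normE /ball_ /= distrC cmE dE ofR_lt.
move=> [d d0 hd]; apply/nbhs_ballP; exists (ofR d).
  by rewrite /= -(@ofR0 R C S) ofR_lt.
by move=> h; rewrite -ball_normE /ball_ /= distrC cmE ofR_lt => /hd.
Qed.

Lemma ce_differentiable w : differentiable (ce : C -> C) w.
Proof.
apply/derivable1_diffP/cvg_ex; exists (ce w).
apply/(@cvgCP R C S _ _ _) => e e0.
have k0 : 0 < cm (ce w) + 1 by rewrite ltr_wpDl ?cm_ge0.
have [d d0 hd] := ce_sub1 (divr_gt0 e0 k0).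
rewrite near_withinE; apply: nbhs0CP; exists d => // h /hd {}hd h0.
rewrite /= [h%:A]mulr1 ceD -[X in cm X]/(h^-1 * (ce h * ce w - ce w) - ce w).
rewrite (_ : _ - _ = ce w * (h^-1 * (ce h - 1 - h))); last by field.
rewrite (cmM (ce w)) (cmM h^-1) cmV.
have ch0 : 0 < cm h by rewrite lt_def cm_ge0 cm_eq0 h0.
rewrite mulrCA mulrC ler_pdivrMr//.
apply: (@le_trans _ _ ((cm (ce w) + 1) * (e / (cm (ce w) + 1) * cm h))).
  by apply: ler_pM; rewrite ?cm_ge0 ?lerDl.
by rewrite mulrA [_ * (e / _)]mulrC divfK// gt_eqF.
Qed.

(* a logarithm only on the right half plane *)
Definition lg z : C :=
  let t := im z / re z in ofR (ln (re z * Num.sqrt (1 + t ^+ 2))) + 'i * ofR (atan t).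

(** In the right half plane [t] is the tangent of the argument, and the modulus is
    [re z * sqrt (1 + t^2)]. *)
Lemma ce_lg z : 0 < re z -> ce (lg z) = z.
Proof.
move=> z0; rewrite ceE /lg reD imD re_iM im_iM !re_ofR !im_ofR oppr0 addr0 add0r.
set t := _ / _; set s := Num.sqrt _.
have s0 : 0 < s by rewrite sqrtr_gt0 ltr_wpDr// sqr_ge0.
rewrite lnK ?posrE ?mulr_gt0//.
have ct : cos (atan t) = s^-1 by rewrite cos_atan.
have st : sin (atan t) = t * s^-1.
  have := atanK t; rewrite /tan ct => /(congr1 (fun x => x * s^-1)).
  by rewrite divfK// invr_eq0 gt_eqF.
have zt : im z = re z * t by rewrite /t mulrCA divff ?mulr1// gt_eqF.
have s1 : ofR s != 0 by rewrite ofR_eq0 gt_eqF.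
clearbody t s; rewrite /cis ct st [z in RHS]cplxE zt !ofRM ofRV.
by move: (ofR s) s1 => p p0; field.
Qed.

Lemma re_cont w : {for w, continuous (re : C -> R)}.
Proof.
apply/(@cvgrPdist_le R R C (nbhs w) (nbhs_filter w)) => e e0.
apply/nbhsCP; exists e => // z /ltW zw.
by rewrite distrC -reN -reD (le_trans (cm_re _)).
Qed.

Lemma im_cont w : {for w, continuous (im : C -> R)}.
Proof.
apply/(@cvgrPdist_le R R C (nbhs w) (nbhs_filter w)) => e e0.
apply/nbhsCP; exists e => // z /ltW zw.
by rewrite distrC -imN -imD (le_trans (cm_im _)).
Qed.

Lemma ofR_cont (t : R) : {for t, continuous (ofR : R -> C)}.
Proof.
apply/(@cvgCP R C S _ _ _) => e e0; apply/nbhs_ballP; exists e => // s.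
by rewrite /ball /= distrC -ofRB cm_ofR => /ltW.
Qed.

Lemma lg_cont w : 0 < re w -> {for w, continuous lg}.
Proof.
move=> w0.
have ct : (fun z : C => im z / re z) x @[x --> w] --> im w / re w.
  have hi : im x @[x --> w] --> im w by exact: im_cont.
  have hr : re x @[x --> w] --> re w by exact: re_cont.
  have r0 : re w != 0 by rewrite gt_eqF.
  have hV : (re x)^-1 @[x --> w] --> (re w)^-1 by exact: cvgV r0 hr.
  exact: cvgM hi hV.
have c1 : (1 + (im x / re x) ^+ 2) @[x --> w] --> 1 + (im w / re w) ^+ 2.
  exact: (@cvg_comp _ _ _ _ (@oneDsqr R) _ _ _ ct (@continuous_oneDsqr R _)).
have c2 : Num.sqrt (1 + (im x / re x) ^+ 2) @[x --> w] --> Num.sqrt (1 + (im w / re w) ^+ 2).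
  exact: cvg_comp c1 (@sqrt_continuous R _).
have hr : re x @[x --> w] --> re w by exact: re_cont.
have c3 : ln (re x * Num.sqrt (1 + (im x / re x) ^+ 2)) @[x --> w] -->
    ln (re w * Num.sqrt (1 + (im w / re w) ^+ 2)).
  apply: cvg_comp (cvgM hr c2) _; apply: continuous_ln.
  by rewrite mulr_gt0// sqrtr_gt0 ltr_wpDr// sqr_ge0.
have c4 : ofR (ln (re x * Num.sqrt (1 + (im x / re x) ^+ 2))) @[x --> w] -->
    ofR (ln (re w * Num.sqrt (1 + (im w / re w) ^+ 2))).
  exact: (@cvg_comp _ _ _ _ ofR _ _ _ c3 (@ofR_cont _)).
have c5 : ofR (atan (im x / re x)) @[x --> w] --> ofR (atan (im w / re w)).
  have c6 : atan (im x / re x) @[x --> w] --> atan (im w / re w).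
    exact: (@cvg_comp _ _ _ _ (@atan R) _ _ _ ct (@continuous_atan R _)).
  exact: (@cvg_comp _ _ _ _ ofR _ _ _ c6 (@ofR_cont _)).
exact: cvgD c4 (cvgM (cvg_cst 'i) c5).
Qed.

Lemma ce_ipi2 : ce ('i * ofR (pi / 2)) = 'i.
Proof.
rewrite ceE re_iM im_iM im_ofR re_ofR oppr0 expR0 ofR1 mul1r /cis cos_pihalf sin_pihalf.
by rewrite ofR0 add0r ofR1 mulr1.
Qed.

(** One of [w], [-i w], [i w], [-w] has positive real part, where [lg] applies; the power of ['i]
    taken out is restored by adding multiples of [i pi / 2]. *)
Lemma ce_surj w : w != 0 -> exists z, ce z = w.
Proof.
move=> w0.
have [h|h] := ltP 0 (re w); first by exists (lg w); rewrite ce_lg.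
have [h2|h2] := ltP 0 (im w).
  exists (lg (- 'i * w) + 'i * ofR (pi / 2)).
  rewrite ceD ce_ipi2 ce_lg ?mulNr ?reN ?re_iM ?opprK//.
  have : 'i ^+ 2 = -1 :> C := sqrCi _.
  by move: 'i => I I2; ring: I2.
have [h3|h3] := ltP (im w) 0.
  exists (lg ('i * w) + ('i * ofR (pi / 2) + 'i * ofR (pi / 2) + 'i * ofR (pi / 2))).
  rewrite (ceD (lg _)) 2!(ceD _ ('i * ofR (pi / 2))) ce_ipi2 ce_lg ?re_iM ?oppr_gt0//.
  have : 'i ^+ 2 = -1 :> C := sqrCi _.
  by move: 'i => I I2; ring: I2.
exists (lg (- w) + ('i * ofR (pi / 2) + 'i * ofR (pi / 2))).
rewrite (ceD (lg _)) (ceD _ ('i * ofR (pi / 2))) ce_ipi2 ce_lg.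
  have : 'i ^+ 2 = -1 :> C := sqrCi _.
  by move: 'i => I I2; ring: I2.
rewrite reN oppr_gt0 lt_neqAle h andbT.
apply: contra w0 => /eqP rw; apply/eqP; apply: reim_inj.
  by rewrite rw -(@ofR0 R C S) re_ofR.
by rewrite -(@ofR0 R C S) im_ofR; apply/eqP; rewrite eq_le h2 h3.
Qed.

Lemma local_log w : w != 0 -> exists2 l : C -> C,
  \forall z \near w, ce (l z) = z & \forall z \near w, {for z, continuous l}.
Proof.
move=> w0; have [l0 l0E] := ce_surj w0.
exists (fun z => l0 + lg (z / w)).
  (* If [z] is closer to [w] than [cm w], then [z / w] lies in the unit disc around 1, hence in the
     right half plane. *)
  apply/nbhsCP; exists (cm w); first by rewrite lt_def cm_ge0 cm_eq0 w0.
  move=> z zw; rewrite ceD l0E ce_lg; first by rewrite mulrC divfK.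
  rewrite -(subrK 1 (z / w)) reD -{2}ofR1 re_ofR -ltrBlDr sub0r.
  have h : cm (z / w - 1) < 1.
    rewrite (_ : _ - 1 = (z - w) / w); last by rewrite mulrBl divff.
    rewrite cmM cmV ltr_pdivrMr ?mul1r//.
    by rewrite lt_def cm_ge0 cm_eq0 w0.
  by have := le_lt_trans (cm_re _) h; rewrite ltr_norml => /andP[].
apply/nbhsCP; exists (cm w); first by rewrite lt_def cm_ge0 cm_eq0 w0.
move=> z zw; suff H : lg (x / w) @[x --> z] --> lg (z / w).
  exact: cvgD (cvg_cst _) H.
have hz : (x / w) @[x --> z] --> z / w by rewrite (_ : (fun x => x / w) = *%R w^-1);
    [rewrite [z / w]mulrC; exact: mulrl_continuous|apply/funext => x; rewrite mulrC].
apply: (@cvg_comp _ _ _ (fun z => z / w) lg _ (nbhs (z / w))) hz _.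
apply: lg_cont.
rewrite -(subrK 1 (z / w)) reD -{2}ofR1 re_ofR -ltrBlDr sub0r.
have h : cm (z / w - 1) < 1.
  rewrite (_ : _ - 1 = (z - w) / w); last by rewrite mulrBl divff.
    rewrite cmM cmV ltr_pdivrMr ?mul1r//.
  by rewrite lt_def cm_ge0 cm_eq0 w0.
by have := le_lt_trans (cm_re _) h; rewrite ltr_norml => /andP[].
Qed.

Definition e2 z : C := ce (2 * ofR pi * 'i * z).

Lemma e2D z w : e2 (z + w) = e2 z * e2 w.
Proof. by rewrite /e2 mulrDr ceD. Qed.

Lemma e20 : e2 0 = 1. Proof. by rewrite /e2 mulr0 ce0. Qed.

Lemma e2_neq0 z : e2 z != 0. Proof. exact: ce_neq0. Qed.

Lemma ofR2 : ofR 2 = 2.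
Proof. by rewrite -[2 in LHS]/(1 + 1) ofRD ofR1. Qed.

Lemma e2_ofR (u : R) : e2 (ofR u) = cis (2 * pi * u).
Proof.
rewrite /e2 (_ : _ * _ = 'i * ofR (2 * pi * u)); last first.
  by rewrite !ofRM ofR2; ring.
by rewrite ceE re_iM im_iM im_ofR re_ofR oppr0 expR0 ofR1 mul1r.
Qed.

Lemma e2_nat (k : nat) : e2 k%:R = 1.
Proof.
elim: k => [|k IH]; first by rewrite e20.
rewrite -natr1 e2D IH mul1r -ofR1 e2_ofR mulr1 mulr_natl.
by rewrite cis2pi cis0 ofR1.
Qed.

Lemma e2_int (k : int) : e2 k%:~R = 1.
Proof.
case: k => k; first by rewrite -pmulrn e2_nat.
rewrite NegzE mulrNz -pmulrn; have := e2D (- k.+1%:R) k.+1%:R.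
by rewrite addNr e20 e2_nat mulr1.
Qed.

Lemma ofR_int (k : int) : ofR k%:~R = k%:~R.
Proof.
have nat (m : nat) : ofR m%:R = m%:R.
  by elim: m => [|m IH]; rewrite ?ofR0// -!natr1 ofRD IH ofR1.
by case: k => k; rewrite ?NegzE ?mulrNz ?ofRN -!pmulrn nat.
Qed.

(** The modulus forces [im z = 0]. The fractional part [u] of [re z] then satisfies
    [cos (2 pi u) = 1], so [sin (pi u) = 0], which leaves only [u = 0] in [[0, 1[]. *)
Lemma e2_eq1 z : e2 z = 1 -> exists k : int, z = k%:~R.
Proof.
move=> z1.
have zE : 2 * ofR pi * 'i * z = ofR (- (2 * pi * im z)) + 'i * ofR (2 * pi * re z).
  rewrite {1}(cplxE z) !ofRN !ofRM ofR2.
  have : 'i ^+ 2 = -1 :> C := sqrCi _.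
  by move: 'i (ofR pi) => I p I2; ring: I2.
move: z1; rewrite /e2 zE ceE reD imD re_iM im_iM !re_ofR !im_ofR oppr0 addr0 add0r => z1.
have iz : im z = 0.
  have := congr1 re z1; have := congr1 im z1.
  rewrite /cis reM imM reD imD re_iM im_iM !re_ofR !im_ofR -ofR1 re_ofR im_ofR.
  rewrite !mul0r !subr0 !add0r !addr0.
  set p := expR _; set c := cos _; set s := sin _ => ps pc.
  have p1 : p ^+ 2 = 1.
    have : p ^+ 2 * (c ^+ 2 + s ^+ 2) = 1.
      by rewrite mulrDr -!exprMn ps pc expr1n expr0n addr0.
    by rewrite cos2Dsin2 mulr1.
  have {}p1 : p = 1.
    by move/eqP: p1; rewrite sqrf_eq1 => /orP[/eqP//|/eqP pN];
      have := expR_gt0 (- (2 * pi * im z)); rewrite -/p pN oppr_gt0 ltr10.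
  have := expR_inj (etrans p1 (esym (@expR0 R))) => /eqP.
  by rewrite oppr_eq0 !mulf_eq0 pnatr_eq0 /= (gt_eqF (pi_gt0 R)) /= => /eqP.
pose k := Num.floor (re z).
pose u := re z - k%:~R.
have zu : z = ofR u + k%:~R.
  rewrite -ofR_int -ofRD /u subrK {1}(cplxE z) iz ofR0 mulr0 addr0//.
have u01 : 0 <= u < 1.
  have := Num.Theory.floor_itv (re z); rewrite -/k => /andP[h1 h2].
  by rewrite subr_ge0 h1 ltrBlDr addrC (lt_le_trans h2)// intrD.
have : e2 z = 1.
  by rewrite /e2 zE ceE reD imD re_iM im_iM !re_ofR !im_ofR oppr0 addr0 add0r.
rewrite zu e2D e2_int mulr1 e2_ofR => /(congr1 re) E.
have {}E : cos ((pi * u) *+ 2) = 1.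
  move: E; rewrite /cis reD re_iM im_ofR re_ofR oppr0 addr0 -ofR1 re_ofR.
  by rewrite -mulrA mulr_natl.
have s0 : sin (pi * u) = 0.
  apply/eqP; rewrite -sqrf_eq0 sin2cos2; move: E; rewrite cos_mulr2n.
  by move: (cos _ ^+ 2) => q; rewrite mulr2n => E; apply/eqP; lra.
exists k; case/andP: u01 => u0 u1.
have [->|un] := eqVneq u 0; first by rewrite ofR0 add0r.
have : 0 < sin (pi * u).
  have {}u0 : 0 < u by rewrite lt_def un.
  by apply: sin_gt0_pi; rewrite mulr_gt0 ?pi_gt0//= gtr_pMr ?pi_gt0.
by rewrite s0 ltxx.
Qed.

End Exponential.

(** * Forms on a complex manifold *)

Section Charts.
Context {R : realType} {n : nat}.
Local Notation C := (Cplx R).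
Local Notation V := 'rV[Cplx R]_n.
Local Notation S := (cplx_Cplx R).
Local Notation rdiff := (@rdiff R (Cplx R) (cplx_Cplx R) n).
Local Notation dbar := (@dbar R (Cplx R) (cplx_Cplx R) n).
Local Notation cC := (@cC R (Cplx R) (cplx_Cplx R) n).
Local Notation cderive := (@cderive R (Cplx R) (cplx_Cplx R) n).
Implicit Types (f g : V -> C) (v z h : V).

Lemma Ck_cC k (W : set V) f : Ck k W f <-> cC k W f.
Proof.
elim: k f => [|k IH] f; split=> -[cf df]; split=> // v;
  by have [d1 d2] := df v; split=> //; apply/IH.
Qed.

Lemma cexpE (z : C) : cexp z = @ce R (Cplx R) S z.
Proof. by []. Qed.

Lemma cexp_e2 (z : C) : cexp (2 * realC pi * 'i * z) = @e2 R (Cplx R) S z.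
Proof. by []. Qed.

Variable X : complexManifold R n.

Lemma imgP (a : cm_idx X) (W : set X) z :
  img a W z <-> img a setT z /\ W (cm_inv a z).
Proof.
split=> [[p [ap Wp] <-]|[[p [ap _] <-]]].
  by rewrite cm_chartK//; split=> //; exists p.
by rewrite cm_chartK// => Wp; exists p.
Qed.

Lemma img_inv (a : cm_idx X) (W : set X) z : img a W z ->
  [/\ cm_dom a (cm_inv a z), W (cm_inv a z) & cm_chart a (cm_inv a z) = z].
Proof. by move=> [p [ap Wp] <-]; rewrite cm_chartK. Qed.

Lemma img_chart (a : cm_idx X) (W : set X) p : cm_dom a p -> W p -> img a W (cm_chart a p).
Proof. by move=> ap Wp; exists p. Qed.

Lemma img_open (a : cm_idx X) (W : set X) : open W -> open (img a W).
Proof.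
move=> oW; rewrite openE => z zW.
have [zT Wz] := (imgP a W z).1 zW.
have zi : (cm_chart a @` cm_dom a) z by case: zT => p [ap _] <-; exists p.
have n1 : \forall y \near z, (cm_chart a @` cm_dom a) y.
  by apply: open_nbhs_nbhs; split=> //; exact: cm_img_open.
have n2 : \forall y \near z, W (cm_inv a y).
  by apply: (cm_inv_cont zi); apply: open_nbhs_nbhs.
apply: filterS2 n1 n2 => y [p ap <-] Wy; apply/imgP; split=> //.
by exists p.
Qed.

Lemma chart_preimage_open (a : cm_idx X) (O : set V) :
  open O -> open (cm_dom a `&` cm_chart a @^-1` O).
Proof.
move=> oO; rewrite openE => p [ap Op].
apply: filterI; first by apply: open_nbhs_nbhs; split=> //; exact: cm_dom_open.
by apply: (cm_chart_cont ap); apply: open_nbhs_nbhs.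
Qed.

Lemma inv_cont (a : cm_idx X) (W : set X) z : img a W z -> {for z, continuous (cm_inv a)}.
Proof. by move=> [p [ap _] <-]; apply: cm_inv_cont; exists p. Qed.

Definition mx2 v z : 'M[C]_(2, n) := \matrix_(i, j) (if i == ord0 then v ord0 j else z ord0 j).

Lemma row_mx2_0 v z : row ord0 (mx2 v z) = v.
Proof. by apply/rowP => j; rewrite !mxE. Qed.

Lemma row_mx2_1 v z : row (lift ord0 ord0) (mx2 v z) = z.
Proof. by apply/rowP => j; rewrite !mxE. Qed.

Lemma row'_mx2_0 v z : row' ord0 (mx2 v z) = z.
Proof. by apply/matrixP => i j; rewrite !mxE !ord1. Qed.

Lemma row'_mx2_1 v z : row' (lift ord0 ord0) (mx2 v z) = v.
Proof. by apply/matrixP => i j; rewrite !mxE !ord1. Qed.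

Lemma extd1 (th : pform X 1) a z v w : extd th a z (mx2 v w) =
  cderive (fun y => th a y w) v z - cderive (fun y => th a y v) w z.
Proof.
rewrite /extd big_ord_recl big_ord1 row_mx2_0 row'_mx2_0 row_mx2_1 row'_mx2_1.
by rewrite expr0 mul1r expr1 mulN1r.
Qed.

Lemma extd0 (f : X -> C) a z v : extd (form0 f) a z v = cderive (f \o cm_inv a) v z.
Proof.
rewrite /extd big_ord1 expr0 mul1r (_ : row ord0 v = v)//.
by apply/rowP => j; rewrite mxE.
Qed.

(** Each term pairs one linear and one conjugate-linear factor, and ['i] times its conjugate is 1.
    With [dz_dzbar_i], this is all that is retained of type (1,1). *)
Lemma dz_dzbar_ii (h : 'M[C]_n) v w :
  dz_dzbar h (mx2 ('i *: v) ('i *: w)) = dz_dzbar h (mx2 v w).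
Proof.
have A (p q r s : C) : 'i * p * (- 'i * q) - 'i * r * (- 'i * s) = p * q - r * s.
  have : 'i ^+ 2 = -1 :> C := sqrCi _.
  by move: 'i => I I2; ring: I2.
apply: eq_bigr => j _; apply: eq_bigr => k _; rewrite !mxE /=; congr (_ * _).
by rewrite !rmorphM /= conjCi; exact: A.
Qed.

Lemma dz_dzbar_i (h : 'M[C]_n) v w :
  dz_dzbar h (mx2 ('i *: v) w) = - dz_dzbar h (mx2 v ('i *: w)).
Proof.
have A (b p q r s : C) : b * ('i * p * q - r * (- 'i * s)) =
    - (b * (p * (- 'i * q) - 'i * r * s)) by ring.
rewrite -sumrN; apply: eq_bigr => j _; rewrite -sumrN; apply: eq_bigr => k _.
by rewrite !mxE /= !rmorphM /= conjCi; exact: A.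
Qed.

Local Notation Ldiff := (@Ldiff R (Cplx R) (cplx_Cplx R) n).

Lemma form1_linear (U : set X) (th : pform X 1) a z h : is_form U th -> img a U z ->
  th a z h = \sum_j (realC (complex.Re (h ord0 j)) * th a z (delta_mx ord0 j) +
     realC (complex.Im (h ord0 j)) * th a z ('i *: delta_mx ord0 j)).
Proof.
move=> [ml _ _ _] zU.
have mlE (b c : R) (v w : V) : th a z (realC b *: v + realC c *: w) =
    realC b * th a z v + realC c * th a z w.
  apply: (ml a z zU ord0) => //.
  - by apply/rowP => j; rewrite !mxE.
  - by apply/matrixP => -[].
  - by apply/matrixP => -[].
have th0 : th a z 0 = 0.
  by have := mlE 0 0 0 0; rewrite !mul0r !scale0r !addr0.
have thD v w : th a z (v + w) = th a z v + th a z w.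
  by have := mlE 1 1 v w; rewrite !mul1r !scale1r.
rewrite {1}(@row_reim R (Cplx R) S n h) (big_morph (th a z) thD th0).
by apply: eq_bigr => j _; rewrite mlE.
Qed.

(** The dbar-equation is solved in a single chart [a0] around [x]. The conclusion passes to every
    other chart because [th] is pulled back by the transition map, whose differential is complex
    linear. *)
Lemma dbar_primitive (U : set X) (th : pform X 1) (w : pform X 2) x :
  open U -> U x -> is_form U th -> form_eq U (extd th) w -> type11 w ->
  exists (N : set X) (u : X -> C), [/\ open N, N x, N `<=` U &
    forall a z, img a N z -> exists2 L : V -> C, rdiff (u \o cm_inv a) z L &
      @Clinear C n (fun h => L h - th a z h)].
Proof.
move=> oU Ux fth dth w11.
have [a0 a0x] := cm_cover x.
have [_ _ sth pth] := fth.
pose W := img a0 U.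
have oW : open W := img_open oU.
have Wx : W (cm_chart a0 x) := img_chart a0x Ux.
have Cth k v : cC k W (fun y => th a0 y v) by apply/Ck_cC; exact: sth.
pose g j y := @coef01 C n (th a0 y) j.
have Cg k j : cC k W (g j) by apply: coef01_cC.
have gE i j z : W z -> dbar i (g j) z = dbar j (g i) z.
  move=> Wz; have zT : img a0 setT z by case/imgP: (Wz).
  have [h hE] := w11 a0 z zT.
  apply: (@coef01_closed R C S n W (th a0) (fun v v' => dz_dzbar h (mx2 v v'))) => //.
  - by move=> v v'; rewrite -extd1 dth.
  - exact: dz_dzbar_ii.
  - exact: dz_dzbar_i.
have g0 (j : 'I_n) z : (n <= j)%N -> W z -> g j z = 0.
  by move=> nj; have := ltn_ord j; rewrite ltnNge nj.
(* All [n] components may be nonzero: [dbar_solve] is used with [m = n], and its vanishing condition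
   holds vacuously. *)
have [W' [u [oW' W'x W'W Cu uE]]] :=
  dbar_solve (leqnn n) oW Wx (Cg n.+1) gE g0.
exists (U `&` (cm_dom a0 `&` cm_chart a0 @^-1` W')), (u \o cm_chart a0); split.
- by apply: openI => //; exact: chart_preimage_open.
- by [].
- by move=> p [].
move=> a z zN; have [az [Uz [a0z W'z]] zE] := img_inv zN.
pose t := trans a a0.
have dt : differentiable t z.
  by apply: cm_trans_holo; exists (cm_inv a z).
have ru : rdiff u (t z) (Ldiff u (t z)) := C1_rdiff oW' Cu W'z.
exists (fun h => Ldiff u (t z) ('d t z h)).
  exact: rdiff_comp dt ru.
have zb : img a (cm_dom a0 `&` U) z by rewrite -zE; apply: img_chart.
have thE h : th a z h = th a0 (t z) ('d t z h).
  rewrite (pth a a0 z h zb) /pullback (_ : \matrix_i _ = 'd t z h)//.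
  apply/rowP => j; rewrite mxE (_ : row _ h = h)//.
  by apply/rowP => k; rewrite mxE.
have lin : @Clinear C n (fun k => Ldiff u (t z) k - th a0 (t z) k).
  apply: dbar_Clinear.
    by move=> h; apply: (form1_linear h fth); exact: W'W.
  by move=> j; rewrite uE.
have := Clinear_comp ('d t z) lin.
by under eq_fun do rewrite -thE.
Qed.

Lemma form0_rdiff (U : set X) (f : X -> C) (eta : pform X 1) a z : open U ->
  is_form U (form0 f) -> form_eq U (extd (form0 f)) eta -> img a U z ->
  rdiff (f \o cm_inv a) z (eta a z).
Proof.
move=> oU [_ _ sf _] df zU.
have oW := img_open (a := a) oU.
have Cf : cC 1 (img a U) (f \o cm_inv a) by apply/Ck_cC; exact: (sf a 0).
apply: (@rdiff_eq R C S n _ z (Ldiff (f \o cm_inv a) z)).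
  by move=> h; rewrite -(C1_rderive _ oW Cf zU) -extd0 df.
exact: C1_rdiff oW Cf zU.
Qed.

End Charts.

(** * Line bundles and Cech cocycles *)

Section CechIndices.
Variable T : topologicalType.
Implicit Types (x y : T) (U : pcover T).

Definition pr x y (i : 'I_2) : T := if i == ord0 then x else y.

Lemma prE (s : 'I_2 -> T) : s = pr (s ord0) (s ord_max).
Proof.
apply/funext => i; rewrite /pr; case: eqP => [->//|/eqP i0]; congr (s _).
by apply/val_inj; case: i i0 => -[|[|]].
Qed.

Lemma cobd1E (M : zmodType) (c : ('I_1 -> T) -> M) (s : 'I_2 -> T) :
  cobd c s = c (fun=> s ord_max) - c (fun=> s ord0).
Proof.
rewrite /cobd big_ord_recl big_ord1 expr0 mulr1z expr1 mulrN1z.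
have cE (j : 'I_2) k : k = j -> c (s \o lift j) = c (fun=> s (lift k ord0)).
  by move=> ->; congr c; apply/funext => i; rewrite /= ord1.
rewrite (cE _ _ erefl) (cE _ _ erefl).
have -> : lift ord0 ord0 = ord_max :> 'I_2 by exact/val_inj.
by have -> : lift ord_max ord0 = ord0 :> 'I_2 by exact/val_inj.
Qed.

Lemma cobd2E (M : zmodType) (c : ('I_2 -> T) -> M) (s : 'I_3 -> T) :
  cobd c s = c (pr (s (inord 1)) (s ord_max)) - c (pr (s ord0) (s ord_max)) +
    c (pr (s ord0) (s (inord 1))).
Proof.
rewrite /cobd !big_ord_recl big_ord0 addr0 addrA expr0 mulr1z expr1 mulrN1z.
rewrite /bump /= (_ : (-1) ^+ (1 + 1) = 1 :> int)// mulr1z.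
rewrite [_ \o lift ord0]prE [_ \o lift (lift ord0 ord0)]prE [_ \o lift (lift _ (lift _ _))]prE /=.
by congr (c (pr _ _) - c (pr _ _) + c (pr _ _)); congr (s _); apply/val_inj; rewrite /= ?inordK.
Qed.

Lemma inter_open U q (s : 'I_q -> T) : open (inter U s).
Proof.
rewrite openE => p Up; apply: filter_forall => i.
by apply: open_nbhs_nbhs; split; [exact: pc_open|exact: Up].
Qed.

Lemma inter_pr U x y p : inter U (pr x y) p <-> U x p /\ U y p.
Proof.
split=> [h|[Ux Uy] i]; last by rewrite /pr; case: ifP.
by split; [exact: (h ord0)|exact: (h ord_max)].
Qed.

End CechIndices.

(** * Line bundles built from cocycles, and independence of the Chern class from choices *)

Section LineBundle.
Context {R : realType} {n : nat}.
Local Notation C := (Cplx R).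
Local Notation V := 'rV[Cplx R]_n.
Local Notation S := (cplx_Cplx R).
Local Notation rdiff := (@rdiff R (Cplx R) (cplx_Cplx R) n).
Local Notation Clinear := (@Clinear (Cplx R) n).
Local Notation e2 := (@e2 R (Cplx R) (cplx_Cplx R)).
Variable X : complexManifold R n.

Lemma loc_const_rdiff (e : X -> C) (W : set X) a z : loc_const W e -> img a W z ->
  rdiff (e \o cm_inv a) z (fun=> 0).
Proof.
move=> eW zW; have [_ Wz _] := img_inv zW.
apply: (@rdiff_near R C S n (fun=> e (cm_inv a z))); last exact: rdiff_cst.
have h : \forall y \near cm_inv a z, e y = e (cm_inv a z) := eW _ Wz.
have h' : \forall y \near z, e (cm_inv a y) = e (cm_inv a z) := inv_cont zW h.
by apply: filterS h' => y /= ->.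
Qed.

(** As [df] is [theta_1 - theta_0] and [de] is 0, the differential is
    [(L_0 - theta_0) - (L_1 - theta_1)], a difference of two complex linear forms. *)
Lemma holomorphic_correction (U U0 : pcover X) (s : 'I_2 -> X) (theta : ('I_1 -> X) -> pform X 1)
    (f e : X -> C) (u : X -> X -> C) (N : X -> set X) :
  is_form (inter U s) (form0 f) ->
  form_eq (inter U s) (extd (form0 f)) (cobd theta s) ->
    loc_const (inter U0 s) e ->
  (forall x, N x `<=` U x `&` U0 x) ->
  (forall x a z, img a (N x) z -> exists2 L : V -> C, rdiff (u x \o cm_inv a) z L &
      Clinear (fun h => L h - theta (fun=> x) a z h)) ->
  holomorphic (N (s ord0) `&` N (s ord_max))
    (fun p => f p - e p - (u (s ord_max) p - u (s ord0) p)).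
Proof.
move=> ff df le NU hu a z zW.
have sub i : (N (s ord0) `&` N (s ord_max)) `<=` N (s i).
  by move=> p []; rewrite [s in s i]prE /pr; case: ifP.
have zU : img a (inter U s) z.
    by case: zW => p [ap pN] <-; apply: img_chart => // i; case: (NU _ _ (sub i _ pN)).
have zU0 : img a (inter U0 s) z.
  by case: zW => p [ap pN] <-; apply: img_chart => // i; case: (NU _ _ (sub i _ pN)).
have zN i : img a (N (s i)) z.
  by case: zW => p [ap pN] <-; apply: img_chart => //; apply: sub.
have [L0 d0 l0] := hu _ _ _ (zN ord0).
have [L1 d1 l1] := hu _ _ _ (zN ord_max).
have d := form0_rdiff (inter_open U s) ff df zU.
have de := loc_const_rdiff le zU0.
have D := rdiffD (rdiffD d (rdiffN de)) (rdiffN (rdiffD d1 (rdiffN d0))).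
apply: (@rdiff_differentiable R C S n _ z _ D).
have := ClinearD l0 (ClinearN l1); congr Clinear; apply/funext => h.
rewrite cobd1E (_ : (_ - _ : pform X 1) a z h =
  theta (fun=> s ord_max) a z h - theta (fun=> s ord0) a z h)//.
by ring.
Qed.

Lemma e2_differentiable (z : C) : differentiable (e2 : C -> C) z.
Proof.
have -> : (e2 : C -> C) = @ce R (Cplx R) S \o ( *%R (2 * realC pi * 'i)).
  by apply/funext => y; rewrite /= -cexp_e2 cexpE.
apply: differentiable_comp; last exact: ce_differentiable.
by apply: (@differentiableM _ _ (cst (2 * realC pi * 'i)) (fun y => y)).
Qed.

(** Every fibre is [C] itself. The fibre at [p] is thought of in the trivialization of index [p],
    available since the cover contains [U p] around [p]; so the trivialization of index [x] is
    multiplication by [g x p p]. *)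
Lemma chern_cocycle_exists (c : cocycle2 X int) (f : ('I_2 -> X) -> X -> C) :
  (forall s, holomorphic (inter (c2_cover c) s) (f s)) ->
  (forall s p, inter (c2_cover c) s p -> (c s p)%:~R = cobd f s p) ->
  exists L, chern_cocycle L c.
Proof.
set U := c2_cover c => hf cf.
pose g x y p := e2 (f (pr x y) p).
(* The exponents differ by the integer [c s p], which [e2] sends to 1. *)
have gM x y z p : U x p -> U y p -> U z p -> g x y p * g y z p = g x z p.
  move=> xp yp zp; pose s (i : 'I_3) := if i == ord0 then x else if i == ord_max then z else y.
  have sE : s (inord 1) = y.
    by rewrite /s (_ : inord 1 = lift ord0 ord0)//; apply/val_inj; rewrite /= inordK.
  have sp : inter U s p by move=> i; rewrite /s; case: ifP => // _; case: ifP.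
  have := cf _ _ sp; rewrite cobd_fun cobd2E sE /= => E.
  rewrite /g -e2D (_ : _ + _ = (c s p)%:~R + f (pr x z) p); last by rewrite E; ring.
  by rewrite e2D e2_int mul1r.
pose tr x p : {linear C^o -> C^o} := *:%R (g x p p : C).
have trE x y p (v : C^o) : U x p -> U y p -> tr x p v = g x y p * tr y p v.
  by move=> xp yp; rewrite /= /GRing.scale /= mulrA gM//; exact: pc_mem.
have trb x p : U x p -> bijective (tr x p).
  move=> _; have g0 : g x p p != 0 by exact: e2_neq0.
  by exists (fun v => (g x p p)^-1 *: v) => v; rewrite /= scalerA ?mulVf ?mulfV// scale1r.
have trh x y : exists2 g : X -> C, holomorphic (U x `&` U y) g &
    forall p (v : C^o), U x p -> U y p -> tr x p v = g p * tr y p v.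
  exists (g x y); last by move=> p v; exact: trE.
  move=> a z zU; apply: (@differentiable_comp _ _ _ _ (f (pr x y) \o cm_inv a) e2).
    by apply: hf; case: zU => p [ap [xp yp]] <-; apply: img_chart => //; apply/inter_pr.
  exact: e2_differentiable.
pose L := @LineBundle R n X (fun=> C^o) X U tr (fun x => pc_open U x)
  (fun p => ex_intro (fun x => U x p) p (pc_mem U p)) trb trh.
exists L, (fun x => x), f; split=> //; first by move=> x p.
move=> s p v sp.
rewrite cexp_e2 {2}[s]prE; apply: trE; exact: sp.
Qed.

Lemma lb_iso_refl (L : line_bundle X) : lb_iso L L.
Proof.
exists (fun p => idfun); split=> [p|i j]; first by exists idfun.
have [g hg gE] := lb_trans j i.
by exists g => [|p v ip jp]; [rewrite setIC|exact: gE].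
Qed.

Lemma holomorphic_cont (W : set X) (h : X -> C) p : open W -> holomorphic W h -> W p ->
  {for p, continuous h}.
Proof.
move=> oW hh Wp; have [a ap] := cm_cover p.
have d := differentiable_continuous (hh a _ (img_chart ap Wp)).
have c1 : {for p, continuous ((h \o cm_inv a) \o cm_chart a)}.
  by apply: continuous_comp => //; exact: cm_chart_cont.
have E : \forall q \near p, (h \o cm_inv a \o cm_chart a) q = h q.
  have : \forall q \near p, cm_dom a q by apply: open_nbhs_nbhs; split=> //; exact: cm_dom_open.
  by apply: filterS => q aq; rewrite /= cm_chartK.
have hp : (h \o cm_inv a \o cm_chart a) p = h p := nbhs_singleton E.
rewrite /prop_for /continuous_at -hp.
exact: cvg_trans (near_eq_cvg E) c1.
Qed.

(** Continuity of [k] is all that is recorded: the logarithms only serve to show that an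
    integer-valued cochain is locally constant. *)
Lemma holomorphic_log (W : set X) (h : X -> C) x : open W -> holomorphic W h -> W x -> h x != 0 ->
  exists (N : set X) (k : X -> C), [/\ open N, N x, N `<=` W &
    forall p, N p -> e2 (k p) = h p /\ {for p, continuous k}].
Proof.
move=> oW hh Wx h0; have [l lE lc] := @local_log R C S _ h0.
have hc p : W p -> {for p, continuous h} by exact: holomorphic_cont.
pose A := [set p | [/\ W p, @ce R C S (l (h p)) = h p & {for h p, continuous l}]].
have nA : nbhs x A.
  have n1 : \forall p \near x, W p by apply: open_nbhs_nbhs.
  have n2 : \forall p \near x, @ce R C S (l (h p)) = h p := hc x Wx _ lE.
  have n3 : \forall p \near x, {for h p, continuous l} := hc x Wx _ lc.
  by apply: filterS3 n1 n2 n3 => p.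
have pi0 : 2 * realC pi * 'i != 0 :> C.
  rewrite !mulf_neq0 ?neq0Ci ?pnatr_eq0// -[0]/(realC 0) (inj_eq (@complexI _)).
  by rewrite gt_eqF// pi_gt0.
exists A°, (fun p => (2 * realC pi * 'i)^-1 * l (h p)); split.
- exact: open_interior.
- by [].
- by move=> p /interior_subset[].
move=> p /interior_subset[Wp lh lp]; split.
  by rewrite -cexp_e2 cexpE mulrA divff// mul1r.
apply: cvgM; first exact: cvg_cst.
by apply: (@continuous_comp _ _ _ h l); [exact: hc|].
Qed.

Lemma int_near (k : int) : \forall z \near (k%:~R : C), forall k' : int, z = k'%:~R -> k' = k.
Proof.
apply/(@nbhsCP R C S); exists 1 => // z zk k' E; move: zk; rewrite E.
rewrite -intrB -(@ofR_int R C S) cm_ofR -intr_norm.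
rewrite (_ : 1 = 1%:~R)// ltr_int -[X in _ < X]add0r ltzD1 normr_le0 subr_eq0.
by move/eqP.
Qed.

(** In the trivializations of index [x] the isomorphism is multiplication by some [e2 k_x] near [x].
    Compatibility makes [f - f' + k_x - k_y] integer-valued; being continuous it is locally
    constant, and the [k] terms drop out of its coboundary [c - c']. *)
Lemma chern_cocycle_cohomologous (L L' : line_bundle X) (c c' : cocycle2 X int) :
  lb_iso L L' -> chern_cocycle L c -> chern_cocycle L' c' -> cohomologous c c'.
Proof.
move=> [F [Fb Fh]] [i [f [id hf fE cf]]] [i' [f' [id' hf' fE' cf']]].
set U := c2_cover c in id hf fE cf; set U' := c2_cover c' in id' hf' fE' cf'.
have : forall x, exists Nk : set X * (X -> C), [/\ open Nk.1, Nk.1 x, Nk.1 `<=` U x `&` U' x &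
    forall p, Nk.1 p -> {for p, continuous Nk.2} /\ forall v : lb_fib L p,
      lb_triv (i' x) p (F p v) = e2 (Nk.2 p) * lb_triv (i x) p v].
  move=> x; have [h hh hE] := Fh (i x) (i' x).
  (* Otherwise [F] would kill the vector whose coordinate in the trivialization of [L] is 1. *)
  have h0 : h x != 0.
    have ix := id _ _ (pc_mem U x); have ix' := id' _ _ (pc_mem U' x).
    have [t tK Kt] := lb_triv_bij ix.
    have := hE x (t 1) ix ix'; rewrite Kt mulr1 => <-.
    apply/eqP => E0.
    have := bij_inj (lb_triv_bij ix') (etrans E0 (esym (linear0 _))).
    rewrite -[RHS](linear0 (F x)) => /(bij_inj (Fb x)) t0.
    by have := Kt 1; rewrite t0 linear0 => /eqP; rewrite eq_sym oner_eq0.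
  have oI : open (lb_dom (i x) `&` lb_dom (i' x)) by apply: openI; exact: lb_dom_open.
  have [|N [k [oN Nx NI kE]]] := holomorphic_log (x := x) oI hh _ h0.
    by split; [apply/id/pc_mem|apply/id'/pc_mem].
  exists (N `&` (U x `&` U' x), k); split=> /=.
  - by apply: openI => //; exact: pcoverI_open.
  - by split=> //; exact: pcoverI_mem.
  - by move=> p [].
  - move=> p [Np [Up U'p]]; have [kp kc] := kE p Np; split=> // v.
    by rewrite kp; apply: hE; [exact: id|exact: id'].
move=> /choice[Nk Nkh].
pose N := @PCover X (fun x => (Nk x).1)
  (fun x => let: And4 o _ _ _ := Nkh x in o) (fun x => let: And4 _ o _ _ := Nkh x in o).
pose k x := (Nk x).2.
have NU x p : N x p -> U x p /\ U' x p by case: (Nkh x) => _ _ h _ /h.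
have Uint q (s : 'I_q -> X) p : inter N s p -> inter U s p.
  by move=> sp j; case: (NU _ _ (sp j)).
have U'int q (s : 'I_q -> X) p : inter N s p -> inter U' s p.
  by move=> sp j; case: (NU _ _ (sp j)).
pose m s p := f s p - f' s p + (k (s ord0) p - k (s ord_max) p).
(* Evaluating the isomorphism on the vector of coordinate 1 in the second trivialization gives
   [e2 k_0 * e2 f = e2 f' * e2 k_1], that is [e2 m = 1]. *)
have mint s p : inter N s p -> exists M : int, m s p = M%:~R.
  move=> sp; apply: (@e2_eq1 R C S).
  have sU := Uint _ _ _ sp; have sU' := U'int _ _ _ sp.
  have [_ _ _ /(_ p (sp ord0))[_ k0]] := Nkh (s ord0).
  have [_ _ _ /(_ p (sp ord_max))[_ k1]] := Nkh (s ord_max).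
  have [t tK Kt] := lb_triv_bij (id _ _ (sU ord_max)).
  have := fE' _ _ (F p (t 1)) sU'.
  rewrite k0 k1 fE// Kt !cexp_e2 !mulr1 => E.
  have n0 : e2 (f' s p) * e2 (k (s ord_max) p) != 0 by rewrite mulf_neq0// e2_neq0.
  apply: (mulIf n0); rewrite mul1r -[RHS]E -!e2D; congr (e2 _).
  by rewrite /m /k; ring.
have mc s p : inter N s p -> {for p, continuous (m s)}.
  move=> sp.
  have [_ _ _ /(_ p (sp ord0))[k0 _]] := Nkh (s ord0).
  have [_ _ _ /(_ p (sp ord_max))[k1 _]] := Nkh (s ord_max).
  have f0 := holomorphic_cont (inter_open U s) (hf s) (Uint _ _ _ sp).
  have f1 := holomorphic_cont (inter_open U' s) (hf' s) (U'int _ _ _ sp).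
  exact: (cvgD (cvgB f0 f1) (cvgB k0 k1)).
(* The default 0 is taken only where [m s p] is not an integer, hence never on [inter N s]. *)
pose M s p : int := xget 0 [set j : int | m s p = j%:~R].
have ME s p : inter N s p -> m s p = (M s p)%:~R.
  by move=> /mint[j jE]; rewrite /M; case: xgetP => [j' -> //|/(_ j)]; rewrite /= jE.
exists N, M; split.
- by split=> x p /NU[].
- move=> s p sp.
  have n1 : \forall q \near p, inter N s q.
    by apply: open_nbhs_nbhs; split=> //; exact: inter_open.
  have := int_near (M s p); rewrite -ME// => n2.
  have n3 : \forall q \near p, forall k' : int, m s q = k'%:~R -> k' = M s p := mc s p sp _ n2.
  by apply: filterS2 n1 n3 => q sq; apply; exact: ME.
move=> s p sp; apply: (@intr_inj C).
rewrite intrB cf ?cf'; [|exact: U'int|exact: Uint].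
rewrite !cobd_fun !cobd2E /=.
have sM x y : N x p -> N y p -> (M (pr x y) p)%:~R = m (pr x y) p.
  by move=> xp yp; rewrite ME//; apply/inter_pr.
rewrite intrD intrB !sM; try exact: sp.
by rewrite /m /pr /=; ring.
Qed.

End LineBundle.

Theorem mainTheorem5 (R : realType) (n : nat) (X : complexManifold R n)
    (X_compact : compact [set: X]) (X_kahler : kahler X)
    (alpha : H2 X (Cplx R)) :
  H11Z alpha -> exists P : Pic X, H2_ZC (c1 P) = alpha.
Proof.
move=> [[beta _ betaE] [w [c [_ w11 [theta [f [thE fE cE]]] cE']]]].
(* [c] and the integral cocycle [repr beta] have the same complex class; [e] is the locally constant
   cochain bounding their difference on a common refinement. *)
have [U0 [e [[U0c U0b] le eE]]] :
    cohomologous c (cocycle2_map (intr : {additive int -> Cplx R}) (repr beta)).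
  by apply/H2_classP; rewrite cE' -betaE.
have /choice[Nu Nuh] : forall x, exists Nu : set X * (X -> Cplx R),
    [/\ open Nu.1, Nu.1 x, Nu.1 `<=` U0 x & forall a z, img a Nu.1 z ->
      exists2 L : 'rV[Cplx R]_n -> Cplx R,
        @rdiff R (Cplx R) (cplx_Cplx R) n (Nu.2 \o cm_inv a) z L &
      @Clinear (Cplx R) n (fun h => L h - theta (fun=> x) a z h)].
  move=> x; have [fth dth] := thE (fun=> x).
  have Ux : inter (c2_cover c) (fun _ : 'I_1 => x) x by move=> i; exact: pc_mem.
  have [N [u [oN Nx NU hu]]] := dbar_primitive (inter_open _ _) Ux fth dth w11.
  exists (N `&` U0 x, u); split=> /=.
  - by apply: openI => //; exact: pc_open.
  - by split=> //; exact: pc_mem.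
  - by move=> p [].
  - by move=> a z [p [ap [Np _]] <-]; apply: hu; apply: img_chart.
pose N := @PCover X (fun x => (Nu x).1)
  (fun x => let: And4 o _ _ _ := Nuh x in o) (fun x => let: And4 _ o _ _ := Nuh x in o).
pose u x := (Nu x).2.
have NU0 x : N x `<=` U0 x by case: (Nuh x).
have Nint q (s : 'I_q -> X) p : inter N s p -> inter U0 s p.
  by move=> sp j; apply: NU0.
have cint q (s : 'I_q -> X) p : inter N s p -> inter (c2_cover c) s p.
  by move=> sp j; apply/U0c/NU0.
have bint q (s : 'I_q -> X) p : inter N s p -> inter (c2_cover (repr beta)) s p.
  by move=> sp j; apply/U0b/NU0.
(* The same cochain on the finer cover where the [u_x] are defined; its class is unchanged, the zero
   cochain bounding the difference. *)
pose b := @Cocycle2 X int N (repr beta)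
  (fun s p sp => c2_loc (bint _ s p sp)) (fun s p sp => c2_closed (bint _ s p sp)).
have bb : H2_class b = beta.
  rewrite -[RHS]reprK; apply/H2_classP; exists N, (fun _ _ => 0); split.
  - by split=> x p // /NU0/U0b.
  - by move=> s p _; near=> q.
  - by move=> s p _; rewrite subrr cobd_fun cobd0.
pose f' s p := f s p - e s p - (u (s ord_max) p - u (s ord0) p).
have [L Lb] : exists L, chern_cocycle L b.
  apply: (@chern_cocycle_exists _ _ _ b f') => s /=.
    have [ff df] := fE s.
    have NU x : N x `<=` c2_cover c x `&` U0 x by move=> p /NU0 h; split; [exact: U0c|].
    have hol := holomorphic_correction ff df (le s) NU (fun x => let: And4 _ _ _ h := Nuh x in h).
    move=> a z [p [ap sp] <-]; apply: hol; apply: img_chart => //.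
  move=> p sp.
  (* The [u] terms form a coboundary and disappear from [cobd f'], which is thus [cobd f - cobd e],
     the integral cocycle. *)
  have := eE s p (Nint _ _ _ sp); rewrite cE; last exact: cint.
  move/(canRL (subrK _))/(canLR (addKr _)); rewrite !cobd_fun !cobd2E /= => <-.
  by rewrite /f' /pr /=; ring.
exists (Pic_class L); rewrite -betaE; congr (H2_ZC _); rewrite -bb /c1.
(* Whatever bundle and cocycle [c1] selects, they are isomorphic to [L] and cohomologous to [b]; the
   default value is excluded because [L] and [b] themselves qualify. *)
case: xgetP => [y _ [L' [b' [/= LL' Lb' <-]]]|/(_ (H2_class b))[]].
  apply/H2_classP/cohomologous_sym; exact: chern_cocycle_cohomologous LL' Lb Lb'.
by exists L, b; split=> //; exact: lb_iso_refl.
Unshelve. all: by end_near. Qed.
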